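(* For each $n\ge 4$, the $n$-dimensional simply connected homogeneous Riemannian manifold $(G,g)$ defined in the context is irreducible. Its nullity distribution has codimension $3$ and its co-index of symmetry is $2$. Moreover, its Ricci tensor has four eigenvalues: zero with multiplicity $n-3$, $-a^2$, and $a^2\left(\frac{-1\pm\sqrt5}{2}\right)$. So $(G,g)$ has sectional curvatures of both signs and its scalar curvature is $-2a^2=\frac{-2}{3+(n-2)(n-3)}$.
   Context: Definition of $(G,g)$: let $n\ge4$, $d=n-1$, and let $a\in\mathbb R$ satisfy $a^2=\frac{1}{3+(n-2)(n-3)}$. Let $M_{d-1}=(m_{ij})$ be the $(d-1)\times(d-1)$ skew-symmetric matrix with $m_{ij}=1$ for $i<j$, let $e_1$ be the first canonical column vector of $\mathbb R^{d-1}$, and let $$A=\begin{bmatrix} aM_{d-1}& a e_1\\ -a e_1^t & a\end{bmatrix}$$ (so $\mathrm{trace}(AA^t)=1$). Let $G=\mathbb R^d\rtimes\mathbb R$ be the semidirect product in which $s\in\mathbb R$ acts on $\mathbb R^d$ by $\mathrm e^{sA}$. Regard $G$ as the connected Lie subgroup of $\mathrm{GL}(d+1,\mathbb R)$ whose Lie algebra is spanned by $E_i=\begin{bmatrix}0&e_i\\0&0\end{bmatrix}$ ($i=1,\dots,d$, with $e_1,\dots,e_d$ the canonical columns of $\mathbb R^d$) and $\mathbf A=\begin{bmatrix}A&0\\0&0\end{bmatrix}$. Let $g$ be the left invariant metric on $G$ whose restriction to the tangent space at the identity is $g(X,Y)=\mathrm{trace}(XY^t)$. The nullity at a point $p$ of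 a Riemannian manifold with curvature tensor $R$ is $\nu_p=\{v: R_{x,y}v=0\ \forall x,y\in T_pM\}$. A Killing field $X$ is a transvection at $q$ if $(\nabla X)_q=0$; the symmetric subspace at $q$ is $\mathfrak s_q=\{X_q: X\text{ is a Killing field which is a transvection at }q\}$. On a homogeneous manifold $\mathfrak s$ is an invariant distribution; the co-index of symmetry is its codimension. *)

(* Defs.v *)
From HB Require Import structures.
From mathcomp Require Import all_boot all_order all_algebra.
From mathcomp Require Import all_classical all_reals all_analysis.

Set Implicit Arguments.
Unset Strict Implicit.
Unset Printing Implicit Defensive.

Import Order.TTheory GRing.Theory Num.Theory numFieldNormedType.Exports.
Local Open Scope classical_set_scope.
Local Open Scope ring_scope.

(* Riemannian geometry is developed for Riemannian metrics on a manifold with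
   one global chart: the manifold is the space 'rV[R]_N, each tangent space is
   identified with 'rV[R]_N through the coordinate fields, and a metric is a
   field g of N x N Gram matrices.  Subspaces of a tangent space are row spaces
   of N x N matrices. *)

Section RiemannianGeometry.
Context {R : realType}.

(* C^oo: all iterated directional derivatives exist and are continuous
   (V and W are meant to be finite dimensional). *)
Definition smooth (V W : normedModType R) (f : V -> W) : Prop :=
  forall s : seq V,
    let h := foldr (fun v (k : V -> W) => (fun x => 'D_v k x)) f s in
    continuous h /\ forall x v, derivable h x v.

Definition simply_connected (T : topologicalType) : Prop :=
  (forall x y : T, exists c : R -> T,
     [/\ {within `[0, 1], continuous c}, c 0 = x & c 1 = y]) /\
  (forall c : R -> T, {within `[0, 1], continuous c} -> c 0 = c 1 ->
   exists H : R * R -> T,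
     [/\ {within `[0, 1] `*` `[0, 1], continuous H},
         (forall t, t \in `[0, 1] -> H (t, 0) = c t),
         (forall t, t \in `[0, 1] -> H (t, 1) = c 0) &
         (forall s, s \in `[0, 1] -> H (0, s) = c 0 /\ H (1, s) = c 0)]).

Context {N : nat}.
Implicit Types (p q u v w : 'rV[R]_N) (g : 'rV[R]_N -> 'M[R]_N).
Implicit Types X Y Z : 'rV[R]_N -> 'rV[R]_N.

Definition inner g p u v : R := (u *m g p *m v^T) 0 0.

Definition riemannian_metric g : Prop :=
  [/\ smooth g,
      (forall p, (g p)^T = g p) &
      (forall p u, u != 0 -> 0 < inner g p u u)].

(* Gamma^k_{ij} of the Levi-Civita connection. *)
Definition christoffel g p (i j k : 'I_N) : R :=
  2^-1 * \sum_l invmx (g p) k l *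
    ('D_(delta_mx 0 i) (fun q => g q j l) p
     + 'D_(delta_mx 0 j) (fun q => g q i l) p
     - 'D_(delta_mx 0 l) (fun q => g q i j) p).

Definition connection_form g p u v : 'rV[R]_N :=
  \row_k \sum_i \sum_j christoffel g p i j k * u 0 i * v 0 j.

(* (nabla_u Y) at the point p, where u is a tangent vector at p. *)
Definition nabla g u Y p : 'rV[R]_N := 'D_u Y p + connection_form g p u (Y p).

Definition lie_bracket X Y p : 'rV[R]_N := 'D_(X p) Y p - 'D_(Y p) X p.

(* R_{X,Y} Z = nabla_X nabla_Y Z - nabla_Y nabla_X Z - nabla_{[X,Y]} Z. *)
Definition curvature_field g X Y Z p : 'rV[R]_N :=
  nabla g (X p) (fun q => nabla g (Y q) Z q) p
  - nabla g (Y p) (fun q => nabla g (X q) Z q) p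
  - nabla g (lie_bracket X Y p) Z p.

(* The curvature tensor at p: tangent vectors are extended to fields with
   constant coefficients in the global chart. *)
Definition curvature g p u v w : 'rV[R]_N :=
  curvature_field g (cst u) (cst v) (cst w) p.

Definition nullity g p : set 'rV[R]_N :=
  [set v | forall x y, curvature g p x y v = 0].

(* Coordinate expression of L_X g = 0. *)
Definition killing g X : Prop :=
  smooth X /\
  forall p (i j : 'I_N),
    'D_(X p) (fun q => g q i j) p
    + \sum_k (g p k j * 'D_(delta_mx 0 i) (fun q => X q 0 k) p
              + g p i k * 'D_(delta_mx 0 j) (fun q => X q 0 k) p) = 0.

Definition transvection_at g q X : Prop :=
  killing g X /\ forall v, nabla g v X q = 0.

Definition symmetric_subspace g q : set 'rV[R]_N :=
  [set u | exists X, transvection_at g q X /\ X q = u].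

Definition has_codim (S : set 'rV[R]_N) (c : nat) : Prop :=
  exists V : 'M[R]_N, S = [set v | (v <= V)%MS] /\ (\rank V + c = N)%N.

Definition sectional g p u v : R :=
  inner g p (curvature g p u v v) u
  / (inner g p u u * inner g p v v - inner g p u v ^+ 2).

(* Ric(u, v) is the trace of x |-> R_{x,u} v. *)
Definition ricci g p u v : R :=
  \tr (lin1_mx (fun x => curvature g p x u v)).

(* The Ricci endomorphism, acting on row vectors from the right:
   inner g p (u *m ricci_op g p) v = Ric(u, v). *)
Definition ricci_op g p : 'M[R]_N :=
  (\matrix_(i, j) ricci g p (delta_mx 0 i) (delta_mx 0 j)) *m invmx (g p).

Definition scalar_curvature g p : R := \tr (ricci_op g p).

Definition isometry g (F : 'rV[R]_N -> 'rV[R]_N) : Prop :=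
  [/\ smooth F,
      (exists F', [/\ smooth F', cancel F F' & cancel F' F]) &
      (forall p u v, inner g (F p) ('D_u F p) ('D_v F p) = inner g p u v)].

Definition homogeneous g : Prop :=
  forall p q, exists F, isometry g F /\ F p = q.

(* parallel_transport g p u q w: the parallel transport along some piecewise
   smooth curve from p to q maps u to w.  Each smooth piece c is parametrized
   by [0, 1]; it is no restriction to let c, and hence the parallel field Y
   along c (a solution of a linear equation), be defined on the whole line. *)
Inductive parallel_transport g :
    'rV[R]_N -> 'rV[R]_N -> 'rV[R]_N -> 'rV[R]_N -> Prop :=
| parallel_transport_cst p u : parallel_transport g p u p u
| parallel_transport_cat (c Y : R -> 'rV[R]_N) q w :
    smooth c ->
    (forall t : R, is_derive t 1 Y (- connection_form g (c t) (derive1 c t) (Y t))) ->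
    parallel_transport g (c 1) (Y 1) q w ->
    parallel_transport g (c 0) (Y 0) q w.

(* The subspace V of the tangent space at p is invariant under the holonomy
   group at p. *)
Definition holonomy_invariant g p (V : 'M[R]_N) : Prop :=
  forall u w, parallel_transport g p u p w -> (u <= V)%MS -> (w <= V)%MS.

Definition irreducible_metric g : Prop :=
  forall p V, holonomy_invariant g p V -> \rank V = 0%N \/ \rank V = N.

End RiemannianGeometry.

Section TheGroup.
Context {R : realType}.

Definition expmx (m : nat) (B : 'M[R]_m) : 'M[R]_m :=
  lim ((fun r : nat => \sum_(i < r) (i`!%:R)^-1 *: (B ^+ i : 'M[R]_m)) @ \oo).

(* The connected Lie subgroup of GL(m, R) with Lie algebra h: the subgroup
   generated by the exponentials of the elements of h. *)
Inductive connected_lie_subgroup (m : nat) (h : set 'M[R]_m) : set 'M[R]_m :=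
| cls_exp B : h B -> connected_lie_subgroup h (expmx B)
| cls_one : connected_lie_subgroup h 1%:M
| cls_mul B C : connected_lie_subgroup h B -> connected_lie_subgroup h C ->
    connected_lie_subgroup h (B *m C)
| cls_inv B : connected_lie_subgroup h B -> connected_lie_subgroup h (invmx B).

(* Here k = d - 1 = n - 2, so that R^d = R^(k + 1) and G has dimension
   n = k + 1 + 1; a is the scalar in the definition of A. *)
Context (k : nat) (a : R).

Definition Mskew : 'M[R]_k := \matrix_(i, j) ((i < j)%N%:R - (j < i)%N%:R).

Definition e1 : 'cV[R]_k := \col_i ((i : nat) == 0%N)%:R.

Definition Amx : 'M[R]_(k + 1) :=
  block_mx (a *: Mskew) (a *: e1) (- (a *: e1^T)) a%:M.

Definition Emx (i : 'I_(k + 1)) : 'M[R]_(k + 1 + 1) :=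
  block_mx 0 (delta_mx i 0) 0 0.

Definition boldA : 'M[R]_(k + 1 + 1) := block_mx Amx 0 0 0.

Definition lie_algebra : set 'M[R]_(k + 1 + 1) :=
  [set B | exists (x : 'I_(k + 1) -> R) (s : R),
             B = \sum_i x i *: Emx i + s *: boldA].

(* The manifold R^d x R underlying the semidirect product G is 'rV_(k + 1 + 1),
   the last coordinate being the one of the factor R.  The element (x, s) is
   identified with the matrix [e^(sA), x; 0, 1]. *)
Definition embG (p : 'rV[R]_(k + 1 + 1)) : 'M[R]_(k + 1 + 1) :=
  block_mx (expmx ((rsubmx p) 0 0 *: Amx)) (lsubmx p)^T 0 1%:M.

(* The tangent vector u at p, left translated to the identity. *)
Definition left_translate (p u : 'rV[R]_(k + 1 + 1)) : 'M[R]_(k + 1 + 1) :=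
  invmx (embG p) *m 'D_u embG p.

Definition gG (p : 'rV[R]_(k + 1 + 1)) : 'M[R]_(k + 1 + 1) :=
  \matrix_(i, j) \tr (left_translate p (delta_mx 0 i)
                      *m (left_translate p (delta_mx 0 j))^T).

End TheGroup.

Arguments Amx {R} k a.
Arguments boldA {R} k a.
Arguments lie_algebra {R} k a _.
Arguments embG {R} k a p.
Arguments left_translate {R} k a p u.
Arguments gG {R} k a p.

(* Main.v *)
(* At a point (x, s) the metric is ds^2 + |e^(-sA) dx|^2, so every computation is done
   with the coordinates of tangent vectors in the left invariant frame.  Write
   A = S + W with S = a e_d e_d^t symmetric and W skew.  The leaves s = cst are flat,
   and since S has rank one the whole curvature is carried by the Jacobi operator J of
   the normal direction, J = S^2 + [S, W], which lives on span(e_1, e_d); this gives the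
   nullity and the Ricci tensor.  Constant horizontal fields orthogonal to e_d are
   transvections.  Conversely, differentiating the Killing equation twice along the
   normal shows that the derivative of a Killing field X = (Y, f) agrees with f A on the
   rows 1 and d, the symmetry of second derivatives then forces df = 0, and at a point
   where nabla X = 0 this gives f = 0 and Y_d = 0.  For irreducibility, rectangular loops
   show that the holonomy group contains the conjugates by all e^(tW) of the rotations in
   the plane (e_d, e_n); an invariant subspace thus either contains e_n and all e^(tW) e_d
   or is orthogonal to them, and e_d is a cyclic vector for W. *)

Require Import Defs.
From HB Require Import structures.
From mathcomp Require Import all_boot all_order all_algebra.
From mathcomp Require Import all_classical all_reals all_analysis.
From mathcomp Require Import ring lra zify.

Set Implicit Arguments.
Unset Strict Implicit.
Unset Printing Implicit Defensive.

Import Order.TTheory GRing.Theory Num.Theory numFieldNormedType.Exports.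
Local Open Scope classical_set_scope.
Local Open Scope ring_scope.

(** * Calculus of matrix valued functions *)

(** For the symmetric subspace, the obstacle is that every Killing field must be controlled, while
    only those generated by left translations are explicit. The field [(A x, 1)] is one of these, so
    for an arbitrary [X] with last component [f] the horizontal part of [DX - f A] is skew. The
    Hessian of [f] is expressed through row d of this skew part. Since [f] is constant along the
    normal, so is its Hessian, and one more normal derivative yields algebraic relations at a single
    point instead of a differential system. They are solvable because [A] couples e_1 and e_d by the
    nonzero entry [a]. Commuting mixed derivatives, used throughout, comes from the continuity of
    all iterated directional derivatives in [smooth].

    The golden ratio in the Ricci spectrum comes from the block a^2 [0, 1; 1, -1] on span(e_1, e_d).

    For irreducibility, the rotations of angle pi and pi/2 already extract the components of a
    vector in each rotated plane, and differentiating in [t] turns a condition on all e^(tW) into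
    stability under [W]. Cyclicity of e_d rests on a real skew matrix having no nonzero real
    eigenvalue. *)

Section Calculus.
Context {R : realType}.

Lemma is_derive_mxP (V : normedModType R) m n (M : V -> 'M[R]_(m, n)) x v dM :
  is_derive x v M dM <-> forall i j, is_derive x v (fun y => M y i j) (dM i j).
Proof.
split=> [[dM1 dM2] i j|H].
  split; first by move/derivable_mxP: dM1; apply.
  by rewrite -dM2 derive_mx // mxE.
have dM1 : derivable M x v by apply/derivable_mxP => i j; have [] := H i j.
split=> //; rewrite derive_mx //; apply/matrixP => i j; rewrite mxE.
by have [] := H i j.
Qed.

Lemma derive_entry (V : normedModType R) m n (M : V -> 'M[R]_(m, n)) x v i j :
  derivable M x v -> 'D_v (fun y => M y i j) x = ('D_v M x) i j.
Proof. by move=> dM; rewrite derive_mx // mxE. Qed.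

Lemma is_derive_sumr (V W : normedModType R) (I : Type) (r : seq I) (P : pred I)
    (f : I -> V -> W) x v df :
  (forall i, is_derive x v (f i) (df i)) ->
  is_derive x v (fun y => \sum_(i <- r | P i) f i y) (\sum_(i <- r | P i) df i).
Proof.
move=> H; elim: r => [|i r IH].
  rewrite big_nil; under eq_fun do rewrite big_nil; exact: is_derive_cst.
rewrite big_cons; under eq_fun do rewrite big_cons.
by case: (P i) => //; apply: is_deriveD.
Qed.

Lemma is_derive_mulr (V : normedModType R) (f g : V -> R) x v df dg :
  is_derive x v f df -> is_derive x v g dg ->
  is_derive x v (fun y => f y * g y) (df * g x + f x * dg).
Proof.
move=> Hf Hg; apply: (is_derive_eq (is_deriveM Hf Hg)).
by rewrite addrC /GRing.scale/= [g x * _]mulrC.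
Qed.

Lemma is_derive_mulmx (V : normedModType R) m n p (F : V -> 'M[R]_(m, n))
    (G : V -> 'M[R]_(n, p)) x v dF dG :
  is_derive x v F dF -> is_derive x v G dG ->
  is_derive x v (fun y => F y *m G y) (dF *m G x + F x *m dG).
Proof.
move=> /is_derive_mxP HF /is_derive_mxP HG; apply/is_derive_mxP => i j.
rewrite !mxE -big_split /=; under eq_fun do rewrite mxE.
by apply: is_derive_sumr => l; apply: is_derive_mulr.
Qed.

Lemma is_derive_mulmxl (V : normedModType R) m n p (C : 'M[R]_(m, n))
    (G : V -> 'M[R]_(n, p)) x v dG :
  is_derive x v G dG -> is_derive x v (fun y => C *m G y) (C *m dG).
Proof.
move=> HG; have := is_derive_mulmx (is_derive_cst C x v) HG.
by rewrite mul0mx add0r.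
Qed.

Lemma is_derive_mulmxr (V : normedModType R) m n p (F : V -> 'M[R]_(m, n))
    (C : 'M[R]_(n, p)) x v dF :
  is_derive x v F dF -> is_derive x v (fun y => F y *m C) (dF *m C).
Proof.
move=> HF; have := is_derive_mulmx HF (is_derive_cst C x v).
by rewrite mulmx0 addr0.
Qed.

Lemma is_derive_trmx (V : normedModType R) m n (F : V -> 'M[R]_(m, n)) x v dF :
  is_derive x v F dF -> is_derive x v (fun y => (F y)^T) dF^T.
Proof.
move=> /is_derive_mxP HF; apply/is_derive_mxP => i j; rewrite mxE.
by under eq_fun do rewrite mxE.
Qed.

Lemma is_derive_scalemx (V : normedModType R) m n (f : V -> R) (F : V -> 'M[R]_(m, n))
    x v df dF :
  is_derive x v f df -> is_derive x v F dF ->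
  is_derive x v (fun y => f y *: F y) (df *: F x + f x *: dF).
Proof.
move=> Hf /is_derive_mxP HF; apply/is_derive_mxP => i j; rewrite !mxE.
by under eq_fun do rewrite mxE; apply: is_derive_mulr.
Qed.

Lemma is_derive_coef (V : normedModType R) m n (F : V -> 'M[R]_(m, n)) i j x v dF :
  is_derive x v F dF -> is_derive x v (fun y => F y i j) (dF i j).
Proof. by move/is_derive_mxP. Qed.

Lemma derive_comp_linear (V V' W : normedModType R) (l : {linear V -> V'})
    (f : V' -> W) x v :
  'D_v (f \o l) x = 'D_(l v) f (l x) /\
  (derivable (f \o l) x v <-> derivable f (l x) (l v)).
Proof.
have E : (fun h : R => h^-1 *: (((f \o l) \o shift x) (h *: v) - (f \o l) x)) =
         (fun h : R => h^-1 *: ((f \o shift (l x)) (h *: l v) - f (l x))).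
  by apply/funext => h /=; rewrite linearP.
by rewrite /derive /derivable E.
Qed.

Lemma is_derive_comp_linear (V V' W : normedModType R) (l : {linear V -> V'})
    (f : V' -> W) x v df :
  is_derive (l x) (l v) f df -> is_derive x v (fun y => f (l y)) df.
Proof.
move=> [H1 H2]; have [H3 H4] := derive_comp_linear l f x v.
by split; [apply/H4|rewrite -H2 -H3].
Qed.

Lemma is_derive_affine (V W : normedModType R) (l : {linear V -> W}) (c : W) x v :
  is_derive x v (fun y => l y + c) (l v).
Proof.
have E : (fun h : R => h^-1 *: (((fun y => l y + c) \o shift x) (h *: v) - (l x + c)))
   @ 0^' --> l v.
  apply: cvg_near_cst; near=> h => /=.
  rewrite linearP -(addrA _ (l x) c) addrK scalerK //.
  by near: h; exact: nbhs_dnbhs_neq.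
by split; [apply: (cvgP _ E)|exact: (cvg_lim _ E)].
Unshelve. all: by end_near. Qed.

Lemma is_derive_linear (V W : normedModType R) (l : {linear V -> W}) x v :
  is_derive x v (fun y => l y) (l v).
Proof.
have := is_derive_affine l 0 x v.
by under eq_fun do rewrite addr0.
Qed.

(** For nonzero [c] the substitution [h -> c h] preserves punctured neighbourhoods of 0 and turns
    the difference quotient in direction [c v] into [c] times the one in direction [v]. *)
Lemma is_derive_scale_dir (V W : normedModType R) (f : V -> W) x v c df :
  is_derive x v f df -> is_derive x (c *: v) f (c *: df).
Proof.
case: (eqVneq c 0) => [->|c0] [H1 H2]; first by rewrite !scale0r; exact: is_derive0.
have E : (fun h : R => h^-1 *: ((f \o shift x) (h *: (c *: v)) - f x)) @ 0^' --> c *: df.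
  have -> : (fun h : R => h^-1 *: ((f \o shift x) (h *: (c *: v)) - f x)) =
    (fun h => c *: h) \; (fun h : R => c *: (h^-1 *: ((f \o shift x) (h *: v) - f x))).
    apply/funext => h /=.
    by rewrite [c *: h](_ : _ = c * h) // !scalerA invfM mulrA mulfV // mul1r [h * c]mulrC.
  apply: (@cvg_comp _ _ _ _ _ _ (0 : R)^').
    move=> A; rewrite /dnbhs /within /= => /nbhs_ballP[e e0 He].
    apply/nbhs_ballP; exists (e / `|c|) => /=; first by rewrite divr_gt0 ?normr_gt0.
    move=> y; rewrite /ball/= !sub0r !normrN ltr_pdivlMr ?normr_gt0// => yc y0.
    apply: He; first by rewrite /ball/= sub0r normrN normrM mulrC.
    by rewrite scaler_eq0 negb_or c0.
  by apply: cvgZr; rewrite -H2; exact: H1.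
by split; [apply: (cvgP _ E)|exact: (cvg_lim _ E)].
Qed.

Lemma is_derive_comp_scalar (V W : normedModType R) (l : {linear V -> R^o})
    (f : R -> W) (x v : V) df :
  is_derive (l x : R) 1 f df -> is_derive x v (fun y => f (l y)) (l v *: df).
Proof.
move=> H; apply: is_derive_comp_linear.
by have := is_derive_scale_dir (l v) H; rewrite [l v *: 1]mulr1.
Qed.

Lemma is_derive_continuous (W : normedModType R) (f df : R -> W) :
  (forall t : R, is_derive t 1 f (df t)) -> continuous f.
Proof.
move=> H t; apply/differentiable_continuous/derivable1_diffP.
by have [] := H t.
Qed.

Lemma is_derive0_cst_mx m n (F : R -> 'M[R]_(m, n)) :
  (forall t : R, is_derive t 1 F 0) -> forall s t, F s = F t.
Proof.
move=> H s t; apply/matrixP => i j.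
apply: (@is_derive_0_is_cst _ (fun y => F y i j)) => y.
by have := is_derive_coef i j (H y); rewrite mxE.
Qed.

Lemma is_derive_unique (V W : normedModType R) (f : V -> W) x v d d' :
  is_derive x v f d -> is_derive x v f d' -> d = d'.
Proof. by move=> [_ <-] [_ <-]. Qed.

(** Smoothness quantifies over all iterated derivatives; a class of continuous functions stable
    under directional derivatives is the invariant for the induction on the list of directions. *)
Lemma smooth_closed (V W : normedModType R) (C : (V -> W) -> Prop) :
  (forall f, C f -> continuous f) ->
  (forall f v, C f -> exists2 df, C df & forall x, is_derive x v f (df x)) ->
  forall f, C f -> smooth f.
Proof.
move=> Ccont Cder f Cf s.
have H : C (foldr (fun v (k : V -> W) => (fun x => 'D_v k x)) f s).
  elim: s => //= v s IH; have [df Cdf Hd] := Cder _ v IH.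
  suff -> : (fun x => 'D_v (foldr (fun v (k : V -> W) => (fun x => 'D_v k x)) f s) x) = df by [].
  by apply/funext => x; have [] := Hd x.
split; first exact: Ccont.
by move=> x v; have [df _ Hd] := Cder _ v H; have [] := Hd x.
Qed.

Lemma smooth_derive (V W : normedModType R) (f : V -> W) v :
  smooth f -> smooth (fun x => 'D_v f x).
Proof.
move=> sf s; have := sf (rcons s v).
by rewrite foldr_rcons.
Qed.

Lemma smooth_derivable (V W : normedModType R) (f : V -> W) x v :
  smooth f -> derivable f x v.
Proof. by move=> /(_ [::])[_]. Qed.

Lemma smooth_is_derive (V W : normedModType R) (f : V -> W) x v :
  smooth f -> is_derive x v f ('D_v f x).
Proof. by move=> sf; apply/derivableP/smooth_derivable. Qed.

Lemma smooth_continuous (V W : normedModType R) (f : V -> W) :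
  smooth f -> continuous f.
Proof. by move=> /(_ [::])[]. Qed.

Lemma smooth_coef (V : normedModType R) m n (F : V -> 'M[R]_(m, n)) i j :
  smooth F -> smooth (fun x => F x i j).
Proof.
move=> sF s.
have -> : foldr (fun v (k : V -> R) => (fun x => 'D_v k x)) (fun x => F x i j) s =
  (fun x => foldr (fun v (k : V -> 'M[R]_(m, n)) => (fun x => 'D_v k x)) F s x i j).
  elim: s => //= v s ->; apply/funext => x.
  by rewrite derive_entry //; have [_] := sF s.
have [cF dF] := sF s; split.
  move=> x; apply: (@continuous_comp _ _ _ _ (fun M : 'M[R]_(m, n) => M i j) x).
    exact: cF.
  exact: coord_continuous.
by move=> x v; move/derivable_mxP: (dF x v).
Qed.

End Calculus.

(** * Second derivatives and linearity of directional derivatives *)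

Section Schwarz.
Context {R : realType} {V : normedModType R}.

Lemma is_derive_line (W : normedModType R) (f : V -> W) (u y : V) (s : R) df :
  is_derive (s *: u + y) u f df -> is_derive s 1 (fun t : R => f (t *: u + y)) df.
Proof.
have E : (fun h : R => h^-1 *: (((fun t : R => f (t *: u + y)) \o shift s) (h *: (1 : R))
                 - f (s *: u + y))) =
         (fun h : R => h^-1 *: ((f \o shift (s *: u + y)) (h *: u) - f (s *: u + y))).
  by apply/funext => h /=; rewrite [h *: 1]mulr1 scalerDl addrA.
by move=> [H1 H2]; split; rewrite /derivable /derive E.
Qed.

(** The mean value theorem is applied twice: to [f (t u + h v + x) - f (t u + x)] in [t], then to
    ['D_u f] along [v]. The left side is symmetric in [u] and [v], which is what [derive_comm]
    exploits. *)
Lemma second_difference_mean (f : V -> R) (u v x : V) (h : R) : smooth f -> 0 < h ->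
  exists s t : R, [/\ 0 < s < h, 0 < t < h &
    f (h *: u + (h *: v + x)) - f (h *: u + x) - (f (h *: v + x) - f x)
    = 'D_v (fun y => 'D_u f y) (t *: v + (s *: u + x)) * h ^+ 2].
Proof.
move=> sf h0.
have [s sh Es] := @MVT _ (fun t : R => f (t *: u + (h *: v + x)) - f (t *: u + x))
  (fun t : R => 'D_u f (t *: u + (h *: v + x)) - 'D_u f (t *: u + x)) 0 h h0
  (fun t _ => is_deriveB
     (is_derive_line (smooth_is_derive (t *: u + (h *: v + x)) u sf))
     (is_derive_line (smooth_is_derive (t *: u + x) u sf)))
  (continuous_subspaceT (is_derive_continuous (fun t =>
     is_deriveB
     (is_derive_line (smooth_is_derive (t *: u + (h *: v + x)) u sf))
     (is_derive_line (smooth_is_derive (t *: u + x) u sf))))).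
have sD := smooth_derive u sf.
have HD (t : R) : is_derive t 1 (fun t : R => 'D_u f (t *: v + (s *: u + x)))
  ('D_v (fun y => 'D_u f y) (t *: v + (s *: u + x))).
  exact: (is_derive_line (smooth_is_derive (t *: v + (s *: u + x)) v sD)).
have [t th Et] := @MVT _ _ _ 0 h h0 (fun t _ => HD t)
  (continuous_subspaceT (is_derive_continuous HD)).
move: Es Et; rewrite !scale0r !add0r !subr0 => -> Et.
exists s, t; split; [by rewrite in_itv in sh|by rewrite in_itv in th|].
by rewrite expr2 mulrA -Et addrCA.
Qed.

Lemma continuous_parallelogram (F : V -> R) (u v x : V) (d : R) :
  {for x, continuous F} -> 0 < d ->
  exists2 r, 0 < r & forall s t h : R, 0 < h < r -> 0 <= s <= h -> 0 <= t <= h ->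
    `|F x - F (t *: v + (s *: u + x))| < d.
Proof.
move=> cF d0; move/cvgrPdist_lt: cF => /(_ d d0) /nbhs_ballP[r r0 Hr].
(* The [+ 1] keeps [M] positive when [u] and [v] both vanish. *)
pose M := `|u| + `|v| + 1.
have M0 : 0 < M by rewrite ltr_wpDl ?addr_ge0.
exists (r / M) => [|s t h /andP[h0 hr] /andP[s0 sh] /andP[t0 th]]; first by rewrite divr_gt0.
apply: Hr; rewrite -ball_normE /ball_ /=.
have -> : x - (t *: v + (s *: u + x)) = - (t *: v + s *: u).
  by rewrite addrA [X in _ - X]addrC opprD addrA subrr add0r.
rewrite normrN.
apply: le_lt_trans (ler_normD _ _) _; rewrite !normrZ !ger0_norm //.
move: hr; rewrite ltr_pdivlMr //; apply: le_lt_trans.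
rewrite /M !mulrDr mulr1 [h * _ + _]addrC.
apply: ler_wpDr; first exact: ltW.
by apply: lerD; apply: ler_wpM2r.
Qed.

(** Equality of the second differences for [(u, v)] and [(v, u)] makes the two mixed derivatives
    agree at two points of a small parallelogram; continuity brings both points back to [x]. *)
Lemma derive_comm (f : V -> R) (u v x : V) : smooth f ->
  'D_u (fun y => 'D_v f y) x = 'D_v (fun y => 'D_u f y) x.
Proof.
move=> sf; apply/eqP; rewrite -subr_eq0 -normr_le0; apply/ler_addgt0Pl => e e0.
rewrite addr0.
pose F u v := fun y => 'D_v (fun z => 'D_u f z) y.
have cF u' v' : {for x, continuous (F u' v')}.
  exact: (smooth_continuous (smooth_derive v' (smooth_derive u' sf))).
have e20 : 0 < e / 2 by rewrite divr_gt0.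
have [r1 r10 H1] := continuous_parallelogram u v (cF u v) e20.
have [r2 r20 H2] := continuous_parallelogram v u (cF v u) e20.
pose h := Num.min r1 r2 / 2.
have m0 : 0 < Num.min r1 r2 by rewrite lt_min r10.
have h0 : 0 < h by rewrite divr_gt0.
have hm : h < Num.min r1 r2 by rewrite ltr_pdivrMr // mulr_natr mulr2n ltrDl.
have [hr1 hr2] : h < r1 /\ h < r2 by move: hm; rewrite lt_min => /andP.
have [s [t [sh th E1]]] := second_difference_mean u v x sf h0.
have [s' [t' [sh' th' E2]]] := second_difference_mean v u x sf h0.
have itv y : 0 < y < h -> 0 <= y <= h by move=> /andP[/ltW-> /ltW->].
have := H1 s t h; rewrite h0 hr1 (itv s) // (itv t) // => /(_ isT isT isT) B1.
have := H2 s' t' h; rewrite h0 hr2 (itv s') // (itv t') // => /(_ isT isT isT) B2.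
have E : F u v (t *: v + (s *: u + x)) = F v u (t' *: u + (s' *: v + x)).
  have h20 : h ^+ 2 != 0 by rewrite expf_neq0 ?gt_eqF.
  apply: (mulIf h20); apply: (etrans (esym E1)); apply: etrans E2.
  by rewrite [h *: v + (h *: u + x)]addrCA; ring.
have -> : 'D_u (fun y => 'D_v f y) x - 'D_v (fun y => 'D_u f y) x =
  (F v u x - F v u (t' *: u + (s' *: v + x))) - (F u v x - F u v (t *: v + (s *: u + x))).
  by rewrite E /F opprB addrA subrK.
apply: le_trans (ler_normB _ _) _; rewrite (splitr e).
exact: (lerD (ltW B2) (ltW B1)).
Qed.

(** Existence of directional derivatives does not make them additive; their continuity does. The
    increment along [u + v] is split into one along [v] and one along [u], each evaluated by the
    mean value theorem. *)
Lemma derive_dirD (f : V -> R) (u v x : V) : smooth f ->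
  'D_(u + v) f x = 'D_u f x + 'D_v f x.
Proof.
move=> sf; apply/eqP; rewrite -subr_eq0 -normr_le0; apply/ler_addgt0Pl => e e0.
rewrite addr0.
have cF w : {for x, continuous (fun y => 'D_w f y)}.
  exact: (smooth_continuous (smooth_derive w sf)).
have e30 : 0 < e / 3 by rewrite divr_gt0.
have [r1 r10 H1] := continuous_parallelogram u v (cF u) e30.
have [r2 r20 H2] := continuous_parallelogram u v (cF v) e30.
have /cvgrPdist_lt /(_ _ e30) := @smooth_derivable _ _ _ f x (u + v) sf.
rewrite -/('D_(u + v) f x) => /nbhs_ballP[r3 /= r30 H3].
pose h := Num.min r1 (Num.min r2 r3) / 2.
have m0 : 0 < Num.min r1 (Num.min r2 r3) by rewrite !lt_min r10 r20.
have h0 : 0 < h by rewrite divr_gt0.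
have hm : h < Num.min r1 (Num.min r2 r3) by rewrite ltr_pdivrMr // mulr_natr mulr2n ltrDl.
have [hr1 hr2 hr3] : [/\ h < r1, h < r2 & h < r3] by move: hm; rewrite !lt_min => /and3P.
have D (w y : V) (t : R) : is_derive t 1 (fun t : R => f (t *: w + y)) ('D_w f (t *: w + y)).
  exact: (is_derive_line (smooth_is_derive (t *: w + y) w sf)).
have [s sh Es] := @MVT _ _ _ 0 h h0 (fun t _ => D u (h *: v + x) t)
  (continuous_subspaceT (is_derive_continuous (D u (h *: v + x)))).
have [t th Et] := @MVT _ _ _ 0 h h0 (fun t _ => D v x t)
  (continuous_subspaceT (is_derive_continuous (D v x))).
rewrite !scale0r !add0r !subr0 in Es Et.
have itv y : y \in `]0, h[ -> 0 <= y <= h by rewrite in_itv /= => /andP[/ltW-> /ltW->].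
have := H1 s h h; rewrite h0 hr1 (itv s) // lexx (ltW h0) => /(_ isT isT isT).
rewrite addrCA => B1.
have := H2 0 t h; rewrite h0 hr2 (itv t) // lexx (ltW h0) => /(_ isT isT isT).
rewrite scale0r add0r => B2.
have := H3 h; rewrite /ball /= sub0r normrN gtr0_norm // => /(_ hr3).
rewrite gt_eqF // => /(_ isT) /= B3.
have E : h^-1 *: (f (h *: (u + v) + x) - f x) =
  'D_u f (s *: u + (h *: v + x)) + 'D_v f (t *: v + x).
  have -> : h *: (u + v) + x = h *: u + (h *: v + x) by rewrite scalerDr addrA.
  apply: (mulfI (lt0r_neq0 h0)); rewrite /GRing.scale /= mulVKf ?gt_eqF //.
  by rewrite mulrDr ![h * _]mulrC -Es -Et; ring.
rewrite E in B3.
set d := 'D_(u + v) f x in B3 *; set d1 := 'D_u f x in B1 *; set d2 := 'D_v f x in B2 *.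
set e1 := 'D_u f _ in B1 B3; set e2 := 'D_v f _ in B2 B3.
have -> : d - (d1 + d2) = (d - (e1 + e2)) - (d1 - e1) - (d2 - e2) by ring.
apply: le_trans (ler_normB _ _) _; apply: le_trans (lerD (ler_normB _ _) (lexx _)) _.
have -> : e = e / 3 + e / 3 + e / 3 by field.
exact: (lerD (lerD (ltW B3) (ltW B1)) (ltW B2)).
Qed.

Lemma derive_dirP m n (F : V -> 'M[R]_(m, n)) (c : R) (u v x : V) : smooth F ->
  'D_(c *: u + v) F x = c *: 'D_u F x + 'D_v F x.
Proof.
move=> sF; apply/matrixP => i j; rewrite [RHS]mxE [X in _ = X + _]mxE.
have E w : 'D_w F x i j = 'D_w (fun y => F y i j) x.
  by rewrite derive_entry //; exact: smooth_derivable.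
apply: (etrans (E _)); apply: (etrans (derive_dirD _ _ _ (smooth_coef i j sF))).
apply: (congr2 +%R _ (esym (E v))); apply: (etrans _ (congr1 ( *%R c) (esym (E u)))).
by have [_ ->] := is_derive_scale_dir c (smooth_is_derive x u (smooth_coef i j sF)).
Qed.

Lemma derive_mx_comm m n (F : V -> 'M[R]_(m, n)) (u v x : V) : smooth F ->
  'D_u (fun y => 'D_v F y) x = 'D_v (fun y => 'D_u F y) x.
Proof.
move=> sF; apply/matrixP => i j.
have E w w' : 'D_w (fun y => 'D_w' F y) x i j = 'D_w (fun y => 'D_w' (fun z => F z i j) y) x.
  rewrite -derive_entry; last exact/smooth_derivable/smooth_derive.
  congr ('D_w _ x); apply/funext => y; rewrite derive_entry //; exact: smooth_derivable.
exact: (etrans (E u v) (etrans (derive_comm u v x (smooth_coef i j sF)) (esym (E v u)))).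
Qed.

End Schwarz.

(** * The matrix exponential *)

Section MatrixLimits.
Context {R : realType}.

Lemma cvg_mxP (T : Type) (F : set_system T) (FF : Filter F) m n
    (u : T -> 'M[R]_(m, n)) (M : 'M[R]_(m, n)) :
  (forall i j, (fun x => u x i j) @ F --> M i j) -> u @ F --> M.
Proof.
move=> H; apply/cvg_ballP => e e0; near=> x; split=> // i j.
move: i j; near: x; apply: filter_forall => i; apply: filter_forall => j.
by have /cvg_ballP/(_ e e0) := H i j.
Unshelve. all: by end_near. Qed.

Lemma cvg_mx_coef (T : Type) (F : set_system T) (FF : Filter F) m n
    (u : T -> 'M[R]_(m, n)) (M : 'M[R]_(m, n)) i j :
  u @ F --> M -> (fun x => u x i j) @ F --> M i j.
Proof.
by move=> H; apply: (@cvg_comp _ _ _ u (fun M : 'M[R]_(m, n) => M i j) _ _ _ H);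
  exact: coord_continuous.
Qed.

Lemma cvg_mulmx (T : Type) (F : set_system T) (FF : Filter F) m n p
    (u : T -> 'M[R]_(m, n)) (v : T -> 'M[R]_(n, p))
    (M : 'M[R]_(m, n)) (N : 'M[R]_(n, p)) :
  u @ F --> M -> v @ F --> N -> (fun x => u x *m v x) @ F --> M *m N.
Proof.
move=> Hu Hv; apply: cvg_mxP => i j; rewrite mxE; under eq_cvg do rewrite mxE.
apply: cvg_big => [|l _]; first exact: add_continuous.
by apply: cvgM; exact: cvg_mx_coef.
Qed.

End MatrixLimits.

Lemma is_derive_comp_affine {R : realType} (W : normedModType R) (f : R -> W) (c z t : R) df :
  is_derive (c * t + z) 1 f df -> is_derive t 1 (fun t => f (c * t + z)) (c *: df).
Proof.
move=> /(is_derive_scale_dir c) [H1 H2].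
have E : (fun h : R => h^-1 *: (((fun t : R => f (c * t + z)) \o shift t) (h *: (1 : R))
                 - f (c * t + z))) =
   (fun h : R => h^-1 *: ((f \o shift (c * t + z)) (h *: (c *: (1 : R))) - f (c * t + z))).
  apply/funext => h /=; congr (_ *: (f _ - _)).
  by rewrite /GRing.scale /=; ring.
by split; rewrite /derivable /derive E.
Qed.

Section MatrixExponential.
Context {R : realType} (m : nat).
Implicit Types B C : 'M[R]_m.

Definition expmx_sum B (r : nat) : 'M[R]_m := \sum_(i < r) (i`!%:R)^-1 *: B ^+ i.

Lemma scalemx_expr (x : R) B n : (x *: B) ^+ n = x ^+ n *: B ^+ n.
Proof.
elim: n => [|n IH]; first by rewrite !expr0 scale1r.
by rewrite !exprS IH -[_ * _]scalemxAl -[B *m _]scalemxAr scalerA.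
Qed.

Lemma expmx_limE B : expmx B = lim (expmx_sum B @ \oo).
Proof. by []. Qed.

Lemma norm_coef_le p q (M : 'M[R]_(p, q)) i j : `|M i j| <= `|M|.
Proof.
rewrite [leRHS]/Num.Def.normr /= mx_normrE.
exact: (le_bigmax _ (fun ij => `|M ij.1 ij.2|) (i, j)).
Qed.

Lemma norm_mulmx_expr_le B C n i j :
  `|(C *m B ^+ n) i j| <= `|C| * (m%:R * `|B|) ^+ n.
Proof.
elim: n i j => [|n IH] i j; first by rewrite expr0 mulr1 mulmx1 norm_coef_le.
rewrite exprSr [B ^+ n * B]/(B ^+ n *m B) mulmxA mxE.
apply: le_trans (ler_norm_sum _ _ _) _.
apply: (@le_trans _ _ (\sum_(l < m) (`|C| * (m%:R * `|B|) ^+ n * `|B|))).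
  apply: ler_sum => l _; rewrite normrM.
  by apply: ler_pM; rewrite ?normr_ge0 ?norm_coef_le ?IH.
rewrite sumr_const card_ord -mulr_natl le_eqVlt; apply/orP; left; apply/eqP.
by rewrite exprSr; ring.
Qed.

(** The power series coefficients of [x |-> (C e^(xB))_ij]. The left factor [C] keeps the family
    stable under termwise differentiation, which replaces [C] by [C B]. *)
Let ce B C i j n : R := (n`!%:R)^-1 * (C *m B ^+ n) i j.

(** Dominated by the exponential series at [m |B| |x|]; the factor [m] appears because the matrix
    norm is the maximum of the entries. *)
Let is_cvg_ce B C i j x : cvgn (pseries (ce B C i j) x).
Proof.
apply: normed_cvg.
pose K := m%:R * `|B| * `|x|.
have K0 : 0 <= K by rewrite !mulr_ge0.
apply: (@series_le_cvg _ _ (`|C| *: exp_coeff K)) => [n|n|n|].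
- exact: normr_ge0.
- by rewrite /exp_coeff !fctE /= mulr_ge0 // mulr_ge0 ?exprn_ge0.
- have -> : (`|C| *: exp_coeff K) n = n`!%:R^-1 * (`|C| * (m%:R * `|B|) ^+ n) * `|x| ^+ n.
    by rewrite fctE /exp_coeff /K /= exprMn /GRing.scale /=; ring.
  rewrite /ce /= !normrM normfV normr_nat normrX.
  by do 2?[rewrite ler_wpM2r ?exprn_ge0 //]; rewrite ler_wpM2l ?invr_ge0 ?norm_mulmx_expr_le.
- exact/is_cvg_seriesZ/is_cvg_series_exp_coeff.
Qed.

Let pseries_ce B C i j x n :
  pseries (ce B C i j) x n = (C *m expmx_sum (x *: B) n) i j.
Proof.
rewrite /pseries /expmx_sum /series /= big_mkord mulmx_sumr summxE.
apply: eq_bigr => l _; rewrite /ce scalemx_expr scalerA -scalemxAr.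
by rewrite [RHS]mxE mulrAC.
Qed.

Lemma cvg_expmx_sum B : expmx_sum B @ \oo --> expmx B.
Proof.
have H : expmx_sum B @ \oo --> \matrix_(i, j) limn (pseries (ce B 1%:M i j) 1).
  apply: cvg_mxP => i j; rewrite mxE.
  have -> : (fun n => expmx_sum B n i j) = pseries (ce B 1%:M i j) 1.
    by apply/funext => n; rewrite pseries_ce mul1mx scale1r.
  exact: is_cvg_ce.
by rewrite expmx_limE (cvg_lim _ H).
Qed.

Let lim_ce B C i j x : limn (pseries (ce B C i j) x) = (C *m expmx (x *: B)) i j.
Proof.
apply: cvg_lim => //.
rewrite (_ : pseries _ _ = (fun n => (C *m expmx_sum (x *: B) n) i j)); last first.
  by apply/funext => n; rewrite pseries_ce.
have H : (fun n => C *m expmx_sum (x *: B) n) @ \oo --> C *m expmx (x *: B).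
  by apply: cvg_mulmx; [exact: cvg_cst|exact: cvg_expmx_sum].
exact: cvg_mx_coef H.
Qed.

Lemma expmx_comm B C : C *m B = B *m C -> C *m expmx B = expmx B *m C.
Proof.
move=> CB; have Ck n : C *m B ^+ n = B ^+ n *m C.
  elim: n => [|n IH]; first by rewrite expr0 mulmx1 mul1mx.
  by rewrite exprS [B * _]/(B *m _) mulmxA CB -mulmxA IH mulmxA.
have E n : C *m expmx_sum B n = expmx_sum B n *m C.
  rewrite mulmx_sumr mulmx_suml; apply: eq_bigr => i _.
  by rewrite -scalemxAr -scalemxAl Ck.
have H1 : (fun n => C *m expmx_sum B n) @ \oo --> C *m expmx B.
  by apply: cvg_mulmx; [exact: cvg_cst|exact: cvg_expmx_sum].
have H2 : (fun n => C *m expmx_sum B n) @ \oo --> expmx B *m C.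
  under eq_cvg do rewrite E.
  by apply: cvg_mulmx; [exact: cvg_expmx_sum|exact: cvg_cst].
exact: cvg_unique H1 H2.
Qed.

Lemma expmx_commZ B (t : R) : B *m expmx (t *: B) = expmx (t *: B) *m B.
Proof. by apply: expmx_comm; rewrite -scalemxAr -scalemxAl. Qed.

Lemma is_derive_expmx B (t : R) :
  is_derive t 1 (fun t => expmx (t *: B)) (B *m expmx (t *: B)).
Proof.
apply/is_derive_mxP => i j.
have E C : pseries_diffs (ce B C i j) = ce B (C *m B) i j.
  apply/funext => n; rewrite /pseries_diffs /ce factS natrM invfM.
  rewrite mulrA mulrA mulfV ?pnatr_eq0 // mul1r exprS.
  by rewrite [B * _]/(B *m _) mulmxA.
have -> : (fun t : R => expmx (t *: B) i j) = (fun t => limn (pseries (ce B 1%:M i j) t)).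
  by apply/funext => y; rewrite lim_ce mul1mx.
have E1 : ce B B i j = pseries_diffs (ce B 1%:M i j) by rewrite E mul1mx.
rewrite -lim_ce E1.
apply: (@pseries_snd_diffs _ _ (`|t| + 1)); rewrite ?E; try exact: is_cvg_ce.
by rewrite [ltRHS]ger0_norm ?ltrDl // addr_ge0.
Qed.

Lemma expmx0 : expmx (0 : 'M[R]_m) = 1%:M.
Proof.
rewrite expmx_limE; apply: cvg_lim => //.
apply: cvg_near_cst; exists 1%N => // n /= n1.
rewrite /expmx_sum -(prednK n1) big_ord_recl /= big1 ?addr0.
  by rewrite expr0 fact0 invr1 scale1r.
by move=> i _; rewrite expr0n /= scaler0.
Qed.

Lemma is_derive_expmxN B (t : R) :
  is_derive t 1 (fun t => expmx (- t *: B)) (- (B *m expmx (- t *: B))).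
Proof.
have E (y : R) : -1 * y + 0 = - y by rewrite addr0 mulN1r.
have := @is_derive_comp_affine _ _ (fun t : R => expmx (t *: B)) (-1) 0 t.
rewrite E => /(_ _ (is_derive_expmx B (- t))); rewrite scaleN1r.
by under eq_fun do rewrite E.
Qed.

Lemma is_derive_expmx_shift B (t z : R) :
  is_derive t 1 (fun t => expmx ((t + z) *: B)) (B *m expmx ((t + z) *: B)).
Proof.
have := @is_derive_comp_affine _ _ (fun t : R => expmx (t *: B)) 1 z t.
rewrite mul1r => /(_ _ (is_derive_expmx B (t + z))); rewrite scale1r.
by under eq_fun do rewrite mul1r.
Qed.

(** The product [e^(-yB) e^((y+z)B)] has zero derivative in [y], hence equals its value [e^(zB)] at
    0; the case [z = 0] provides inverses. Such products with vanishing derivative replace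
    manipulations of series in the later computations of exponentials too. *)
Lemma expmxD B (s t : R) : expmx ((s + t) *: B) = expmx (s *: B) *m expmx (t *: B).
Proof.
have inv z y : expmx (- y *: B) *m expmx ((y + z) *: B) = expmx (z *: B).
  have := @is_derive0_cst_mx _ _ _ (fun y => expmx (- y *: B) *m expmx ((y + z) *: B)) _ y 0.
  rewrite oppr0 scale0r expmx0 mul1mx add0r; apply => x.
  apply: is_derive_eq (is_derive_mulmx (is_derive_expmxN B x) (is_derive_expmx_shift B x z)) _.
  by rewrite mulNmx (expmx_commZ B (- x)) -mulmxA addNr.
have invr y : expmx (y *: B) *m expmx (- y *: B) = 1%:M.
  by have := inv 0 (- y); rewrite addr0 opprK scale0r expmx0.
by rewrite -[RHS](mulmx1) -(inv t s) mulmxA invr mul1mx mulmx1.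
Qed.

Lemma expmxN B (s : R) : expmx (s *: B) *m expmx (- s *: B) = 1%:M.
Proof. by rewrite -expmxD subrr scale0r expmx0. Qed.

End MatrixExponential.

(** * The matrix A *)

Lemma mulmx_deltaE (R : pzSemiRingType) m n (M : 'M[R]_(m, n)) j i :
  (M *m delta_mx j (0 : 'I_1)) i 0 = M i j.
Proof.
rewrite mxE (bigD1 j) //= mxE !eqxx mulr1 big1 ?addr0 // => l lj.
by rewrite mxE (negPf lj) mulr0.
Qed.

Lemma delta_mulmxE (R : pzSemiRingType) m n (M : 'M[R]_(m, n)) i j :
  (delta_mx (0 : 'I_1) i *m M) 0 j = M i j.
Proof. by rewrite -rowE mxE. Qed.

Lemma mulmx_delta_trE (R : pzSemiRingType) m n p q (M : 'M[R]_(m, n)) (L : 'M[R]_(p, q)) x y i j :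
  (M *m delta_mx x y *m L^T) i j = M i x * L j y.
Proof.
rewrite -(mul_delta_mx (0 : 'I_1)) mulmxA -mulmxA [LHS]mxE big_ord1.
by rewrite mulmx_deltaE delta_mulmxE mxE.
Qed.

Section MatrixCoefficients.
Context {R : pzRingType} {m n : nat}.
Implicit Types M : 'M[R]_(m, n).

Lemma addmx_coef M (M' : 'M[R]_(m, n)) i j : (M + M') i j = M i j + M' i j. Proof. by rewrite mxE. Qed.
Lemma oppmx_coef M i j : (- M) i j = - M i j. Proof. by rewrite mxE. Qed.
Lemma scalemx_coef c M i j : (c *: M) i j = c * M i j. Proof. by rewrite mxE. Qed.
Lemma zeromx_coef i j : (0 : 'M[R]_(m, n)) i j = 0. Proof. by rewrite mxE. Qed.
Lemma trmx_coef M i j : M^T j i = M i j. Proof. by rewrite mxE. Qed.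
Lemma deltamx_coef i' j' i j : (delta_mx i' j' : 'M[R]_(m, n)) i j = ((i == i') && (j == j'))%:R.
Proof. by rewrite mxE. Qed.

End MatrixCoefficients.

(* [mxE] would also unfold the block structure of the matrices at hand. *)
Definition coefmxE :=
  (@addmx_coef, @oppmx_coef, @scalemx_coef, @zeromx_coef, @trmx_coef, @deltamx_coef).

(* The indices 1, d = n - 1 and n of the paper, for k = n - 3. *)
HB.lock Definition idx1 {k : nat} : 'I_(k.+1 + 1 + 1) := lshift 1 (lshift 1 ord0).
HB.lock Definition idxd {k : nat} : 'I_(k.+1 + 1 + 1) := lshift 1 (rshift k.+1 ord0).
HB.lock Definition idxn {k : nat} : 'I_(k.+1 + 1 + 1) := rshift (k.+1 + 1) ord0.

Lemma idx1E k : @idx1 k = lshift 1 (lshift 1 ord0). Proof. by rewrite unlock. Qed.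
Lemma idxdE k : @idxd k = lshift 1 (rshift k.+1 ord0). Proof. by rewrite unlock. Qed.
Lemma idxnE k : @idxn k = rshift (k.+1 + 1) ord0. Proof. by rewrite unlock. Qed.

Section Generator.
Context {R : realType} (k : nat) (a : R).

Let N := (k.+1 + 1 + 1)%N.
Let A : 'M[R]_N := boldA k.+1 a.
Local Notation idx1 := (@idx1 k).
Local Notation idxd := (@idxd k).
Local Notation idxn := (@idxn k).

Lemma ord_N_ind (P : 'I_N -> Prop) :
  (forall i : 'I_k.+1, P (lshift 1 (lshift 1 i))) -> P idxd -> P idxn -> forall i, P i.
Proof.
rewrite idxdE idxnE => H1 Hd Hn i; case: (split_ordP i) => j ->; last by rewrite ord1.
by case: (split_ordP j) => l ->; [|rewrite ord1].
Qed.

Lemma i1_neq_id : (idx1 == idxd) = false. Proof. by rewrite ?idx1E ?idxdE eq_lshift eq_lrshift. Qed.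
Lemma i1_neq_in : (idx1 == idxn) = false. Proof. by rewrite ?idx1E ?idxnE eq_lrshift. Qed.
Lemma id_neq_in : (idxd == idxn) = false. Proof. by rewrite ?idxdE ?idxnE eq_lrshift. Qed.

Lemma ul_eq_id (i : 'I_k.+1) : (lshift 1 (lshift 1 i) == idxd) = false.
Proof. by rewrite ?idxdE eq_lshift eq_lrshift. Qed.

Lemma ul_eq_in (i : 'I_k.+1) : (lshift 1 (lshift 1 i) == idxn) = false.
Proof. by rewrite ?idxnE eq_lrshift. Qed.

Lemma ul_eq_i1 (i : 'I_k.+1) : (lshift 1 (lshift 1 i) == idx1) = (i == 0).
Proof. by rewrite ?idx1E !eq_lshift. Qed.

Definition idxE := (eqxx, i1_neq_id, i1_neq_in, id_neq_in, ul_eq_id, ul_eq_in, ul_eq_i1,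
  (eq_sym idxd idx1, eq_sym idxn idx1, eq_sym idxn idxd)).

Lemma boldA_in_l i : A idxn i = 0.
Proof. by elim/ord_N_ind: i => [i||]; rewrite /A /boldA ?idxnE ?idxdE ?block_mxEdl ?block_mxEdr mxE. Qed.

Lemma boldA_in_r i : A i idxn = 0.
Proof. by elim/ord_N_ind: i => [i||]; rewrite /A /boldA ?idxnE ?idxdE ?block_mxEur ?block_mxEdr mxE. Qed.

Lemma boldA_ul (i j : 'I_k.+1) :
  A (lshift 1 (lshift 1 i)) (lshift 1 (lshift 1 j)) = a * ((i < j)%N%:R - (j < i)%N%:R).
Proof. by rewrite ?idxdE /A /boldA block_mxEul /Amx block_mxEul !mxE. Qed.

Lemma boldA_id_r (i : 'I_k.+1) : A (lshift 1 (lshift 1 i)) idxd = a * (i == 0)%:R.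
Proof. by rewrite ?idxdE /A /boldA block_mxEul /Amx block_mxEur !mxE. Qed.

Lemma boldA_id_l (i : 'I_k.+1) : A idxd (lshift 1 (lshift 1 i)) = - (a * (i == 0)%:R).
Proof. by rewrite ?idxdE /A /boldA block_mxEul /Amx block_mxEdl !mxE. Qed.

Lemma boldA_id : A idxd idxd = a.
Proof. by rewrite ?idxdE /A /boldA block_mxEul /Amx block_mxEdr mxE eqxx mulr1n. Qed.

Lemma boldA_sym : A + A^T = (2 * a) *: delta_mx idxd idxd.
Proof.
apply/matrixP => i j; rewrite !coefmxE.
elim/ord_N_ind: i => [i||]; elim/ord_N_ind: j => [j||];
  rewrite ?boldA_in_l ?boldA_in_r ?boldA_ul ?boldA_id_r ?boldA_id_l ?boldA_id
    ?idxE /= ?andbT ?mulr0 ?mulr1 ?andbF //; ring.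
Qed.

Local Notation dl i := (delta_mx 0 i : 'rV[R]_N).

Lemma delta_id_trA : dl idxd *m A^T = a *: (dl idx1 + dl idxd).
Proof.
apply/rowP => j; rewrite -rowE [LHS]mxE !coefmxE.
elim/ord_N_ind: j => [j||];
  rewrite ?boldA_in_l ?boldA_id_r ?boldA_id ?idxE /= ?andbT ?addr0 ?add0r ?mulr1 ?mulr0 //.
Qed.

Lemma mul_trA_id (u : 'rV[R]_N) : (u *m A^T) 0 idxd = a * (u 0 idxd - u 0 idx1).
Proof.
have E : col idxd A^T = a *: (delta_mx idxd 0 - delta_mx idx1 0).
  apply/colP => j; rewrite [LHS]mxE !coefmxE.
  elim/ord_N_ind: j => [j||];
  rewrite ?boldA_in_r ?boldA_id_l ?boldA_id ?idxE /= ?andbT ?subr0 ?sub0r ?mulr1 ?mulr0 ?mulrN //.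
have -> : (u *m A^T) 0 idxd = (u *m col idxd A^T) 0 0.
  by rewrite colE mulmxA mulmx_deltaE.
by rewrite E -scalemxAr mulmxBr !coefmxE !mulmx_deltaE.
Qed.

Lemma mul_trA_in (u : 'rV[R]_N) : (u *m A^T) 0 idxn = 0.
Proof. by rewrite mxE big1 // => j _; rewrite trmx_coef boldA_in_l mulr0. Qed.

Lemma delta_in_trA : dl idxn *m A^T = 0.
Proof. by apply/rowP => j; rewrite -rowE [LHS]mxE !coefmxE boldA_in_r. Qed.

Lemma boldA_i1_i1 : A idx1 idx1 = 0.
Proof. by rewrite ?idx1E boldA_ul ltnn subrr mulr0. Qed.

Lemma boldA_i1_id : A idx1 idxd = a.
Proof. by rewrite ?idx1E boldA_id_r eqxx mulr1. Qed.

(** [Mskew] contributes its (k + 1) k off-diagonal entries, all 1 or -1; the two copies of [e1]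
    contribute 2 and the corner 1. With k = n - 3 this is the constant 3 + (n - 2)(n - 3) that
    normalises [a]. *)
Lemma mxtrace_Amx : \tr (Amx k.+1 a *m (Amx k.+1 a)^T) = a ^+ 2 * (3 + k.+1%:R * k%:R).
Proof.
have -> (M : 'M[R]_(k.+1 + 1)) : \tr (M *m M^T) = \sum_i \sum_j M i j ^+ 2.
  apply: eq_bigr => i _; rewrite mxE; apply: eq_bigr => j _.
  by rewrite mxE expr2.
rewrite big_split_ord /= big_ord1.
under eq_bigr => i _.
  rewrite big_split_ord /= big_ord1 /Amx block_mxEur !mxE.
  under eq_bigr => j _ do rewrite block_mxEul !mxE exprMn.
  rewrite -mulr_sumr exprMn -mulrDr; over.
rewrite -mulr_sumr big_split_ord /= big_ord1 /Amx block_mxEdr mxE eqxx mulr1n.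
under [X in _ + (X + _)]eq_bigr => j _ do rewrite block_mxEdl !mxE sqrrN exprMn.
rewrite -mulr_sumr big_split /=.
have e1S : \sum_(i < k.+1) ((i : nat) == 0%N)%:R ^+ 2 = 1 :> R.
  rewrite big_ord_recl /= big1 ?addr0 ?expr1n // => i _.
  by rewrite expr0n.
have MS : \sum_(i < k.+1) \sum_(j < k.+1) ((i < j)%N%:R - (j < i)%N%:R) ^+ 2 = k.+1%:R * k%:R :> R.
  rewrite -[k.+1 in RHS]card_ord -sumr_const mulr_suml; apply: eq_bigr => i _.
  rewrite mul1r (bigD1 i) //= ltnn subrr expr0n add0r.
  under eq_bigr => j ji.
    rewrite (_ : (_ - _) ^+ 2 = 1); first over.
    case: ltngtP => [||ij]; rewrite ?subr0 ?sub0r ?sqrrN ?expr1n //.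
    by move: ji; rewrite -val_eqE /= ij eqxx.
  rewrite sumr_const; congr (_%:R).
  by rewrite cardC1 card_ord.
by rewrite MS e1S; ring.
Qed.

End Generator.

(** * The left invariant frame *)

(* The rows of [Phi s] are the coordinate vectors at a point [(x, s)],
   expressed in the left invariant orthonormal frame. *)
HB.lock Definition Phi {R : realType} (k : nat) (a s : R) : 'M[R]_(k.+1 + 1 + 1) :=
  (expmx (- s *: boldA k.+1 a))^T.

Lemma PhiE {R : realType} k (a s : R) : Phi k a s = (expmx (- s *: boldA k.+1 a))^T.
Proof. by rewrite unlock. Qed.

Section Frame.
Context {R : realType} (k : nat) (a : R).

Let N := (k.+1 + 1 + 1)%N.
Local Notation A := (boldA k.+1 a).
Local Notation dl i := (delta_mx 0 i : 'rV[R]_N).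
Local Notation d := (k.+1 + 1)%N.

Local Notation Phi := (Phi k a).

Lemma Phi0 : Phi 0 = 1%:M.
Proof. by rewrite PhiE oppr0 scale0r expmx0 trmx1. Qed.

Lemma PhiD s t : Phi (s + t) = Phi s *m Phi t.
Proof. by rewrite !PhiE -trmx_mul -expmxD opprD addrC. Qed.

Lemma PhiVr s : Phi s *m Phi (- s) = 1%:M.
Proof. by rewrite -PhiD subrr Phi0. Qed.

Lemma PhiVl s : Phi (- s) *m Phi s = 1%:M.
Proof. by rewrite -PhiD addNr Phi0. Qed.

Lemma unitmx_Phi s : Phi s \in unitmx.
Proof. exact: (mulmx1_unit (PhiVr s)).1. Qed.

Lemma Phi_comm s : Phi s *m A^T = A^T *m Phi s.
Proof. by rewrite !PhiE -!trmx_mul expmx_commZ. Qed.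

Lemma is_derive_Phi (s : R) : is_derive s 1 Phi (- (Phi s *m A^T)).
Proof.
rewrite PhiE -trmx_mul -linearN /= (_ : Phi = fun s => (expmx (- s *: A))^T); last exact/funext/PhiE.
exact: is_derive_trmx (is_derive_expmxN _ _).
Qed.

Lemma is_derive_PhiN (s : R) : is_derive s 1 (fun s => Phi (- s)) (A^T *m Phi (- s)).
Proof.
have := @is_derive_comp_affine _ _ Phi (-1) 0 s.
rewrite addr0 mulN1r => /(_ _ (is_derive_Phi (- s))).
rewrite scaleN1r opprK Phi_comm.
by under eq_fun do rewrite addr0 mulN1r.
Qed.

Lemma delta_in_Phi s : dl idxn *m Phi s = dl idxn.
Proof.
rewrite -[RHS]mulmx1 -Phi0.
apply: (@is_derive0_cst_mx _ _ _ (fun s => dl idxn *m Phi s)) => t.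
apply: is_derive_eq (is_derive_mulmxl _ (is_derive_Phi t)) _.
by rewrite Phi_comm mulmxN mulmxA delta_in_trA mul0mx oppr0.
Qed.

Lemma mul_Phi_in (u : 'rV[R]_N) s : (u *m Phi s) 0 idxn = u 0 idxn.
Proof.
rewrite -[in RHS](mulmx1 u) -Phi0.
apply: (@is_derive_0_is_cst _ (fun s => (u *m Phi s) 0 idxn)) => t.
have := is_derive_coef 0 idxn (is_derive_mulmxl u (is_derive_Phi t)).
by rewrite mulmxN mulmxA coefmxE mul_trA_in oppr0.
Qed.

Definition block1 (B : 'M[R]_d) : 'M[R]_N := block_mx B 0 0 1%:M.

Lemma block1M B C : block1 B *m block1 C = block1 (B *m C).
Proof. by rewrite /block1 mulmx_block !mulmx0 !mul0mx !addr0 add0r mulmx1. Qed.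

Lemma is_derive_block1 (F : R -> 'M[R]_d) (t : R) dF :
  is_derive t 1 F dF -> is_derive t 1 (fun t => block1 (F t)) (block_mx dF 0 0 0).
Proof.
move=> /is_derive_mxP H; apply/is_derive_mxP => i j.
case: (split_ordP i) => i' ->; case: (split_ordP j) => j' ->;
 rewrite ?(block_mxEul, block_mxEur, block_mxEdl, block_mxEdr).
- by under eq_fun do rewrite block_mxEul.
- by under eq_fun do rewrite block_mxEur zeromx_coef; rewrite zeromx_coef; exact: is_derive_cst.
- by under eq_fun do rewrite block_mxEdl zeromx_coef; rewrite zeromx_coef; exact: is_derive_cst.
- by under eq_fun do rewrite block_mxEdr; rewrite zeromx_coef; exact: is_derive_cst.
Qed.

(** The inverse of the claimed value times [e^(tA)] has zero derivative in [t] and is 1 at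
    [t = 0]. *)
Lemma expmx_boldA (s : R) : expmx (s *: A) = block1 (expmx (s *: Amx k.+1 a)).
Proof.
have H t : block1 (expmx (- t *: Amx k.+1 a)) *m expmx (t *: A) = 1%:M.
  have -> : 1%:M = block1 (expmx (- 0 *: Amx k.+1 a)) *m expmx (0 *: A).
    by rewrite oppr0 !scale0r !expmx0 mulmx1 /block1 -scalar_mx_block.
  apply: (@is_derive0_cst_mx _ _ _ (fun t => block1 (expmx (- t *: Amx k.+1 a)) *m expmx (t *: A))) => z.
  pose D := is_derive_block1 (is_derive_expmxN (Amx k.+1 a) z).
  apply: is_derive_eq (is_derive_mulmx D (is_derive_expmx A z)) _.
  rewrite mulmxA -mulmxDl -[RHS](mul0mx _ (expmx (z *: A))); congr (_ *m _).
  rewrite (expmx_commZ (Amx k.+1 a) (- z)) /block1 /boldA mulmx_block.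
  by rewrite !mulmx0 !mul0mx !addr0 add_block_mx addNr !addr0 block_mx0.
have I : block1 (expmx (s *: Amx k.+1 a)) *m block1 (expmx (- s *: Amx k.+1 a)) = 1%:M.
  by rewrite block1M (expmxN (Amx k.+1 a) s) /block1 -scalar_mx_block.
by have := congr1 (mulmx (block1 (expmx (s *: Amx k.+1 a)))) (H s); rewrite mulmxA I mul1mx mulmx1.
Qed.

(** Registered below as a linear form so that a function of the last coordinate is differentiated by
    the scalar chain rule [is_derive_comp_scalar]. *)
Definition last_coord (p : 'rV[R]_N) : R := p 0 idxn.

Lemma last_coord_is_linear : linear (last_coord : 'rV[R]_N -> R^o).
Proof. by move=> c u v; rewrite /last_coord !coefmxE. Qed.

HB.instance Definition _ :=
  GRing.isLinear.Build R 'rV[R]_N R^o *:%R last_coord last_coord_is_linear.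

Lemma is_derive_last (W : normedModType R) (f : R -> W) (p u : 'rV[R]_N) df :
  is_derive (last_coord p) 1 f df ->
  is_derive p u (fun q => f (last_coord q)) (last_coord u *: df).
Proof. exact: is_derive_comp_scalar. Qed.

Definition translation_block (p : 'rV[R]_N) : 'M[R]_N := block_mx 0 (lsubmx p)^T 0 0.

Lemma translation_block_is_linear : linear translation_block.
Proof.
move=> c x y; rewrite /translation_block scale_block_mx add_block_mx !scaler0 !addr0.
by rewrite linearP /= linearP.
Qed.

HB.instance Definition _ :=
  GRing.isLinear.Build R 'rV[R]_N 'M[R]_N *:%R translation_block translation_block_is_linear.

Lemma embG_left p : embG k.+1 a p =
  block1 (expmx (last_coord p *: Amx k.+1 a)) + block_mx 0 (lsubmx p)^T 0 0.
Proof.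
by rewrite /embG /block1 add_block_mx !addr0 add0r /last_coord idxnE mxE.
Qed.

Lemma is_derive_embG p u : is_derive p u (embG k.+1 a)
  (block_mx (last_coord u *: (Amx k.+1 a *m expmx (last_coord p *: Amx k.+1 a)))
     (lsubmx u)^T 0 0).
Proof.
rewrite (_ : embG k.+1 a = (fun q => block1 (expmx (last_coord q *: Amx k.+1 a)))
     + translation_block); last first.
  by apply/funext => q; rewrite embG_left.
have D1 := is_derive_block1 (is_derive_expmx (Amx k.+1 a) (last_coord p)).
have := is_derive_last u D1; rewrite scale_block_mx !scaler0 => {}D1.
have D2 : is_derive p u translation_block
    (block_mx 0 (lsubmx u)^T 0 0).
  exact: (is_derive_linear translation_block).
apply: is_derive_eq (is_deriveD D1 D2) _.
by rewrite add_block_mx !addr0 add0r.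
Qed.

Lemma invmx_eqP m (B C : 'M[R]_m) : B *m C = 1%:M -> invmx B = C.
Proof. by move=> BC; have [uB _] := mulmx1_unit BC; rewrite -[LHS]mulmx1 -BC mulKmx. Qed.

Lemma invmx_embG p : invmx (embG k.+1 a p) =
  block_mx (expmx (- last_coord p *: Amx k.+1 a))
    (- (expmx (- last_coord p *: Amx k.+1 a) *m (lsubmx p)^T)) 0 1%:M.
Proof.
apply: invmx_eqP; rewrite embG_left /block1 add_block_mx !addr0 add0r.
rewrite mulmx_block !mulmx0 !mul0mx !addr0 add0r !mulmx1.
by rewrite mulmxN mulmxA expmxN mul1mx addNr -scalar_mx_block.
Qed.

Lemma left_translateE p u : left_translate k.+1 a p u =
  block_mx (last_coord u *: Amx k.+1 a)
    (expmx (- last_coord p *: Amx k.+1 a) *m (lsubmx u)^T) 0 0.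
Proof.
rewrite /left_translate invmx_embG; set s := last_coord p; set B := Amx k.+1 a.
have [_ ->] := is_derive_embG p u.
rewrite mulmx_block !mulmx0 !mul0mx !addr0 -scalemxAr; congr block_mx.
by have I := expmxN B (- s); rewrite opprK in I; rewrite (expmx_commZ B s) mulmxA I mul1mx.
Qed.

Hypothesis Ha : a ^+ 2 * (3 + k.+1%:R * k%:R) = 1.

(** The normalisation [Ha] enters here: by [mxtrace_Amx] it makes [boldA] a unit vector at the
    identity, so that the left invariant frame is orthonormal. *)
Lemma gGE p : gG k.+1 a p = Phi (last_coord p) *m (Phi (last_coord p))^T.
Proof.
have E (u v : 'rV[R]_N) : \tr (left_translate k.+1 a p u *m (left_translate k.+1 a p v)^T) =
   (u *m (Phi (last_coord p) *m (Phi (last_coord p))^T) *m v^T) 0 0.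
  rewrite !left_translateE !PhiE trmxK expmx_boldA /block1.
  set P := expmx (- last_coord p *: Amx k.+1 a).
  rewrite !tr_block_mx !mulmx_block !trmx0 !mulmx0 !mul0mx !addr0 mxtrace_block mxtrace0 addr0.
  rewrite mxtraceD linearZ /= -scalemxAl -scalemxAr !mxtraceZ mxtrace_Amx Ha mulr1.
  rewrite trmx1 mulmx1 add0r -[u in RHS]hsubmxK -[v in RHS]hsubmxK tr_row_mx mul_row_block.
  rewrite !mulmx0 addr0 add0r mulmx1 mul_row_col [in RHS]coefmxE addrC; congr (_ + _).
    rewrite trmx_mul trmxK mxtrace_mulC /mxtrace big_ord1 !mulmxA.
    by rewrite ord1 -[LHS]trmx_coef !trmx_mul !trmxK !mulmxA.
  by rewrite [RHS]mxE big_ord1 /last_coord idxnE !mxE.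
by apply/matrixP => i j; rewrite mxE E -rowE trmx_delta mulmx_deltaE mxE.
Qed.

End Frame.

(* The coordinates of the tangent vector [u], at any point of last coordinate
   [s], in the left invariant orthonormal frame. *)
HB.lock Definition fcoord {R : realType} (k : nat) (a s : R) (u : 'rV[R]_(k.+1 + 1 + 1))
  (i : 'I_(k.+1 + 1 + 1)) : R := (u *m Phi k a s) 0 i.

HB.lock Definition frame {R : realType} (k : nat) (a s : R) (i : 'I_(k.+1 + 1 + 1)) :
  'rV[R]_(k.+1 + 1 + 1) := delta_mx 0 i *m Phi k a (- s).

Section FrameCoordinates.
Context {R : realType} (k : nat) (a : R).
Let N := (k.+1 + 1 + 1)%N.
Local Notation dl i := (delta_mx 0 i : 'rV[R]_N).
Local Notation Phi := (Phi k a).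
Local Notation fcoord := (fcoord k a).
Local Notation frame := (frame k a).

Lemma fcoordE s u i : fcoord s u i = (u *m Phi s) 0 i. Proof. by rewrite unlock. Qed.
Lemma frameE s i : frame s i = dl i *m Phi (- s). Proof. by rewrite unlock. Qed.

Lemma fcoordD s u v i : fcoord s (u + v) i = fcoord s u i + fcoord s v i.
Proof. by rewrite !fcoordE mulmxDl addmx_coef. Qed.

Lemma fcoordZ s c u i : fcoord s (c *: u) i = c * fcoord s u i.
Proof. by rewrite !fcoordE -scalemxAl scalemx_coef. Qed.

Lemma fcoordN s u i : fcoord s (- u) i = - fcoord s u i.
Proof. by rewrite -scaleN1r fcoordZ mulN1r. Qed.

Lemma fcoord0 s i : fcoord s 0 i = 0.
Proof. by rewrite fcoordE mul0mx zeromx_coef. Qed.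

Definition fcoord_lin := (fcoordD, fcoordN, fcoordZ, fcoord0).

Lemma fcoord_in s u : fcoord s u idxn = u 0 idxn.
Proof. by rewrite fcoordE mul_Phi_in. Qed.

Lemma fcoord_frame s i j : fcoord s (frame s i) j = (j == i)%:R.
Proof. by rewrite fcoordE frameE -mulmxA PhiVl mulmx1 coefmxE eqxx. Qed.

Lemma frame_in s : frame s idxn = dl idxn.
Proof. by rewrite frameE delta_in_Phi. Qed.

Lemma frame_coef_in s i : frame s i 0 idxn = (idxn == i)%:R.
Proof. by rewrite -(fcoord_in s) fcoord_frame. Qed.

Lemma frame_sum s u : u = \sum_i fcoord s u i *: frame s i.
Proof.
rewrite -[LHS]mulmx1 -(PhiVr k a s) mulmxA {1}[u *m _]row_sum_delta mulmx_suml.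
by apply: eq_bigr => i _; rewrite -scalemxAl -frameE fcoordE.
Qed.

Lemma fcoord_eq s u v : (forall i, fcoord s u i = fcoord s v i) -> u = v.
Proof. by move=> E; rewrite (frame_sum s u) (frame_sum s v); apply: eq_bigr => i _; rewrite E. Qed.

Lemma is_derive_fcoord u i (s : R) :
  is_derive s 1 (fun s => fcoord s u i) (- (u *m Phi s *m (boldA k.+1 a)^T) 0 i).
Proof.
rewrite (_ : (fun s => fcoord s u i) = (fun s => (u *m Phi s) 0 i)); last first.
  by apply/funext => t; rewrite fcoordE.
apply: is_derive_eq (is_derive_coef 0 i (is_derive_mulmxl u (is_derive_Phi k a s))) _.
by rewrite mulmxN mulmxA coefmxE.
Qed.

Lemma is_derive_fcoord_id u (s : R) : is_derive s 1 (fun s => fcoord s u idxd)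
    (- (a * (fcoord s u idxd - fcoord s u idx1))).
Proof.
by apply: is_derive_eq (is_derive_fcoord u idxd s) _; rewrite mul_trA_id !fcoordE.
Qed.

Lemma is_derive_frame_id (s : R) :
  is_derive s 1 (fun s => frame s idxd) (a *: (frame s idx1 + frame s idxd)).
Proof.
rewrite (_ : (fun s => frame s idxd) = (fun s => dl idxd *m Phi (- s))); last first.
  by apply/funext => t; rewrite frameE.
apply: is_derive_eq (is_derive_mulmxl _ (is_derive_PhiN k a s)) _.
by rewrite mulmxA delta_id_trA -scalemxAl mulmxDl -!frameE.
Qed.

End FrameCoordinates.

(** * The metric and its Christoffel symbols *)

Section Metric.
Context {R : realType} (k : nat) (a : R).
Hypothesis Ha : a ^+ 2 * (3 + k.+1%:R * k%:R) = 1.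

Let N := (k.+1 + 1 + 1)%N.
Local Notation A := (boldA k.+1 a).
Local Notation dl i := (delta_mx 0 i : 'rV[R]_N).
Local Notation g := (gG k.+1 a).
Local Notation Phi := (Phi k a).

Lemma a_neq0 : a != 0.
Proof. by apply/eqP => a0; move/eqP: Ha; rewrite a0 expr0n mul0r eq_sym oner_eq0. Qed.

Lemma Phi_mul_in s : Phi s *m delta_mx idxn (0 : 'I_1) = delta_mx idxn 0.
Proof.
apply/colP => i; have := mul_Phi_in a (dl i) s; rewrite -rowE mxE => E.
by rewrite mulmx_deltaE E !coefmxE eqxx andbT eq_sym.
Qed.

Lemma is_derive_conj (M : 'M[R]_N) (s : R) :
  is_derive s 1 (fun s => Phi s *m M *m (Phi s)^T)
    (Phi s *m (- (A^T *m M + M *m A)) *m (Phi s)^T).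
Proof.
have D := is_derive_Phi k a s.
apply: is_derive_eq (is_derive_mulmx (is_derive_mulmxr M D) (is_derive_trmx D)) _.
rewrite linearN /= trmx_mul [(A^T)^T]trmxK !(mulNmx, mulmxN) -opprD.
by rewrite mulmxDr mulmxDl !mulmxA.
Qed.

Lemma is_derive_metric p u : is_derive p u g
  (- (2 * a * last_coord u) *:
    (Phi (last_coord p) *m delta_mx idxd idxd *m (Phi (last_coord p))^T)).
Proof.
have -> : g = (fun q => Phi (last_coord q) *m 1%:M *m (Phi (last_coord q))^T).
  by apply/funext => q; rewrite mulmx1 gGE.
apply: is_derive_eq (is_derive_last u (is_derive_conj 1%:M (last_coord p))) _.
rewrite mulmx1 mul1mx addrC boldA_sym -scaleNr -scalemxAr -scalemxAl scalerA.
by congr (_ *: _); ring.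
Qed.

Lemma derive_metric_coef p i j l : 'D_(dl i) (fun q => g q j l) p =
  - (2 * a) * (i == idxn)%:R * (Phi (last_coord p) j idxd * Phi (last_coord p) l idxd).
Proof.
have [_ ->] := is_derive_coef j l (is_derive_metric p (dl i)).
set P := Phi _.
rewrite scalemx_coef mulmx_delta_trE.
by rewrite /last_coord coefmxE eqxx /= [idxn == i]eq_sym; ring.
Qed.

(* The Levi-Civita connection on coordinate vectors at a point of last coordinate [s]. *)
Definition connection (s : R) (u v : 'rV[R]_N) : 'rV[R]_N :=
  - (a * (u 0 idxn * fcoord k a s v idxd + v 0 idxn * fcoord k a s u idxd)) *: frame k a s idxd
  + (a * fcoord k a s u idxd * fcoord k a s v idxd) *: dl idxn.

(** Only the derivative of the metric along the last coordinate survives, and it has rank one, built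
    from column d of [Phi]. Raising the index with the inverse Gram matrix [Q^T Q] turns column d of
    [P] into row d of [Q], the frame vector e_d, and fixes e_n. *)
Lemma christoffelE p i j l : christoffel g p i j l =
  - a * ((i == idxn)%:R * Phi (last_coord p) j idxd + (j == idxn)%:R * Phi (last_coord p) i idxd)
      * (dl idxd *m Phi (- last_coord p)) 0 l
  + a * Phi (last_coord p) i idxd * Phi (last_coord p) j idxd * (l == idxn)%:R.
Proof.
rewrite /christoffel gGE //; set s := last_coord p; set P := Phi s.
have PE i0 j0 l0 : 'D_(dl i0) (fun q => g q j0 l0) p =
  - (2 * a) * (i0 == idxn)%:R * (P j0 idxd * P l0 idxd) by exact: derive_metric_coef.
set Q := Phi (- s).
have PQ : P *m Q = 1%:M := PhiVr k a s.
have QP : Q *m P = 1%:M := PhiVl k a s.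
have Pn : P *m delta_mx idxn (0 : 'I_1) = delta_mx idxn 0 := Phi_mul_in s.
have Qn : Q *m delta_mx idxn (0 : 'I_1) = delta_mx idxn 0 := Phi_mul_in (- s).
have nQ : dl idxn *m Q = dl idxn := delta_in_Phi k a (- s).
clearbody P Q.
have -> : invmx (P *m P^T) = Q^T *m Q.
  by apply: invmx_eqP; rewrite mulmxA -(mulmxA P) -trmx_mul QP trmx1 mulmx1.
have E1 : \sum_m (Q^T *m Q) l m * P m idxd = (dl idxd *m Q) 0 l.
  have -> : (dl idxd *m Q) 0 l = (Q^T *m Q *m (P *m delta_mx idxd (0 : 'I_1))) l 0.
    by rewrite -!mulmxA [Q *m _]mulmxA QP mul1mx -[delta_mx idxd 0]trmx_delta -trmx_mul trmx_coef.
  by rewrite [RHS]mxE; apply: eq_bigr => m _; rewrite mulmx_deltaE.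
have E2 : \sum_m (Q^T *m Q) l m * (m == idxn)%:R = (l == idxn)%:R.
  have -> : (l == idxn)%:R = (Q^T *m Q *m (delta_mx idxn (0 : 'I_1))) l 0 :> R.
    rewrite -mulmxA Qn -[delta_mx idxn 0]trmx_delta -trmx_mul nQ trmx_delta.
    by rewrite coefmxE eqxx andbT.
  by rewrite [RHS]mxE; apply: eq_bigr => m _; rewrite deltamx_coef eqxx andbT.
under eq_bigr => m _ do rewrite !PE.
rewrite -E1 -E2 !mulr_sumr -big_split; apply: eq_bigr => m _ /=.
by field.
Qed.
End Metric.

(** * Connection and curvature *)

Section Curvature.
Context {R : realType} (k : nat) (a : R).
Hypothesis Ha : a ^+ 2 * (3 + k.+1%:R * k%:R) = 1.

Let N := (k.+1 + 1 + 1)%N.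
Local Notation dl i := (delta_mx 0 i : 'rV[R]_N).
Local Notation g := (gG k.+1 a).
Local Notation Phi := (Phi k a).
Local Notation conn := (@connection R k a).
Local Notation fc := (fcoord k a).
Local Notation fr := (frame k a).
Implicit Types u v w p : 'rV[R]_N.

Lemma sum_coefE (f : 'I_N -> R) i : \sum_j (j == i)%:R * f j = f i.
Proof.
rewrite (bigD1 i) //= eqxx mul1r big1 ?addr0 // => j ji.
by rewrite (negPf ji) mul0r.
Qed.

Lemma connection_formE p u v : connection_form g p u v = conn (last_coord p) u v.
Proof.
apply/rowP => l; rewrite [LHS]mxE; set s := last_coord p.
under eq_bigr => i _ do under eq_bigr => j _ do rewrite christoffelE // -/s -frameE.
have -> : conn s u v 0 l = (- a * fr s idxd 0 l) * (u 0 idxn * fc s v idxd)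
    + (- a * fr s idxd 0 l) * (fc s u idxd * v 0 idxn)
    + (a * (l == idxn)%:R) * (fc s u idxd * fc s v idxd).
  by rewrite /connection !coefmxE eqxx; ring.
have hatE (x : 'rV[R]_N) : fc s x idxd = \sum_j Phi s j idxd * x 0 j.
  by rewrite fcoordE mxE; apply: eq_bigr => j _; rewrite mulrC.
have inE (x : 'rV[R]_N) : x 0 idxn = \sum_j (j == idxn)%:R * x 0 j.
  by rewrite (sum_coefE (fun j => x 0 j)).
have S (e f : 'I_N -> R) : (\sum_i e i) * (\sum_j f j) = \sum_i \sum_j e i * f j.
  exact: big_distrlr.
rewrite (hatE u) (hatE v) (inE u) (inE v) !S !mulr_sumr -!big_split.
apply: eq_bigr => i _ /=.
rewrite !mulr_sumr -!big_split; apply: eq_bigr => j _ /=.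
ring.
Qed.

Lemma is_derive_conn v w (s : R) : is_derive s 1 (fun s => conn s v w)
  (- (a ^+ 2 * (v 0 idxn * fc s w idxd + w 0 idxn * fc s v idxd)) *: fr s idx1
   - (a ^+ 2 * (v 0 idxn * fc s w idx1 + w 0 idxn * fc s v idx1)) *: fr s idxd
   + (a ^+ 2 * (fc s v idx1 * fc s w idxd + fc s v idxd * fc s w idx1
       - 2 * fc s v idxd * fc s w idxd)) *: dl idxn).
Proof.
have Dv := is_derive_fcoord_id a v s; have Dw := is_derive_fcoord_id a w s.
have D1 : is_derive s 1 (fun s => - (a * (v 0 idxn * fc s w idxd + w 0 idxn * fc s v idxd)))
   (- (a * (v 0 idxn * (- (a * (fc s w idxd - fc s w idx1)))
     + w 0 idxn * (- (a * (fc s v idxd - fc s v idx1)))))).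
  apply: is_deriveN; apply: is_deriveZ; apply: is_deriveD; exact: is_deriveZ.
have D2 := is_derive_mulr (is_deriveZ a Dv) Dw.
apply: is_derive_eq (is_deriveD (is_derive_scalemx D1 (is_derive_frame_id k a s))
  (is_derive_scalemx D2 (is_derive_cst (dl idxn) s 1))) _.
apply/rowP => j; rewrite !coefmxE /GRing.scale /= /GRing.scale /=; ring.
Qed.

Lemma conn_in s v w : conn s v w 0 idxn = a * fc s v idxd * fc s w idxd.
Proof.
by rewrite /connection !coefmxE frame_coef_in [idxn == idxd]eq_sym id_neq_in !eqxx /=; ring.
Qed.

Lemma fcoord_conn s v w i : fc s (conn s v w) i =
  - (a * (v 0 idxn * fc s w idxd + w 0 idxn * fc s v idxd)) * (i == idxd)%:R
  + a * fc s v idxd * fc s w idxd * (i == idxn)%:R.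
Proof. by rewrite /connection -(frame_in k a s) !fcoord_lin !fcoord_frame. Qed.

Lemma nabla_cst u v p : nabla g u (cst v) p = conn (last_coord p) u v.
Proof. by rewrite /nabla derive_cst add0r connection_formE. Qed.

(** The covariant derivative of a constant field depends on the point only through its last
    coordinate, so differentiating it along [u] is [u_n] times a derivative in [s]. *)
Lemma nabla_nabla_cst p u v w :
  nabla g u (fun q => nabla g v (cst w) q) p =
  u 0 idxn *: 'D_1 (fun s => conn s v w) (last_coord p)
  + conn (last_coord p) u (conn (last_coord p) v w).
Proof.
rewrite [LHS]/nabla connection_formE nabla_cst; congr (_ + _).
rewrite (_ : (fun q => _) = (fun q => conn (last_coord q) v w)); last first.
  by apply/funext => q; rewrite nabla_cst.
have D := is_derive_conn v w (last_coord p).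
have [_ ->] := is_derive_last u D.
by have [_ ->] := D.
Qed.

(* The curvature depends on the bivector [u ^ v] only through the vector
   [u_n v - v_n u]. *)
Definition wedge_normal s u v i : R := u 0 idxn * fc s v i - v 0 idxn * fc s u i.

(** With the self-adjoint [K z = - z_d e_1 + (z_d - z_1) e_d], so that the Jacobi operator is
    [J = a^2 K], the formula reads [R_{u,v} w = w_n J z - <J z, w> e_n]. For horizontal [u] and [v]
    the vector [z] vanishes. *)
Lemma curvatureE p u v w : curvature g p u v w =
  let s := last_coord p in let z := wedge_normal s u v in
  (a ^+ 2 * w 0 idxn) *: (- z idxd *: fr s idx1 + (z idxd - z idx1) *: fr s idxd)
  - (a ^+ 2 * (- z idxd * fc s w idx1 + (z idxd - z idx1) * fc s w idxd)) *: dl idxn.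
Proof.
have L : lie_bracket (cst u) (cst v) p = 0 by rewrite /lie_bracket !derive_cst subrr.
have L0 : nabla g 0 (cst w) p = 0.
  rewrite nabla_cst; apply: (@fcoord_eq _ k a (last_coord p)) => i.
  by rewrite fcoord_conn !fcoord_lin zeromx_coef; ring.
rewrite /curvature /curvature_field L L0 subr0 !nabla_nabla_cst.
have [_ ->] := is_derive_conn v w (last_coord p).
have [_ ->] := is_derive_conn u w (last_coord p).
set s := last_coord p => /=.
rewrite /connection -/(conn s v w) -/(conn s u w).
rewrite !conn_in !fcoord_conn [idxd == idxn]id_neq_in eqxx /= /wedge_normal.
apply/rowP => j; rewrite !coefmxE.
ring.
Qed.

End Curvature.

(** * Nullity and Ricci tensor *)

(** Exhibiting eigenvectors only bounds multiplicities from below; this bound makes them exact and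
    excludes any further eigenvalue. *)
Lemma sum_rank_eigenspace_le (F : fieldType) n (M : 'M[F]_n) (s : seq F) :
  uniq s -> (\sum_(l <- s) \rank (eigenspace M l) <= n)%N.
Proof.
move=> us; rewrite (big_nth 0) big_mkord.
have inj : {in predT &, injective (fun i : 'I_(size s) => nth 0 s i)}.
  by move=> i j _ _ /eqP; rewrite nth_uniq // => /eqP/val_inj.
have /mxdirectP /= <- := mxdirect_sum_eigenspace M inj.
exact: rank_leq_row.
Qed.

Lemma has_codim_ker {R : realType} N c (C : 'M[R]_(N, c)) (S : set 'rV[R]_N) :
  (forall v, S v <-> v *m C = 0) -> \rank C = c -> has_codim S c.
Proof.
move=> SC rC; exists (kermx C); split.
  by apply/seteqP; split=> v /=; [move=> /SC/sub_kermxP|move/sub_kermxP/SC].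
by rewrite mxrank_ker rC subnK // -{1}rC rank_leq_row.
Qed.

Lemma mul_lin1_mx (R : pzRingType) m n (f : 'rV[R]_m -> 'rV[R]_n) (u : 'rV[R]_m) :
  linear f -> u *m lin1_mx f = f u.
Proof.
move=> L; pose l : {linear 'rV[R]_m -> 'rV[R]_n} := HB.pack f (GRing.isLinear.Build _ _ _ _ f L).
exact: (mul_rV_lin1 l).
Qed.

Section CurvatureInvariants.
Context {R : realType} (k : nat) (a : R).
Hypothesis Ha : a ^+ 2 * (3 + k.+1%:R * k%:R) = 1.

Let N := (k.+1 + 1 + 1)%N.
Local Notation dl i := (delta_mx 0 i : 'rV[R]_N).
Local Notation g := (gG k.+1 a).
Local Notation Phi := (Phi k a).
Local Notation fc := (fcoord k a).
Local Notation fr := (frame k a).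
Implicit Types u v w p : 'rV[R]_N.

Lemma has_codim_fcoord (S : set 'rV[R]_N) s (e : seq 'I_N) : uniq e ->
  (forall v, S v <-> forall i, i \in e -> fc s v i = 0) -> has_codim S (size e).
Proof.
(* [D] selects the columns listed in [e]; the default [idxn] of [nth] is never reached, since
   [j < size e]. *)
move=> ue SE; pose D : 'M[R]_(N, size e) := \matrix_(i, j) (i == nth idxn e j)%:R.
have fcD v j : (v *m (Phi s *m D)) 0 j = fc s v (nth idxn e j).
  rewrite mulmxA fcoordE mxE -(sum_coefE (fun i => (v *m Phi s) 0 i)).
  by apply: eq_bigr => i _; rewrite [D i j]mxE mulrC.
apply: (has_codim_ker (C := Phi s *m D)) => [v|].
  rewrite SE; split=> [v0|/rowP v0 i ie].
    by apply/rowP => j; rewrite fcD v0 ?zeromx_coef // mem_nth.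
  have ij : (index i e < size e)%N by rewrite index_mem.
  by have := v0 (Ordinal ij); rewrite fcD zeromx_coef /= nth_index.
have D1 : D^T *m D = 1%:M.
  apply/matrixP => i j; rewrite mxE.
  under eq_bigr do rewrite trmx_coef [D _ i]mxE.
  by rewrite (sum_coefE (fun l => D l j)) mxE [RHS]mxE nth_uniq // -val_eqE.
rewrite (eqmxMfull _ _) ?row_full_unit ?unitmx_Phi //; apply/eqP; rewrite eqn_leq rank_leq_col.
by rewrite -{1}(mxrank1 R (size e)) -D1 mxrankM_maxr.
Qed.

Definition idx3 : seq 'I_N := [:: idx1; idxd; idxn].

Lemma uniq_idx3 : uniq idx3.
Proof. by rewrite /= !inE i1_neq_id i1_neq_in id_neq_in. Qed.

Lemma fcoord_dl_in s i : fc s (dl idxn) i = (i == idxn)%:R.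
Proof. by rewrite -(frame_in k a s) fcoord_frame. Qed.

Lemma fcoord_curvature p u v w i :
  let s := last_coord p in let z := wedge_normal a s u v in
  fc s (curvature g p u v w) i =
    a ^+ 2 * w 0 idxn * (- z idxd * (i == idx1)%:R + (z idxd - z idx1) * (i == idxd)%:R)
    - a ^+ 2 * (- z idxd * fc s w idx1 + (z idxd - z idx1) * fc s w idxd) * (i == idxn)%:R.
Proof. by rewrite curvatureE //= !(fcoord_lin, fcoord_frame, fcoord_dl_in). Qed.

Lemma nullityE p v : nullity g p v <->
  forall i, i \in idx3 -> fc (last_coord p) v i = 0.
Proof.
set s := last_coord p; split=> [nv|v0 x y]; last first.
  have [v1 vd vn] : [/\ fc s v idx1 = 0, fc s v idxd = 0 & fc s v idxn = 0].
    by split; apply: v0; rewrite !inE eqxx ?orbT.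
  apply: (@fcoord_eq _ k a s) => i.
  by rewrite fcoord_curvature -/s v1 vd -(fcoord_in a s v) vn fcoord0; ring.
have a2 : a ^+ 2 != 0 by rewrite expf_neq0 ?(a_neq0 Ha).
(* Against [e_n], the vector [z] is [- x] on the indices 1 and d. Since [J] is invertible on
   span(e_1, e_d), suitable choices of [x] and [i] isolate each of the three coordinates of [v]. *)
have C x (i : 'I_N) : 0 = a ^+ 2 * v 0 idxn * (fc s x idxd * (i == idx1)%:R - (fc s x idxd - fc s x idx1) * (i == idxd)%:R)
    - a ^+ 2 * (fc s x idxd * fc s v idx1 - (fc s x idxd - fc s x idx1) * fc s v idxd) * (i == idxn)%:R.
  rewrite -(fcoord0 a s i) -(nv x (dl idxn)) fcoord_curvature -/s /wedge_normal.
  by rewrite !fcoord_dl_in !coefmxE !eqxx id_neq_in i1_neq_in /=; ring.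
have vn : v 0 idxn = 0.
  have := C (fr s idxd) idx1; rewrite !fcoord_frame !idxE /= => E.
  by apply: (mulfI a2); rewrite mulr0; apply: etrans (esym E); ring.
have vd : fc s v idxd = 0.
  have := C (fr s idx1) idxn; rewrite !fcoord_frame !idxE /= => E.
  by apply: (mulfI a2); apply: oppr_inj; rewrite mulr0 oppr0; apply: etrans (esym E); ring.
have v1 : fc s v idx1 = 0.
  have := C (fr s idxd) idxn; rewrite !fcoord_frame !idxE /= vd => E.
  by apply: (mulfI a2); apply: oppr_inj; rewrite mulr0 oppr0; apply: etrans (esym E); ring.
by move=> i; rewrite !inE => /or3P[]/eqP->; rewrite ?fcoord_in.
Qed.

Lemma codim_nullity p : has_codim (nullity g p) 3.
Proof. exact: (has_codim_fcoord uniq_idx3 (nullityE p)). Qed.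

End CurvatureInvariants.

Section Ricci.
Context {R : realType} (k : nat) (a : R).
Hypothesis Ha : a ^+ 2 * (3 + k.+1%:R * k%:R) = 1.

Let N := (k.+1 + 1 + 1)%N.
Local Notation dl i := (delta_mx 0 i : 'rV[R]_N).
Local Notation g := (gG k.+1 a).
Local Notation Phi := (Phi k a).
Local Notation fc := (fcoord k a).
Local Notation fr := (frame k a).
Implicit Types u v w p : 'rV[R]_N.

Lemma innerE p u v : inner g p u v = \sum_i fc (last_coord p) u i * fc (last_coord p) v i.
Proof.
rewrite /inner gGE // mulmxA -mulmxA -trmx_mul mxE; apply: eq_bigr => i _.
by rewrite trmx_coef !fcoordE.
Qed.

Lemma mxtrace_frame s (f : 'rV[R]_N -> 'rV[R]_N) : linear f ->
  \tr (lin1_mx f) = \sum_i fc s (f (fr s i)) i.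
Proof.
move=> L; rewrite -[lin1_mx f]mulmx1 -(PhiVr k a s) mulmxA mxtrace_mulC.
apply: eq_bigr => i _.
by rewrite fcoordE -(mul_lin1_mx _ L) frameE -!mulmxA -rowE [RHS]mxE.
Qed.

(** [f] stands for [x |-> R_{x,u} v]; its linearity is read off from the coordinate formula instead
    of the definition of the curvature. *)
Lemma trace_jacobi s u v (f : 'rV[R]_N -> 'rV[R]_N) :
  (forall x i, let z := wedge_normal a s x u in fc s (f x) i =
    a ^+ 2 * v 0 idxn * (- z idxd * (i == idx1)%:R + (z idxd - z idx1) * (i == idxd)%:R)
    - a ^+ 2 * (- z idxd * fc s v idx1 + (z idxd - z idx1) * fc s v idxd) * (i == idxn)%:R) ->
  \tr (lin1_mx f) = - a ^+ 2 * (u 0 idxn * v 0 idxn + fc s u idxd * fc s v idxd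
     - fc s u idxd * fc s v idx1 - fc s u idx1 * fc s v idxd).
Proof.
move=> F; rewrite (@mxtrace_frame s); last first.
  move=> c x y; apply: (@fcoord_eq _ k a s) => i.
  rewrite F fcoordD fcoordZ !F /wedge_normal !(fcoordD, fcoordZ) !(addmx_coef, scalemx_coef).
  ring.
pose z i := wedge_normal a s (fr s i) u.
rewrite (eq_bigr (fun i => (i == idx1)%:R * (a ^+ 2 * v 0 idxn * - z i idxd) +
   (i == idxd)%:R * (a ^+ 2 * v 0 idxn * (z i idxd - z i idx1))
   + (i == idxn)%:R * (- a ^+ 2 * (- z i idxd * fc s v idx1 + (z i idxd - z i idx1) * fc s v idxd)))).
  rewrite !big_split /= !(sum_coefE (fun i => _)) /z /wedge_normal.
  by rewrite !frame_coef_in !fcoord_frame !idxE /=; ring.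
by move=> i _; rewrite F /z; ring.
Qed.

Lemma ricciE p u v : let s := last_coord p in
  ricci g p u v = - a ^+ 2 * (u 0 idxn * v 0 idxn + fc s u idxd * fc s v idxd
     - fc s u idxd * fc s v idx1 - fc s u idx1 * fc s v idxd).
Proof. by apply: trace_jacobi => x i; exact: fcoord_curvature. Qed.

(** The Ricci endomorphism in the left invariant frame. Its block on (e_1, e_d) is a^2
    [0, 1; 1, -1], with eigenvalues [a^2 c] for [c^2 + c = 1]. *)
Definition ricci_frame : 'M[R]_N := - a ^+ 2 *:
  (delta_mx idxn idxn + delta_mx idxd idxd - delta_mx idxd idx1 - delta_mx idx1 idxd).

Lemma ricci_opE p :
  ricci_op g p = Phi (last_coord p) *m ricci_frame *m Phi (- last_coord p).
Proof.
rewrite /ricci_op gGE //; set s := last_coord p.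
have -> : invmx (Phi s *m (Phi s)^T) = (Phi (- s))^T *m Phi (- s).
  apply: invmx_eqP; rewrite mulmxA -(mulmxA (Phi s)) -trmx_mul PhiVl trmx1 mulmx1.
  exact: PhiVr.
rewrite mulmxA; congr (_ *m _).
rewrite -[RHS]mulmx1 -trmx1 -(PhiVl k a s) trmx_mul mulmxA; congr (_ *m _).
apply/matrixP => i j; rewrite mxE ricciE -/s !fcoordE.
have E x y : (Phi s *m delta_mx x y *m (Phi s)^T) i j =
    (dl i *m Phi s) 0 x * (dl j *m Phi s) 0 y.
  by rewrite mulmx_delta_trE !delta_mulmxE.
rewrite /ricci_frame -scalemxAr -scalemxAl !(mulmxDr, mulmxDl, mulmxN, mulNmx).
rewrite scalemx_coef !(addmx_coef, oppmx_coef) !E.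
by rewrite -(mul_Phi_in a (dl i) s) -(mul_Phi_in a (dl j) s).
Qed.

Lemma scalar_curvatureE p : scalar_curvature g p = - 2 * a ^+ 2.
Proof.
rewrite /scalar_curvature ricci_opE mxtrace_mulC mulmxA PhiVl mul1mx.
rewrite /ricci_frame mxtraceZ !raddfB raddfD /= /mxtrace.
have E x y : \sum_i (delta_mx x y : 'M[R]_N) i i = (x == y)%:R.
  under eq_bigr do rewrite deltamx_coef -mulnb natrM.
  by rewrite sum_coefE.
by rewrite !E !idxE /=; ring.
Qed.

Lemma eigen_ricci p v l : let s := last_coord p in
  (- a ^+ 2 * v 0 idxn = l * v 0 idxn ->
   a ^+ 2 * fc s v idxd = l * fc s v idx1 ->
   a ^+ 2 * (fc s v idx1 - fc s v idxd) = l * fc s v idxd ->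
   (forall i, i \notin idx3 k -> l * fc s v i = 0) ->
   v *m ricci_op g p = l *: v)%R.
Proof.
move=> s En E1 Ed E0; apply: (@fcoord_eq _ k a s) => i; rewrite fcoordZ.
rewrite fcoordE ricci_opE -/s !mulmxA -mulmxA PhiVl mulmx1.
have E (x y : 'I_N) : (v *m Phi s *m delta_mx x y) 0 i = (i == y)%:R * fc s v x.
  rewrite -(mul_delta_mx (0 : 'I_1)) mulmxA [LHS]mxE big_ord1 mulmx_deltaE deltamx_coef eqxx.
  by rewrite fcoordE mulrC.
rewrite /ricci_frame -scalemxAr !(mulmxDr, mulmxN) scalemx_coef !(addmx_coef, oppmx_coef) !E.
rewrite fcoord_in.
have [->|ni] := eqVneq i idxn.
  by rewrite fcoord_in -En !idxE /=; ring.
have [->|nd] := eqVneq i idxd; first by rewrite -Ed /= !idxE /=; ring.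
have [->|n1] := eqVneq i idx1; first by rewrite -E1 /=; ring.
by rewrite E0 /= ?mulr0 ?addr0 ?subr0 //; rewrite ?inE ?negb_or ?ni ?nd ?n1 //; ring.
Qed.

End Ricci.

Lemma rank_eigenspace_gt0 (F : fieldType) n (M : 'M[F]_n) (v : 'rV[F]_n) l :
  v != 0 -> v *m M = l *: v -> (0 < \rank (eigenspace M l))%N.
Proof.
move=> v0 /eigenspaceP vM; rewrite lt0n mxrank_eq0; apply/eqP => E0.
by move: vM; rewrite E0 submx0 (negPf v0).
Qed.

Section Spectrum.
Context {R : realType} (k : nat) (a : R).
Hypothesis Hk : (0 < k)%N.
Hypothesis Ha : a ^+ 2 * (3 + k.+1%:R * k%:R) = 1.

Let N := (k.+1 + 1 + 1)%N.
Local Notation dl i := (delta_mx 0 i : 'rV[R]_N).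
Local Notation g := (gG k.+1 a).
Local Notation fc := (fcoord k a).
Local Notation fr := (frame k a).
Implicit Types u v w p : 'rV[R]_N.

Definition ricci_spectrum : seq R := [:: 0; - a ^+ 2;
  a ^+ 2 * ((-1 + Num.sqrt 5) / 2); a ^+ 2 * ((-1 - Num.sqrt 5) / 2)].

Lemma sqrt5_sq : Num.sqrt 5 ^+ 2 = 5 :> R.
Proof. by rewrite sqr_sqrtr. Qed.

Lemma sqrt5_gt2 : 2 < Num.sqrt 5 :> R.
Proof. by rewrite -[ltLHS]ger0_norm // -sqrtr_sqr ltr_sqrt //; lra. Qed.

Lemma uniq_ricci_spectrum : uniq ricci_spectrum.
Proof.
have a2 : 0 < a ^+ 2 by rewrite exprn_even_gt0 //= (a_neq0 Ha).
have s2 := sqrt5_gt2; set b := Num.sqrt 5 in s2 *.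
have a2b : a ^+ 2 * 2 < a ^+ 2 * b by rewrite ltr_pM2l.
have E (c : R) : a ^+ 2 * ((-1 + c) / 2) = (a ^+ 2 * c - a ^+ 2) / 2 by field.
rewrite /ricci_spectrum (E b) (E (- b)) mulrN.
(* Once [y = a^2 sqrt 5] is abstract, the distinctness of the four values follows linearly from
   [0 < x] and [2 x < y]. *)
set x := a ^+ 2 in a2 a2b *; set y := x * b in a2b *; clearbody x y.
have ne (c d : R) : (c < d) || (d < c) -> c != d by rewrite neq_lt.
rewrite /= !inE !negb_or -!andbA; apply/and5P; split; last (apply/andP; split; last (rewrite andbT));
  by apply: ne; apply/orP; first [left; lra|right; lra].
Qed.

(** The nullity lies in the kernel of the Ricci endomorphism, and e_n is an eigenvector. On (e_1,
    e_d) the block sends (1, c) to a^2 (c, 1 - c), which is [a^2 c] times (1, c) exactly when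
    [c^2 + c = 1]. *)
Lemma ricci_eigenspaces p :
  [/\ (k <= \rank (eigenspace (ricci_op g p) 0))%N,
      (1 <= \rank (eigenspace (ricci_op g p) (- a ^+ 2)))%N &
      forall c : R, c ^+ 2 + c = 1 -> (1 <= \rank (eigenspace (ricci_op g p) (a ^+ 2 * c)))%N].
Proof.
set s := last_coord p.
have fr_neq0 v i : fc s v i != 0 -> v != 0.
  by apply: contra_neq => ->; rewrite fcoord0.
split=> [||c Ec].
- have [V [VE rV]] : has_codim (nullity g p) 3 by exact: codim_nullity.
  have kV : (k <= \rank V)%N by move: rV; set r := \rank V; clearbody r; lia.
  apply: (leq_trans kV); apply/mxrankS/row_subP => i; apply/eigenspaceP.
  have : nullity g p (row i V) by rewrite VE /= row_sub.
  rewrite nullityE // -/s => V0.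
  have [v1 vd vn] : [/\ fc s (row i V) idx1 = 0, fc s (row i V) idxd = 0 & fc s (row i V) idxn = 0].
    by split; apply: V0; rewrite /idx3 !inE ?eqxx ?orbT.
  apply: eigen_ricci => //; rewrite -/s ?v1 ?vd -?(fcoord_in a s) ?vn; try by ring.
  by move=> j _; rewrite mul0r.
- apply: (@rank_eigenspace_gt0 _ _ _ (fr s idxn)).
    by apply: (fr_neq0 _ idxn); rewrite fcoord_frame eqxx oner_eq0.
  apply: eigen_ricci => //; rewrite -/s ?frame_coef_in ?fcoord_frame ?idxE //=; try by ring.
  move=> i; rewrite /idx3 !inE !negb_or => /and3P[_ _ /negPf ni].
  by rewrite fcoord_frame ni mulr0.
- apply: (@rank_eigenspace_gt0 _ _ _ (fr s idx1 + c *: fr s idxd)).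
    apply: (fr_neq0 _ idx1).
    by rewrite fcoordD fcoordZ !fcoord_frame !idxE /= mulr0 addr0 oner_eq0.
  apply: eigen_ricci => //; rewrite -/s ?addmx_coef ?scalemx_coef ?frame_coef_in
      ?fcoordD ?fcoordZ ?fcoord_frame ?idxE /=; try by ring.
  + by transitivity (a ^+ 2 * ((c ^+ 2 + c) - c)); [rewrite Ec|]; ring.
  + move=> i; rewrite /idx3 !inE !negb_or => /and3P[/negPf n1 /negPf nd _].
    by rewrite fcoordD fcoordZ !fcoord_frame n1 nd /=; ring.
Qed.

Lemma ricci_spectrumP p :
  let M := ricci_op g p in
  (forall l, eigenvalue M l <-> l \in ricci_spectrum) /\
  [seq \rank (eigenspace M l) | l <- ricci_spectrum] = [:: k; 1; 1; 1]%N.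
Proof.
have [r0 r1 r23] := ricci_eigenspaces p; set M := ricci_op g p in r0 r1 r23 *.
have r2 : (1 <= \rank (eigenspace M (a ^+ 2 * ((-1 + Num.sqrt 5) / 2))))%N.
  by apply: r23; have := sqrt5_sq; set b := Num.sqrt 5 => b2; field: b2.
have r3 : (1 <= \rank (eigenspace M (a ^+ 2 * ((-1 - Num.sqrt 5) / 2))))%N.
  by apply: r23; have := sqrt5_sq; set b := Num.sqrt 5 => b2; field: b2.
have U := uniq_ricci_spectrum.
have := sum_rank_eigenspace_le M U; rewrite /ricci_spectrum !big_cons big_nil => S.
split=> [l|]; last first.
  rewrite /ricci_spectrum /=.
  move: r0 r1 r2 r3 S.
  set x0 := \rank _; set x1 := \rank _; set x2 := \rank _; set x3 := \rank _.
  move=> r0 r1 r2 r3 S.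
  by congr [:: _; _; _; _]; lia.
split=> [lM|].
  apply/negPn/negP => nl.
  have Ul : uniq (l :: ricci_spectrum) by rewrite cons_uniq nl U.
  have := sum_rank_eigenspace_le M Ul; rewrite /ricci_spectrum !big_cons big_nil.
  have : (0 < \rank (eigenspace M l))%N by rewrite lt0n mxrank_eq0.
  move: r0 r1 r2 r3.
  set x0 := \rank _; set x1 := \rank _; set x2 := \rank _; set x3 := \rank _; set x4 := \rank _.
  lia.
(* That 0 is an eigenvalue requires multiplicity n - 3 > 0, which is [Hk]. *)
by rewrite !inE => /or4P[]/eqP->; rewrite /eigenvalue -mxrank_eq0 -lt0n // (leq_trans _ r0).
Qed.
End Spectrum.

(** * Sectional curvature, isometries and topology *)

Section Geometry.
Context {R : realType} (k : nat) (a : R).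
Hypothesis Ha : a ^+ 2 * (3 + k.+1%:R * k%:R) = 1.

Let N := (k.+1 + 1 + 1)%N.
Local Notation dl i := (delta_mx 0 i : 'rV[R]_N).
Local Notation g := (gG k.+1 a).
Local Notation Phi := (Phi k a).
Local Notation fc := (fcoord k a).
Local Notation fr := (frame k a).
Implicit Types u v w p q : 'rV[R]_N.

Lemma inner_frame p i v : inner g p (fr (last_coord p) i) v = fc (last_coord p) v i.
Proof.
rewrite innerE //; under eq_bigr do rewrite fcoord_frame.
by rewrite sum_coefE.
Qed.

Lemma innerC p u v : inner g p u v = inner g p v u.
Proof. by rewrite !innerE //; apply: eq_bigr => i _; rewrite mulrC. Qed.

Lemma innerD p u v w : inner g p (u + v) w = inner g p u w + inner g p v w.
Proof. by rewrite /inner !mulmxDl addmx_coef. Qed.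

Lemma innerZ p c u w : inner g p (c *: u) w = c * inner g p u w.
Proof. by rewrite /inner -!scalemxAl scalemx_coef. Qed.

(** On planes containing e_n the sectional curvature is [- <J u, u> / <u, u>]. The form [J] is
    indefinite on span(e_1, e_d), its determinant there being -a^4; [c = 1] and [c = -1] give a^2 /
    2 and -3 a^2 / 2. *)
Lemma sectionalE p (c : R) : let s := last_coord p in
  sectional g p (fr s idx1 + c *: fr s idxd) (fr s idxn) =
    a ^+ 2 * (2 * c - c ^+ 2) / (1 + c ^+ 2).
Proof.
move=> s; rewrite /sectional [inner g p (curvature _ _ _ _ _) _]innerC !(innerD, innerZ) !inner_frame.
rewrite !fcoord_curvature // -/s /wedge_normal !fcoord_lin !fcoord_frame !coefmxE !frame_coef_in !idxE /=.
by congr (_ / _); ring.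
Qed.

Lemma row_free_plane s (c : R) : row_free (col_mx (fr s idx1 + c *: fr s idxd) (fr s idxn)).
Proof.
apply/row_freeP; exists (Phi s *m row_mx (delta_mx idx1 0) (delta_mx idxn 0)).
rewrite mul_mx_row mul_col_row [RHS]scalar_mx_block.
congr block_mx; apply/matrixP => i j; rewrite !ord1 mulmxA mulmx_deltaE -fcoordE
  ?fcoordD ?fcoordZ !fcoord_frame !idxE /= mxE ?eqxx ?mulr1n; ring.
Qed.

Lemma positive_sectional : exists p u v, row_free (col_mx u v) /\ 0 < sectional g p u v.
Proof.
exists 0, (fr (last_coord (0 : 'rV[R]_N)) idx1 + 1 *: fr (last_coord (0 : 'rV[R]_N)) idxd), (fr (last_coord (0 : 'rV[R]_N)) idxn).
split; first exact: row_free_plane.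
rewrite sectionalE; have : 0 < a ^+ 2 by rewrite exprn_even_gt0 //= (a_neq0 Ha).
set x := a ^+ 2 => x0; have -> : x * (2 * 1 - 1 ^+ 2) / (1 + 1 ^+ 2) = x / 2 by field.
by rewrite divr_gt0.
Qed.

Lemma negative_sectional : exists p u v, row_free (col_mx u v) /\ sectional g p u v < 0.
Proof.
exists 0, (fr (last_coord (0 : 'rV[R]_N)) idx1 + (-1) *: fr (last_coord (0 : 'rV[R]_N)) idxd), (fr (last_coord (0 : 'rV[R]_N)) idxn).
split; first exact: row_free_plane.
rewrite sectionalE; have : 0 < a ^+ 2 by rewrite exprn_even_gt0 //= (a_neq0 Ha).
set x := a ^+ 2 => x0; have -> : x * (2 * -1 - (-1) ^+ 2) / (1 + (-1) ^+ 2) = - (3 * x / 2) by field.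
by rewrite oppr_lt0 divr_gt0 // mulr_gt0.
Qed.

Lemma last_coord_continuous : continuous (@last_coord R k).
Proof. exact: coord_continuous. Qed.

(** The functions [Phi M Phi^T] with constant [M] are stable under differentiation, which replaces
    [M] by a multiple of [A^T M + M A]. *)
Lemma smooth_metric : smooth g.
Proof.
pose C (f : 'rV[R]_N -> 'M[R]_N) := exists M, f = fun p => Phi (last_coord p) *m M *m (Phi (last_coord p))^T.
apply: (@smooth_closed _ _ _ C); last first.
- by exists 1%:M; apply/funext => p; rewrite mulmx1 gGE.
- move=> f v [M ->].
  exists (fun p => last_coord v *: (Phi (last_coord p) *m (- ((boldA k.+1 a)^T *m M + M *m boldA k.+1 a)) *m (Phi (last_coord p))^T)).
    exists (last_coord v *: (- ((boldA k.+1 a)^T *m M + M *m boldA k.+1 a))).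
    by apply/funext => p; rewrite -scalemxAr -scalemxAl.
  by move=> p; exact: (is_derive_last v (is_derive_conj a M (last_coord p))).
- move=> f [M ->] p.
  apply: (@continuous_comp _ _ _ (@last_coord R k) (fun s => Phi s *m M *m (Phi s)^T)).
    exact: last_coord_continuous.
  exact: (is_derive_continuous (is_derive_conj a M)).
Qed.

Lemma smooth_affine (V W : normedModType R) (l : {linear V -> W}) (c : W) :
  continuous l -> smooth (fun x => l x + c).
Proof.
(* The boolean switches the linear part off: one differentiation leads from [l x + d] to a
   constant. *)
move=> cl; pose C (f : V -> W) := exists (b : bool) d, f = fun x => (if b then l x else 0) + d.
apply: (@smooth_closed _ _ _ C); last by exists true, c.
- move=> f [b [d ->]] x; apply: cvgD; last exact: cvg_cst.
  by case: b; [exact: cl|exact: cvg_cst].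
- move=> f v [b [d ->]]; exists (cst (if b then l v else 0)).
    by exists false, (if b then l v else 0); apply/funext => x; rewrite add0r.
  move=> x; case: b; first exact: is_derive_affine.
  by under eq_fun do rewrite add0r; exact: is_derive_cst.
Qed.

Lemma continuous_mulmxr m n r (M : 'M[R]_(n, r)) : continuous (fun x : 'M[R]_(m, n) => x *m M).
Proof. move=> x; apply: (@cvg_mulmx _ _ (nbhs x) _ _ _ _ id (fun=> M) x M); first exact: cvg_id.
exact: cvg_cst. Qed.

Lemma riemannian_metric_gG : riemannian_metric g.
Proof.
split; first exact: smooth_metric.
  by move=> p; rewrite gGE // trmx_mul trmxK.
move=> p u u0; rewrite innerE //; set s := last_coord p.
rewrite lt_neqAle eq_sym; apply/andP; split; last by apply: sumr_ge0 => i _; rewrite -expr2 sqr_ge0.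
apply: contra_neq u0 => /eqP; rewrite psumr_eq0 => [/allP u0|i _]; last by rewrite -expr2 sqr_ge0.
apply: (@fcoord_eq _ k a s) => i; rewrite fcoord0; apply/eqP.
by have := u0 i (mem_index_enum i); rewrite -expr2 sqrf_eq0.
Qed.

(** [F] is a left translation, [(x, s) -> (e^(tA) x + b', s + t)] with [b = (b', t)] chosen so that
    [F p = q]. Its differential [Phi (- t)] carries the frame at height [s] to the frame at height
    [s + t]. *)
Lemma homogeneous_gG : homogeneous g.
Proof.
move=> p q; pose t := last_coord q - last_coord p.
pose b := q - p *m Phi (- t).
have bn : last_coord b = t by rewrite /last_coord !coefmxE mul_Phi_in.
pose F (x : 'rV[R]_N) := x *m Phi (- t) + b.
have sF t' c : smooth (fun x : 'rV[R]_N => x *m Phi t' + c).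
  exact: (@smooth_affine _ _ (mulmxr (Phi t')) c (@continuous_mulmxr _ _ _ _)).
exists F; split; last by rewrite /F /b addrC subrK.
split=> [||x u v]; first exact: sF.
  exists (fun x => x *m Phi t + - (b *m Phi t)); split; first exact: sF.
    by move=> x; rewrite /F mulmxDl addrK -mulmxA PhiVl mulmx1.
  by move=> x; rewrite /F mulmxDl mulNmx -!mulmxA PhiVr !mulmx1 subrK.
have DF w : 'D_w F x = w *m Phi (- t).
  by have [_ ->] := is_derive_affine (mulmxr (Phi (- t))) b x w.
have Fl : last_coord (F x) = last_coord x + t.
  by rewrite /F linearD /= bn {1}/last_coord mul_Phi_in.
have fcF w i : fc (last_coord x + t) (w *m Phi (- t)) i = fc (last_coord x) w i.
  by rewrite !fcoordE -mulmxA -PhiD addrC addrK.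
by rewrite !innerE // !DF Fl; apply: eq_bigr => i _; rewrite !fcF.
Qed.

End Geometry.

(** * Simple connectedness by contraction along segments *)

Lemma simply_connected_normed {R : realType} (V : normedModType R) : simply_connected (R := R) V.
Proof.
split=> [x y|c cc c01].
  exists (fun t : R => x + t *: (y - x)); split.
  - apply: continuous_subspaceT => t.
    exact: (cvgD (cvg_cst x) (cvgZ (@cvg_id _ (nbhs t)) (cvg_cst (y - x)))).
  - by rewrite scale0r addr0.
  - by rewrite scale1r addrC subrK.
exists (fun z : R * R => (1 - z.2) *: c z.1 + z.2 *: c 0); split=> [|t _|t _|s _] /=.
- apply/subspace_continuousP => -[t s] [/= t01 s01].
  set F := within _ _.
  have F1 : (fun z : R * R => c z.1) @ F --> c t.
    (* The loop is continuous only within the unit interval, so the first projection must be shown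
       to send the filter of the square into the filter of the interval. *)
    have G1 : fst @ F --> within `[0, 1] (nbhs t).
      move=> P; rewrite /within /= => HP.
      have H : nbhs (t, s) (fst @^-1` [set y | `[0, 1]%classic y -> P y]).
        exact: (@cvg_fst _ _ (nbhs t) (nbhs s) _ _ HP).
      suff : nbhs (t, s) (fun z : R * R => (`[0, 1] `*` `[0, 1]) z -> P z.1) by [].
      by apply: (@filterS _ (nbhs (t, s)) _ _ _ _ H) => -[t' s'] /= HP' [/HP'].
    have G2 : c @ within `[0, 1] (nbhs t) --> c t by move/subspace_continuousP: cc; exact.
    by move=> P cP; apply: (G1 (c @^-1` P)); exact: G2.
  have F2 : (fun z : R * R => z.2) @ F --> s.
    apply: (@cvg_trans _ ((fun z : R * R => z.2) @ nbhs (t, s))); last exact: cvg_snd.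
    by apply: cvg_app; exact: cvg_within.
  have F3 : (fun z : R * R => 1 - z.2) @ F --> 1 - s by apply: cvgB F2; exact: cvg_cst.
  have F4 : (fun z : R * R => z.2 *: c 0) @ F --> s *: c 0 by exact: cvgZr_tmp.
  have F5 : (fun z : R * R => (1 - z.2) *: c z.1) @ F --> (1 - s) *: c t by exact: cvgZ.
  exact: cvgD F5 F4.
- by rewrite subr0 scale1r scale0r addr0.
- by rewrite subrr scale0r scale1r add0r.
- by rewrite -c01 -scalerDl subrK scale1r.
Qed.

(** * The group G *)

Section Group.
Context {R : realType} (k : nat) (a : R).
Hypothesis a0 : a != 0.

Let N := (k.+1 + 1 + 1)%N.
Local Notation d := (k.+1 + 1)%N.
Local Notation Phi := (Phi k a).
Local Notation B := (Amx k.+1 a).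
Local Notation embG := (embG k.+1 a).
Implicit Types p q : 'rV[R]_N.

Lemma is_derive_trace_conj (s : R) :
  is_derive s 1 (fun s => \tr (Phi s *m 1%:M *m (Phi s)^T))
    (- (2 * a) * \sum_i Phi s i idxd ^+ 2).
Proof.
have /is_derive_mxP D := @is_derive_conj R k a 1%:M s.
have := is_derive_sumr (index_enum 'I_N) xpredT (fun i => D i i).
move=> /is_derive_eq; apply; rewrite mulr_sumr; apply: eq_bigr => i _.
rewrite mulmx1 mul1mx addrC boldA_sym -scaleNr -scalemxAr -scalemxAl scalemx_coef.
by rewrite mulmx_delta_trE expr2.
Qed.

Lemma Phi_eq1 s : Phi s = 1%:M -> s = 0.
Proof.
(* The trace of [Phi Phi^T] is strictly monotone, so [Phi] is not periodic. *)
move=> Ps; pose h t := \tr (Phi t *m 1%:M *m (Phi t)^T).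
have h0 : h s = h 0 by rewrite /h Ps Phi0.
have dh (t : R) := is_derive_trace_conj t.
have nz t : - (2 * a) * \sum_i Phi t i idxd ^+ 2 != 0.
  rewrite mulf_neq0 ?oppr_eq0 ?mulf_neq0 //; apply/negP.
  rewrite psumr_eq0 => [/allP z|i _]; last exact: sqr_ge0.
  have := @fcoord_frame R k a t idxd idxd; rewrite fcoordE mxE big1 => [/eqP|i _].
    by rewrite eqxx eq_sym oner_eq0.
  by have := z i (mem_index_enum i); rewrite sqrf_eq0 => /eqP ->; rewrite mulr0.
have cont x y : {within `[x, y], continuous h} by exact: continuous_subspaceT (is_derive_continuous dh).
apply/eqP; apply: contraT; rewrite neq_lt => /orP[s0|s0].
  have [c _ E] := @MVT _ h _ _ _ s0 (fun t _ => dh t) (@cont _ _).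
  move/eqP: E; rewrite h0 subrr eq_sym mulf_eq0 (negPf (nz c)) /=.
  by rewrite subr_eq0 gt_eqF.
have [c _ E] := @MVT _ h _ _ _ s0 (fun t _ => dh t) (@cont _ _).
move/eqP: E; rewrite h0 subrr eq_sym mulf_eq0 (negPf (nz c)) /=.
by rewrite subr_eq0 gt_eqF.
Qed.

Lemma expmx_Amx_inj s t : expmx (s *: B) = expmx (t *: B) -> s = t.
Proof.
move=> E; have : Phi (- s) = Phi (- t) by rewrite !PhiE !opprK !expmx_boldA E.
move=> /(congr1 (mulmx^~ (Phi s))); rewrite PhiVl -PhiD => /esym/Phi_eq1/eqP.
by rewrite addrC subr_eq0 => /eqP.
Qed.

Lemma embG_inj : injective embG.
Proof.
move=> p q; rewrite /Defs.embG => /eq_block_mx[/expmx_Amx_inj E /trmx_inj E' _ _].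
rewrite -[p]hsubmxK -[q]hsubmxK E'; congr row_mx.
by apply/matrixP => i j; rewrite !ord1.
Qed.

Lemma embG_row (x : 'cV[R]_d) s : embG (row_mx x^T s%:M) = block_mx (expmx (s *: B)) x 0 1%:M.
Proof. by rewrite /Defs.embG row_mxKr row_mxKl trmxK mxE eqxx mulr1n. Qed.

Lemma lie_algebraE (x : 'I_d -> R) s :
  \sum_i x i *: Emx i + s *: boldA k.+1 a = block_mx (s *: B) (\col_i x i) 0 0.
Proof.
have -> : \sum_i x i *: Emx i = block_mx 0 (\sum_i x i *: delta_mx i 0) 0 0 :> 'M[R]_N.
  elim/big_rec2: _ => [|i y z _ ->]; first by rewrite block_mx0.
  by rewrite scale_block_mx add_block_mx !scaler0 !addr0.
have -> : \sum_i x i *: delta_mx i 0 = \col_i x i :> 'cV[R]_d.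
  apply/colP => j; rewrite mxE summxE (bigD1 j) //= !mxE !eqxx mulr1 big1 ?addr0 // => i ij.
  by rewrite !mxE eq_sym (negPf ij) mulr0.
by rewrite /boldA scale_block_mx add_block_mx !scaler0 !addr0 add0r.
Qed.

(** The shape of the exponential comes from two invariances: the last row is fixed, and the first d
    columns are intertwined with [e^(tsB)]. The vector [y] stays implicit because membership in the
    range of [embG] depends only on the shape. *)
Lemma expmx_lie (x : 'cV[R]_d) s : exists y,
  expmx (block_mx (s *: B) x 0 0 : 'M[R]_N) = block_mx (expmx (s *: B)) y 0 1%:M.
Proof.
set C := block_mx _ _ _ _.
have E1 : (row_mx 0 1%:M : 'M[R]_(1, N)) *m expmx C = row_mx 0 1%:M.
  transitivity ((row_mx 0 1%:M : 'M[R]_(1, N)) *m expmx ((0 : R) *: C)); last first.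
    by rewrite scale0r expmx0 mulmx1.
  rewrite -{1}(scale1r C).
  apply: (@is_derive0_cst_mx _ _ _ (fun t => (row_mx 0 1%:M : 'M[R]_(1, N)) *m expmx (t *: C))) => t.
  apply: is_derive_eq (is_derive_mulmxl _ (is_derive_expmx C t)) _.
  by rewrite mulmxA mul_row_block !mul0mx !mulmx0 !addr0 row_mx0 mul0mx.
have E2 : expmx C *m (col_mx 1%:M 0 : 'M[R]_(N, d)) *m expmx (- (1 : R) *: (s *: B)) = col_mx 1%:M 0.
  transitivity (expmx ((0 : R) *: C) *m (col_mx 1%:M 0 : 'M[R]_(N, d)) *m expmx (- (0 : R) *: (s *: B))).
    rewrite -{1}(scale1r C).
    apply: (@is_derive0_cst_mx _ _ _ (fun t => expmx (t *: C) *m (col_mx 1%:M 0 : 'M[R]_(N, d)) *m expmx (- t *: (s *: B)))) => t.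
    apply: is_derive_eq (is_derive_mulmx (is_derive_mulmxr _ (is_derive_expmx C t)) (is_derive_expmxN (s *: B) t)) _.
    rewrite (expmx_commZ C t) mulmxN mulmxA -mulmxBl -!mulmxA -mulmxBr.
    have -> : C *m col_mx 1%:M 0 - col_mx 1%:M 0 *m (s *: B) = 0 :> 'M[R]_(N, d).
      by rewrite mul_block_col mul_col_mx !mulmx0 !mul0mx !addr0 mulmx1 mul1mx subrr.
    by rewrite mulmx0 mul0mx.
  by rewrite oppr0 !scale0r !expmx0 mul1mx mulmx1.
have {}E2 : expmx C *m (col_mx 1%:M 0 : 'M[R]_(N, d)) = col_mx (expmx (s *: B)) 0.
  have := congr1 (mulmx^~ (expmx (s *: B))) E2; rewrite mul_col_mx mul1mx mul0mx => <-.
  by have := expmxN (s *: B) (-1); rewrite opprK scale1r -!mulmxA => ->; rewrite mulmx1.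
exists (ursubmx (expmx C)).
move: E1 E2; rewrite -[expmx C]submxK mul_row_block mul_block_col.
rewrite !mul0mx !mulmx0 !mul1mx !mulmx1 !addr0 !add0r => /eq_row_mx[E3 ->] /eq_col_mx[-> _].
by rewrite E3 block_mxKur.
Qed.

(** The square of the matrix is 0, so [1 - t C] inverts [e^(tC)]: their product has zero
    derivative. *)
Lemma expmx_translation (x : 'cV[R]_d) :
  expmx (block_mx 0 x 0 0 : 'M[R]_N) = block_mx 1%:M x 0 1%:M.
Proof.
set C := block_mx 0 x 0 0.
have C2 : C *m C = 0 by rewrite mulmx_block !mulmx0 !mul0mx !addr0 block_mx0.
have D (t : R) : is_derive t 1 (fun t : R => 1%:M - t *: C) (- C).
  apply: is_derive_eq (is_deriveB (is_derive_cst (1%:M : 'M[R]_N) t 1)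
    (is_derive_scalemx (is_derive_id t 1) (is_derive_cst C t 1))) _.
  by rewrite scale1r scaler0 addr0 sub0r.
have E : expmx ((1 : R) *: C) *m (1%:M - (1 : R) *: C) = 1%:M.
  transitivity (expmx ((0 : R) *: C) *m (1%:M - (0 : R) *: C)); last first.
    by rewrite !scale0r expmx0 subr0 mulmx1.
  apply: (@is_derive0_cst_mx _ _ _ (fun t => expmx (t *: C) *m (1%:M - t *: C))) => t.
  apply: is_derive_eq (is_derive_mulmx (is_derive_expmx C t) (D t)) _.
  rewrite (expmx_commZ C t) -mulmxA -mulmxDr [C *m _]mulmxBr mulmx1 -scalemxAr C2 scaler0 subr0.
  by rewrite subrr mulmx0.
have I : (1%:M - C) *m (1%:M + C) = 1%:M.
  by rewrite mulmxDr mulmx1 mulmxBl mul1mx C2 subr0 subrK.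
move: E; rewrite !scale1r => /(congr1 (mulmx^~ (1%:M + C))).
rewrite -mulmxA I mulmx1 mul1mx => ->.
by rewrite {1}scalar_mx_block add_block_mx !addr0 add0r.
Qed.

(** Each matrix of G is a translation times some [e^(sA)], that is a product of two exponentials of
    the Lie algebra. Conversely the block shape contains the exponentials by [expmx_lie] and is
    stable under products and inverses. *)
Lemma range_embG : range embG = connected_lie_subgroup (lie_algebra k.+1 a).
Proof.
apply/seteqP; split=> [_ [p _ <-]|M].
  have -> : embG p = expmx (block_mx 0 (lsubmx p)^T 0 0) *m expmx (last_coord p *: boldA k.+1 a).
    rewrite expmx_translation expmx_boldA /block1 mulmx_block embG_left /block1 add_block_mx.
    by rewrite !mulmx0 !mul0mx !addr0 !add0r !mul1mx mulmx1.
  refine (cls_mul _ _); apply: cls_exp.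
    exists (fun i => (lsubmx p)^T i 0), 0; rewrite lie_algebraE scale0r.
    by congr block_mx; apply/colP => i; rewrite [RHS]mxE.
  exists (fun _ => 0), (last_coord p).
  by rewrite big1 ?add0r // => i _; rewrite scale0r.
elim=> {M} [_ [x [s ->]]||B C _ [p _ <-] _ [q _ <-]|B _ [p _ <-]].
- rewrite lie_algebraE; have [y ->] := expmx_lie (\col_i x i) s.
  by exists (row_mx y^T s%:M) => //; rewrite embG_row.
- exists (row_mx 0^T (0 : R)%:M) => //.
  by rewrite embG_row scale0r expmx0 -scalar_mx_block.
- have E r : embG r = block_mx (expmx (last_coord r *: Amx k.+1 a)) (lsubmx r)^T 0 1%:M.
    by rewrite embG_left /block1 add_block_mx !addr0 add0r.
  exists (row_mx (expmx (last_coord p *: Amx k.+1 a) *m (lsubmx q)^T + (lsubmx p)^T)^T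
    (last_coord p + last_coord q)%:M) => //.
  by rewrite embG_row !E mulmx_block !mulmx0 !mul0mx !addr0 !add0r !mulmx1 -expmxD.
- exists (row_mx (- (expmx (- last_coord p *: Amx k.+1 a) *m (lsubmx p)^T))^T (- last_coord p)%:M) => //.
  by rewrite embG_row invmx_embG.
Qed.

End Group.

(** * Killing fields and transvections *)

Lemma derive_mx_sum {R : realType} (V : normedModType R) m n (F : V -> 'M[R]_(m, n))
    (I : Type) (r : seq I) (c : I -> R) (v : I -> V) x : smooth F ->
  'D_(\sum_(i <- r) c i *: v i) F x = \sum_(i <- r) c i *: 'D_(v i) F x.
Proof.
move=> sF; elim: r => [|i r IH]; first by rewrite !big_nil derive0.
by rewrite !big_cons derive_dirP // IH.
Qed.

(* The derivative of the frame coordinates of a constant vector in the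
   direction of the last coordinate, up to sign. *)
HB.lock Definition fshift {R : realType} (k : nat) (a s : R) (u : 'rV[R]_(k.+1 + 1 + 1))
  (i : 'I_(k.+1 + 1 + 1)) : R := (u *m Phi k a s *m (boldA k.+1 a)^T) 0 i.

Section Symmetric.
Context {R : realType} (k : nat) (a : R).
Hypothesis Ha : a ^+ 2 * (3 + k.+1%:R * k%:R) = 1.

Let N := (k.+1 + 1 + 1)%N.
Local Notation A := (boldA k.+1 a).
Local Notation dl i := (delta_mx 0 i : 'rV[R]_N).
Local Notation g := (gG k.+1 a).
Local Notation Phi := (Phi k a).
Local Notation fc := (fcoord k a).
Local Notation fr := (frame k a).
Local Notation fs := (fshift k a).
Implicit Types u v w p q : 'rV[R]_N.

Lemma fshiftE s u i : fs s u i = (u *m Phi s *m A^T) 0 i. Proof. by rewrite unlock. Qed.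

Lemma fshift_id s u : fs s u idxd = a * (fc s u idxd - fc s u idx1).
Proof. by rewrite fshiftE mul_trA_id !fcoordE. Qed.

Lemma fshift_sum s u i : fs s u i = \sum_j fc s u j * A i j.
Proof. by rewrite fshiftE mxE; apply: eq_bigr => j _; rewrite trmx_coef fcoordE. Qed.

Lemma fshift_frame s i j : fs s (fr s j) i = A i j.
Proof.
rewrite fshift_sum; under eq_bigr do rewrite fcoord_frame.
by rewrite (sum_coefE (fun j => A i j)).
Qed.

Lemma fshift_sym s u v :
  \sum_i (fs s u i * fc s v i + fc s u i * fs s v i) = 2 * a * (fc s u idxd * fc s v idxd).
Proof.
have E x y : \sum_i fs s x i * fc s y i = (x *m Phi s *m A^T *m (y *m Phi s)^T) 0 0.
  by rewrite mxE; apply: eq_bigr => i _; rewrite trmx_coef fshiftE fcoordE.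
have E' x y : \sum_i fc s x i * fs s y i = (x *m Phi s *m A *m (y *m Phi s)^T) 0 0.
  rewrite -mulmxA -[A]trmxK -trmx_mul mxE; apply: eq_bigr => i _.
  by rewrite trmx_coef fshiftE fcoordE.
rewrite big_split /= E E' -addmx_coef -mulmxDl -mulmxDr addrC boldA_sym.
rewrite -scalemxAr -scalemxAl scalemx_coef; congr (_ * _).
by rewrite mulmx_delta_trE !fcoordE.
Qed.

Lemma is_derive_fcoord_field (F : 'rV[R]_N -> 'rV[R]_N) p w i dF :
  is_derive p w F dF ->
  is_derive p w (fun q => fc (last_coord q) (F q) i)
    (fc (last_coord p) dF i - last_coord w * fs (last_coord p) (F p) i).
Proof.
move=> DF; rewrite (_ : (fun q => _) = (fun q => (F q *m Phi (last_coord q)) 0 i)); last first.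
  by apply/funext => q; rewrite fcoordE.
have D := is_derive_last w (is_derive_Phi k a (last_coord p)).
apply: is_derive_eq (is_derive_coef 0 i (is_derive_mulmx DF D)) _.
by rewrite addmx_coef -scalemxAr mulmxN mulmxA scalemx_coef oppmx_coef mulrN fcoordE fshiftE.
Qed.

Lemma is_derive_fcoord_cst v p w i :
  is_derive p w (fun q => fc (last_coord q) v i) (- last_coord w * fs (last_coord p) v i).
Proof.
apply: is_derive_eq (is_derive_fcoord_field i (is_derive_cst v p w)) _.
by rewrite fcoord0 sub0r mulNr.
Qed.

Section KillingField.
Variable X : 'rV[R]_N -> 'rV[R]_N.
Hypothesis kX : killing g X.
Let sX : smooth X := kX.1.
Let f q := X q 0 idxn.
Local Notation Y u := (fun q => 'D_u X q).

Lemma smooth_killing_last : smooth f. Proof. exact: smooth_coef. Qed.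

Lemma derive_killing_last u q : 'D_u f q = 'D_u X q 0 idxn.
Proof. by rewrite /f derive_entry //; exact: smooth_derivable. Qed.

(** The invariant form of the Killing equation: the derivative of the metric along [X] is [- 2 a f]
    times a rank one form, as the metric varies with the last coordinate only. *)
Lemma killing_inner u v p : let s := last_coord p in
  inner g p ('D_u X p) v + inner g p ('D_v X p) u = 2 * a * f p * (fc s u idxd * fc s v idxd).
Proof.
set s := last_coord p => /=; pose P := Phi s.
pose J : 'M[R]_N := \matrix_(i, l) 'D_(dl i) (fun q => X q 0 l) p.
have JE w : w *m J = 'D_w X p.
  rewrite [in RHS](row_sum_delta w) derive_mx_sum // mulmx_sum_row.
  apply: eq_bigr => i _; congr (_ *: _); apply/rowP => l; rewrite !mxE.
  by rewrite derive_entry //; exact: smooth_derivable.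
have gT : (g p)^T = g p by have [_ ->] := riemannian_metric_gG Ha.
have K : J *m g p + (J *m g p)^T = (2 * a * f p) *: (P *m delta_mx idxd idxd *m P^T).
  apply/matrixP => i j; have [_ /(_ p i j)] := kX.
  have [_ ->] := is_derive_coef i j (is_derive_metric Ha p (X p)).
  rewrite big_split /= addmx_coef trmx_coef !scalemx_coef -/s -/P => /eqP.
  rewrite addr_eq0 => /eqP E.
  rewrite [(J *m _) i j]mxE [(J *m _) j i]mxE.
  have -> : \sum_k0 J i k0 * g p k0 j = \sum_k0 g p k0 j * 'D_(dl i) (fun q => X q 0 k0) p.
    by apply: eq_bigr => l _; rewrite mxE mulrC.
  have -> : \sum_k0 J j k0 * g p k0 i = \sum_k0 g p i k0 * 'D_(dl j) (fun q => X q 0 k0) p.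
    by apply: eq_bigr => l _; rewrite mxE mulrC -[in RHS]gT trmx_coef.
  by rewrite -[LHS]opprK -E /last_coord -/(f p); ring.
have E : inner g p ('D_u X p) v + inner g p ('D_v X p) u = (u *m (J *m g p + (J *m g p)^T) *m v^T) 0 0.
  rewrite /inner -!JE mulmxDr mulmxDl addmx_coef -!mulmxA; congr (_ + _).
  by rewrite -[LHS]trmx_coef !trmx_mul !trmxK !mulmxA.
rewrite E K -scalemxAr -scalemxAl scalemx_coef; congr (_ * _).
by rewrite !mulmxA -[_ *m P^T *m _]mulmxA -trmx_mul mulmx_delta_trE !fcoordE.
Qed.

Lemma killing_frame u v p : let s := last_coord p in
  \sum_i (fc s ('D_u X p) i * fc s v i + fc s u i * fc s ('D_v X p) i) =
  2 * a * f p * (fc s u idxd * fc s v idxd).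
Proof.
rewrite /= -killing_inner !innerE // -big_split /=.
by apply: eq_bigr => i _; congr (_ + _); rewrite mulrC.
Qed.

Let e := dl idxn.
(** The d-th frame coordinate of [D_u X - f A u], a comparison of [X] with the Killing field
    [(A x, 1)]; it reappears as [killing_defect]. *)
Let pp u q := fc (last_coord q) ('D_u X q) idxd - f q * fs (last_coord q) u idxd.
Let rr u q := fc (last_coord q) ('D_u X q) idx1 - f q * fs (last_coord q) u idx1.

Let e_last : last_coord e = 1. Proof. by rewrite /last_coord coefmxE !eqxx. Qed.

Let e_id s : fc s e idxd = 0. Proof. by rewrite fcoord_dl_in id_neq_in. Qed.

Lemma inner_vertical p w : inner g p w (dl idxn) = w 0 idxn.
Proof. by rewrite innerC // -(frame_in k a (last_coord p)) inner_frame // fcoord_in. Qed.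

(** Since e_n has no d-coordinate, the right side of the Killing equation vanishes on it: the
    derivative of [X] along the normal is minus the gradient of [f]. *)
Lemma killing_vertical v p : let s := last_coord p in
  \sum_j fc s ('D_(dl idxn) X p) j * fc s v j = - 'D_v f p.
Proof.
have := killing_inner (dl idxn) v p; rewrite /= -/e e_id mul0r mulr0.
rewrite (inner_vertical p ('D_v X p)) -derive_killing_last innerE // => /eqP.
by rewrite addr_eq0 => /eqP ->.
Qed.

Lemma derive_vertical_last p : 'D_(dl idxn) f p = 0.
Proof.
have := killing_inner (dl idxn) (dl idxn) p; rewrite /= -/e e_id mul0r mulr0.
rewrite (inner_vertical p ('D_e X p)) -derive_killing_last => /eqP.
by rewrite -mulr2n mulrn_eq0 /= => /eqP.
Qed.

(** Obtained by differentiating [killing_vertical] along a leaf, where frame coordinates of constant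
    vectors do not vary, and exchanging the two derivatives of [X]. *)
Lemma killing_vertical2 u v p : u 0 idxn = 0 -> let s := last_coord p in
  \sum_j fc s ('D_(dl idxn) (Y u) p) j * fc s v j = - 'D_u (fun q => 'D_v f q) p.
Proof.
move=> un /=; set s := last_coord p.
have DY : is_derive p u (Y e) ('D_u (Y e) p) by apply/smooth_is_derive/smooth_derive.
have D : is_derive p u (fun q => \sum_j fc (last_coord q) ('D_e X q) j * fc (last_coord q) v j)
    (\sum_j fc s ('D_u (Y e) p) j * fc s v j).
  apply: is_derive_sumr => j.
  apply: is_derive_eq (is_derive_mulr (is_derive_fcoord_field j DY) (is_derive_fcoord_cst v p u j)) _.
  by rewrite /last_coord un; rewrite oppr0 !mul0r subr0 mulr0 addr0.
rewrite (derive_mx_comm e u p sX).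
have D' : is_derive p u (fun q => - 'D_v f q) (- 'D_u (fun q => 'D_v f q) p).
  apply: is_deriveN; apply: smooth_is_derive; apply: smooth_derive; exact: smooth_killing_last.
apply: (is_derive_unique D); rewrite (_ : (fun q => _) = (fun q => - 'D_v f q)) //.
by apply/funext => q; exact: killing_vertical.
Qed.

Lemma derive_comm_last u v p : 'D_u (fun q => 'D_v f q) p = 'D_v (fun q => 'D_u f q) p.
Proof. exact: (derive_comm u v p smooth_killing_last). Qed.

(** The horizontal Killing equation is differentiated along the normal. The second derivatives of
    [X] become Hessians of [f] by [killing_vertical2], and the terms from the variation of the frame
    are summed by [fshift_sym]. *)
Lemma hessian_killing u v p : u 0 idxn = 0 -> v 0 idxn = 0 -> let s := last_coord p in
  'D_u (fun q => 'D_v f q) p = - a * (pp u p * fc s v idxd + pp v p * fc s u idxd).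
Proof.
move=> un vn /=; set s := last_coord p.
have DY w : is_derive p e (Y w) ('D_e (Y w) p) by apply/smooth_is_derive/smooth_derive.
have Df : is_derive p e f 0.
  rewrite -(derive_vertical_last p); apply: smooth_is_derive; exact: smooth_killing_last.
have Dc w j : is_derive p e (fun q => fc (last_coord q) w j) (- fs s w j).
  by apply: is_derive_eq (is_derive_fcoord_cst w p e j) _; rewrite e_last mulN1r.
have DF w j : is_derive p e (fun q => fc (last_coord q) ('D_w X q) j)
    (fc s ('D_e (Y w) p) j - fs s ('D_w X p) j).
  by apply: is_derive_eq (is_derive_fcoord_field j (DY w)) _; rewrite e_last mul1r.
have D1 : is_derive p e (fun q => \sum_i (fc (last_coord q) ('D_u X q) i * fc (last_coord q) v i
       + fc (last_coord q) u i * fc (last_coord q) ('D_v X q) i))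
   (\sum_i (((fc s ('D_e (Y u) p) i - fs s ('D_u X p) i) * fc s v i + fc s ('D_u X p) i * - fs s v i)
     + (- fs s u i * fc s ('D_v X p) i + fc s u i * (fc s ('D_e (Y v) p) i - fs s ('D_v X p) i)))).
  by apply: is_derive_sumr => j; apply: is_deriveD; apply: is_derive_mulr.
have D2 : is_derive p e (fun q => 2 * a * f q * (fc (last_coord q) u idxd * fc (last_coord q) v idxd))
   (2 * a * f p * (- fs s u idxd * fc s v idxd + fc s u idxd * - fs s v idxd)).
  have D0 : is_derive p e (fun q => 2 * a * f q) 0.
    by apply: is_derive_eq (is_derive_mulr (is_derive_cst (2 * a) p e) Df) _; rewrite mul0r mulr0 addr0.
  apply: is_derive_eq (is_derive_mulr D0 (is_derive_mulr (Dc u idxd) (Dc v idxd))) _.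
  by rewrite mul0r add0r.
have E : (fun q => \sum_i (fc (last_coord q) ('D_u X q) i * fc (last_coord q) v i
       + fc (last_coord q) u i * fc (last_coord q) ('D_v X q) i)) =
    (fun q => 2 * a * f q * (fc (last_coord q) u idxd * fc (last_coord q) v idxd)).
  by apply/funext => q; exact: killing_frame.
rewrite E in D1; have := is_derive_unique D1 D2.
(* Regroups the differentiated sum into the four sums with known values: two Hessians and two
   instances of [fshift_sym]. *)
have S (z y x t r l : 'I_N -> R) b c h1 h2 :
  \sum_j z j * fc s v j = - h1 -> \sum_j y j * fc s u j = - h2 ->
  \sum_i (x i * fc s v i + t i * fs s v i) = b -> \sum_i (fs s u i * r i + fc s u i * l i) = c ->
  \sum_i (((z i - x i) * fc s v i + t i * - fs s v i) + (- fs s u i * r i + fc s u i * (y i - l i)))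
    = - h1 - h2 - b - c.
  move=> <- <- <- <-; rewrite -big_split -!sumrB; apply: eq_bigr => i _ /=; ring.
rewrite (S _ _ _ _ _ _ _ _ _ _ (killing_vertical2 v p un) (killing_vertical2 u p vn)
  (fshift_sym s ('D_u X p) v) (fshift_sym s u ('D_v X p))).
rewrite (derive_comm_last v u) -/s /pp -/s.
set h := 'D_u _ p; set x := fc s ('D_u X p) idxd; set y := fc s ('D_v X p) idxd => H.
have E2 : 2 * h = 2 * (- a * ((x - f p * fs s u idxd) * fc s v idxd + (y - f p * fs s v idxd) * fc s u idxd)).
  by rewrite -[LHS]opprK -[X in - X](_ : - h - h = _); [move/eqP: H; rewrite 2!subr_eq => /eqP ->; ring|ring].
by apply: (mulfI _ E2); rewrite pnatr_eq0.
Qed.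

End KillingField.
End Symmetric.

(** * Rigidity of Killing fields and the symmetric subspace *)

Section Transvections.
Context {R : realType} (k : nat) (a : R).
Hypothesis Ha : a ^+ 2 * (3 + k.+1%:R * k%:R) = 1.

Let N := (k.+1 + 1 + 1)%N.
Local Notation A := (boldA k.+1 a).
Local Notation dl i := (delta_mx 0 i : 'rV[R]_N).
Local Notation g := (gG k.+1 a).
Local Notation fc := (fcoord k a).
Local Notation fr := (frame k a).
Local Notation fs := (fshift k a).
Implicit Types u v w p q : 'rV[R]_N.

Section KillingField.
Variable X : 'rV[R]_N -> 'rV[R]_N.
Hypothesis kX : killing g X.
Let sX : smooth X := kX.1.
Let f q := X q 0 idxn.
Let e := dl idxn.

(* The frame coordinate [i] of [D_u X], minus its value for the multiple of the
   Killing field [(A x, 1)], generated by the left translations by the [(0, s)],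
   that has the same last component as [X]. *)
Definition killing_defect u q i :=
  fc (last_coord q) ('D_u X q) i - f q * fs (last_coord q) u i.
Local Notation kd := killing_defect.

(** The Killing equation for [X] and [f] times the identity [fshift_sym] have the same right side,
    so their difference is skew. *)
Lemma killing_defect_skew p i j :
  kd (fr (last_coord p) i) p j + kd (fr (last_coord p) j) p i = 0.
Proof.
set s := last_coord p.
have S (x y : 'I_N -> R) : \sum_l (x l * (l == j)%:R + (l == i)%:R * y l) = x j + y i.
  rewrite big_split /= (sum_coefE y) -(sum_coefE x); congr (_ + _).
  by apply: eq_bigr => l _; rewrite mulrC.
have F i0 : fc s (fr s i0) = fun l => (l == i0)%:R by apply/funext => l; rewrite fcoord_frame.
have := killing_frame Ha kX (fr s i) (fr s j) p; have := fshift_sym a s (fr s i) (fr s j).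
rewrite /= -/s !F !S /kd -/s => E1 E2.
have -> (x y z t c : R) : x - c * y + (z - c * t) = x + z - c * (y + t) by ring.
by rewrite E1 E2 -/(f p); ring.
Qed.

Lemma frame_horizontal s i : i != idxn -> (fr s i) 0 idxn = 0.
Proof. by move=> /negPf ni; rewrite frame_coef_in eq_sym ni. Qed.

(** The Hessian formula paired with e_d evaluates the d-coordinate of the mixed second derivative of
    [X]; the diagonal defect at e_d vanishes by skewness. *)
Lemma killing_defect_id u p : u 0 idxn = 0 ->
  is_derive p e (fun q => kd u q idxd) (a * kd u p idx1).
Proof.
move=> un; set s := last_coord p.
have e1 : last_coord e = 1 by rewrite /last_coord coefmxE !eqxx.
have DY : is_derive p e (fun q => 'D_u X q) ('D_e (fun q => 'D_u X q) p).
  exact/smooth_is_derive/smooth_derive.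
have Df : is_derive p e f 0.
  rewrite -(derive_vertical_last Ha kX p); apply: smooth_is_derive; exact: smooth_killing_last kX.
have Dc i : is_derive p e (fun q => fc (last_coord q) u i) (- fs s u i).
  by apply: is_derive_eq (is_derive_fcoord_cst a u p e i) _; rewrite e1 mulN1r.
have Ds : is_derive p e (fun q => fs (last_coord q) u idxd) (a * (- fs s u idxd + fs s u idx1)).
  rewrite (_ : (fun q => _) = (fun q => a * (fc (last_coord q) u idxd - fc (last_coord q) u idx1))); last first.
    by apply/funext => q; rewrite fshift_id.
  apply: is_derive_eq (is_derive_mulr (is_derive_cst a p e) (is_deriveB (Dc idxd) (Dc idx1))) _.
  by rewrite mul0r add0r opprK.
have H : fc s ('D_e (fun q => 'D_u X q) p) idxd = a * kd u p idxd.
  have V := killing_vertical2 Ha kX (fr s idxd) p un; rewrite /= -/s in V.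
  rewrite (eq_bigr (fun j => (j == idxd)%:R * fc s ('D_e (fun q => 'D_u X q) p) j)) in V; last first.
    by move=> j _; rewrite fcoord_frame mulrC.
  rewrite (sum_coefE (fun j => fc s ('D_e (fun q => 'D_u X q) p) j)) in V; rewrite V.
  have E0 : (fr s idxd) 0 idxn = 0 by apply: frame_horizontal; rewrite id_neq_in.
  have Hs := hessian_killing Ha kX p un E0; rewrite /= -/s in Hs; rewrite Hs.
  have := killing_defect_skew p idxd idxd; rewrite -/s -mulr2n => /eqP.
  rewrite mulrn_eq0 /= => /eqP K0.
  rewrite -/(f p) -/(kd u p idxd) -/(kd (fr s idxd) p idxd) K0.
  by rewrite fcoord_frame eqxx /=; ring.
apply: is_derive_eq (is_deriveB (is_derive_fcoord_field a idxd DY) (is_derive_mulr Df Ds)) _.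
by rewrite e1 -/s H /kd -/s !fshift_id; ring.
Qed.

(** [f] is constant along the normal and derivatives commute, so the Hessian of [f] is constant
    along the normal as well. Differentiating [hessian_killing] in that direction with
    [killing_defect_id] gives the relation. *)
Lemma killing_defect_relation u v p : u 0 idxn = 0 -> v 0 idxn = 0 -> let s := last_coord p in
  a * (kd u p idx1 * fc s v idxd + kd v p idx1 * fc s u idxd)
    = kd u p idxd * fs s v idxd + kd v p idxd * fs s u idxd.
Proof.
move=> un vn /=; set s := last_coord p.
have sf : smooth f := smooth_killing_last kX.
have hess0 : 'D_e (fun q => 'D_u (fun q' => 'D_v f q') q) p = 0.
  rewrite (derive_comm e u p (smooth_derive v sf)).
  have -> : (fun q => 'D_e (fun q' => 'D_v f q') q) = cst 0; last by rewrite derive_cst.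
  apply/funext => q; rewrite (derive_comm e v q sf).
  have -> : (fun q' => 'D_e f q') = cst 0 by apply/funext => q'; exact: (derive_vertical_last Ha kX q').
  by rewrite derive_cst.
have D0 := smooth_is_derive p e (smooth_derive u (smooth_derive v sf)).
rewrite hess0 in D0.
have Dc w : is_derive p e (fun q => fc (last_coord q) w idxd) (- fs s w idxd).
  by apply: is_derive_eq (is_derive_fcoord_cst a w p e idxd) _; rewrite /last_coord coefmxE !eqxx mulN1r.
have D1 := is_deriveD (is_derive_mulr (killing_defect_id p un) (Dc v))
                      (is_derive_mulr (killing_defect_id p vn) (Dc u)).
have D2 := is_derive_mulr (is_derive_cst (- a) p e) D1.
rewrite (_ : (fun q => _) = (fun q => 'D_u (fun q' => 'D_v f q') q)) in D2; last first.
  apply/funext => q; have := hessian_killing Ha kX q un vn => /= ->.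
  by [].
have := is_derive_unique D0 D2; rewrite mul0r add0r => /esym/eqP.
rewrite mulf_eq0 oppr_eq0 (negPf (a_neq0 Ha)) /= => /eqP E.
apply/eqP; rewrite -subr_eq0 -E; apply/eqP; ring.
Qed.

(** The relation is evaluated on (e_1, e_1), (u, e_1) and (u, e_d). It is effective because e_1 has
    d-coordinate 0 while [A e_1] has d-coordinate [- a]; skewness passes from the pair (e_1, d) to
    the pair (e_d, 1). *)
Lemma killing_defect0 u p : u 0 idxn = 0 -> kd u p idxd = 0 /\ kd u p idx1 = 0.
Proof.
move=> un; set s := last_coord p; have a0 := a_neq0 Ha.
have e1n : fr s idx1 0 idxn = 0 by apply: frame_horizontal; rewrite i1_neq_in.
have edn : fr s idxd 0 idxn = 0 by apply: frame_horizontal; rewrite id_neq_in.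
have half (x : R) : x + x = 0 -> x = 0.
  by move=> /eqP; rewrite -mulr2n mulrn_eq0 => /eqP.
have r1 : kd (fr s idx1) p idx1 = 0 by apply: half; exact: killing_defect_skew.
have p1 : kd (fr s idx1) p idxd = 0.
  have := killing_defect_relation p e1n e1n; rewrite /= -/s r1 fshift_id !fcoord_frame !idxE /= => /eqP.
  rewrite -subr_eq0 => /eqP E; apply: (mulIf a0); rewrite mul0r; apply: half.
  by apply: (etrans _ E); ring.
have rd : kd (fr s idxd) p idx1 = 0.
  by have := killing_defect_skew p idxd idx1; rewrite -/s p1 addr0.
have pu : kd u p idxd = 0.
  have := killing_defect_relation p un e1n; rewrite /= -/s r1 p1 !fshift_id !fcoord_frame !idxE /= => /eqP.
  rewrite -subr_eq0 => /eqP E; apply: (mulIf a0); rewrite mul0r.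
  by apply: (etrans _ E); ring.
have pd : kd (fr s idxd) p idxd = 0 by apply: half; exact: killing_defect_skew.
split=> //; have := killing_defect_relation p un edn; rewrite /= -/s rd pu pd !fcoord_frame eqxx /= => /eqP.
rewrite -subr_eq0 => /eqP E; apply: (mulfI a0); rewrite mulr0.
by apply: (etrans _ E); ring.
Qed.

(** On the rows 1 and d, [D_v X = f A v]. Differentiating along a horizontal [w] and using symmetry
    gives [D_w f (A v)_i = D_v f (A w)_i]. Row 1 on (e_1, e_d) kills [D_{e_1} f], then row d on
    (e_1, u) kills [D_u f], as A_1d = a, A_11 = 0 and A_d1 = - a. *)
Lemma derive_killing_last0 u p : u 0 idxn = 0 -> 'D_u f p = 0.
Proof.
move=> un; set s := last_coord p; have a0 := a_neq0 Ha.
have sf : smooth f := smooth_killing_last kX.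
have H w v i : w 0 idxn = 0 -> (forall q, fc (last_coord q) ('D_v X q) i = f q * fs (last_coord q) v i) ->
    fc s ('D_w (fun q => 'D_v X q) p) i = 'D_w f p * fs s v i.
  move=> wn E; have DY : is_derive p w (fun q => 'D_v X q) ('D_w (fun q => 'D_v X q) p).
    exact/smooth_is_derive/smooth_derive.
  have Ds : is_derive p w (fun q => fs (last_coord q) v i) 0.
    rewrite (_ : (fun q => _) = (fun q => \sum_j fc (last_coord q) v j * A i j)); last first.
      by apply/funext => q; rewrite fshift_sum.
    have D j : is_derive p w (fun q => fc (last_coord q) v j * A i j) 0.
      apply: is_derive_eq (is_derive_mulr (is_derive_fcoord_cst a v p w j) (is_derive_cst (A i j) p w)) _.
      by rewrite /last_coord wn oppr0 !mul0r mulr0 addr0.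
    by apply: is_derive_eq (is_derive_sumr (index_enum 'I_N) xpredT D) _; rewrite big1.
  have D1 := is_derive_fcoord_field a i DY.
  have D2 := is_derive_mulr (smooth_is_derive p w sf) Ds.
  rewrite (_ : (fun q => f q * _) = (fun q => fc (last_coord q) ('D_v X q) i)) in D2; last first.
    by apply/funext => q; rewrite E.
  have := is_derive_unique D1 D2; have -> : last_coord w = 0 by [].
  by rewrite mul0r subr0 mulr0 addr0.
have hor v i : v 0 idxn = 0 -> i \in [:: idxd; idx1] ->
    forall q, fc (last_coord q) ('D_v X q) i = f q * fs (last_coord q) v i.
  move=> vn ii q; apply/eqP; rewrite -subr_eq0; apply/eqP.
  have [K1 K2] := killing_defect0 q vn.
  by move: ii; rewrite !inE => /orP[]/eqP->.
have S w v i : w 0 idxn = 0 -> v 0 idxn = 0 -> i \in [:: idxd; idx1] ->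
    'D_w f p * fs s v i = 'D_v f p * fs s w i.
  move=> wn vn ii; rewrite -(H w v i wn (hor v i vn ii)) -(H v w i vn (hor w i wn ii)).
  by rewrite (derive_mx_comm w v p sX).
have e1n : fr s idx1 0 idxn = 0 by apply: frame_horizontal; rewrite i1_neq_in.
have edn : fr s idxd 0 idxn = 0 by apply: frame_horizontal; rewrite id_neq_in.
have D1 : 'D_(fr s idx1) f p = 0.
  have := S _ _ idx1 e1n edn; rewrite !inE eqxx orbT !fshift_frame boldA_i1_i1 boldA_i1_id mulr0.
  by move=> /(_ isT)/eqP; rewrite mulf_eq0 (negPf a0) orbF => /eqP.
have := S _ _ idxd e1n un; rewrite !inE eqxx D1 mul0r fshift_id !fcoord_frame !idxE /= => /(_ isT)/esym/eqP.
by rewrite sub0r mulrN1 mulf_eq0 oppr_eq0 (negPf a0) orbF => /eqP.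
Qed.

End KillingField.

Lemma symmetric_subspaceE p u : symmetric_subspace g p u <->
  forall i, i \in [:: idxd; idxn] -> fc (last_coord p) u i = 0.
Proof.
set s := last_coord p; split=> [[X [[kX tX] <-]]|u0].
  have sX : smooth X := kX.1.
  have edn : fr s idxd 0 idxn = 0 by apply: frame_horizontal; rewrite id_neq_in.
  have e1n : fr s idx1 0 idxn = 0 by apply: frame_horizontal; rewrite i1_neq_in.
  (* The last component of the covariant derivative along e_d is [D_{e_d} f + a X_d], whose first
     term vanishes. *)
  have Xd : fc s (X p) idxd = 0.
    have := tX (fr s idxd); rewrite /nabla connection_formE // -/s => /(congr1 (fun v : 'rV[R]_N => v 0 idxn)).
    rewrite addmx_coef -(derive_killing_last kX) (derive_killing_last0 kX p edn) add0r conn_in.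
    rewrite fcoord_frame eqxx zeromx_coef mulr1 => /eqP.
    by rewrite mulf_eq0 (negPf (a_neq0 Ha)) => /eqP.
  (* The d-coordinate of the covariant derivative along e_1 is [- a f]: the defect vanishes, and the
     connection term involves only the last and d-coordinates of e_1, both 0. *)
  have Xn : X p 0 idxn = 0.
    have := tX (fr s idx1); rewrite /nabla connection_formE // -/s => /(congr1 (fun v => fc s v idxd)).
    rewrite fcoordD fcoord_conn e1n Xd !fcoord_frame !idxE fcoord0.
    have [K _] := killing_defect0 kX p e1n; move: K.
    rewrite /killing_defect -/s fshift_id !fcoord_frame !idxE /= => /eqP.
    rewrite subr_eq0 => /eqP -> E; apply: (mulIf (a_neq0 Ha)); rewrite mul0r.
    by apply: oppr_inj; rewrite oppr0; apply: (etrans _ E); ring.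
  by move=> i; rewrite !inE => /orP[]/eqP-> //; rewrite fcoord_in.
have ud : fc s u idxd = 0 by apply: u0; rewrite !inE eqxx.
have un : u 0 idxn = 0 by rewrite -(fcoord_in a s) u0 // !inE eqxx orbT.
have su : smooth (cst u : 'rV[R]_N -> 'rV[R]_N).
  apply: (@smooth_closed _ _ _ (fun f => exists c, f = cst c)); last by exists u.
    by move=> _ [c ->]; exact: cst_continuous.
  move=> _ v [c ->]; exists (fun=> 0 : 'rV[R]_N); first by exists 0.
  by move=> x; exact: is_derive_cst.
exists (cst u); split=> //; split; first split=> // q i j.
  have [_ ->] := is_derive_coef i j (is_derive_metric Ha q (cst u q)).
  rewrite /last_coord un mulr0 oppr0 scale0r zeromx_coef add0r big1 // => l _.
  by rewrite (_ : (fun q => _) = cst (u 0 l)) // !derive_cst !mulr0 addr0.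
move=> v; rewrite nabla_cst // -/s; apply: (@fcoord_eq _ k a s) => i.
by rewrite fcoord_conn ud un fcoord0; ring.
Qed.

Lemma codim_symmetric_subspace p : has_codim (symmetric_subspace g p) 2.
Proof.
have U : uniq [:: idxd; idxn : 'I_N] by rewrite /= inE id_neq_in.
exact: (has_codim_fcoord U (symmetric_subspaceE p)).
Qed.

End Transvections.

(** * Holonomy *)

(** On [Z] the functional [c] satisfies [z p(W) c = p(a) z c] for every polynomial [p]. For the
    characteristic polynomial the left side is 0 by Cayley-Hamilton, while [p(a)] is nonzero: from
    [v W = a v] and skewness follows [a v v^T = v W v^T = 0], hence [v = 0]. *)
Lemma skew_eigen_functional {R : realFieldType} n (W : 'M[R]_n.+1) (a : R) (c : 'cV[R]_n.+1)
    (Z : 'rV[R]_n.+1 -> Prop) :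
  a != 0 -> W^T = - W -> (forall z, Z z -> Z (z *m W)) ->
  (forall z, Z z -> z *m W *m c = a *: (z *m c)) -> forall z, Z z -> z *m c = 0.
Proof.
move=> a0 WT ZW Zc.
have horner (p : {poly R}) z : Z z -> z *m horner_mx W p *m c = p.[a] *: (z *m c).
  elim/poly_ind: p z => [|p b IH] z Zz; first by rewrite rmorph0 mulmx0 mul0mx horner0 scale0r.
  rewrite rmorphD rmorphM /= horner_mx_X horner_mx_C hornerD hornerMX hornerC.
  rewrite mulmxDr mulmxDl mul_mx_scalar -scalemxAl scalerDl; congr (_ + _).
  have -> : horner_mx W p * W = W *m horner_mx W p.
    by rewrite -[W *m _](_ : W * horner_mx W p = _) // -{2 3}(horner_mx_X W) -!rmorphM mulrC.
  by rewrite mulmxA IH ?Zc ?scalerA //; exact: ZW.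
move=> z Zz; have := horner (char_poly W) z Zz; rewrite Cayley_Hamilton mulmx0 mul0mx => /esym/eqP.
rewrite scaler_eq0 => /orP[|/eqP//].
rewrite -/(root _ _) -eigenvalue_root_char => /eigenvalueP[v vW v0]; exfalso.
move/negP: v0; apply; have vv : v *m W *m v^T = a *: (v *m v^T) by rewrite vW -scalemxAl.
have : v *m v^T = 0.
  apply: (scalerI a0); rewrite scaler0 -vv.
  have : (v *m W *m v^T)^T = - (v *m W *m v^T).
    by rewrite !trmx_mul trmxK WT mulNmx mulmxN mulmxA.
  move=> /matrixP/(_ 0 0); rewrite [LHS]mxE [RHS]mxE => /eqP.
  rewrite -addr_eq0 -mulr2n mulrn_eq0 /= => /eqP E.
  by apply/matrixP => i j; rewrite !ord1 E mxE.
move=> /matrixP/(_ 0 0); rewrite mxE [RHS]mxE => /eqP; rewrite psumr_eq0 => [/allP E|i _].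
  apply/eqP/rowP => i; have := E i (mem_index_enum i).
  by rewrite [v^T _ _]mxE -expr2 sqrf_eq0 [RHS]mxE => /eqP.
by rewrite [v^T _ _]mxE -expr2 sqr_ge0.
Qed.

Section SkewPart.
Context {R : realType} (k : nat) (a : R).
Hypothesis a0 : a != 0.

Let N := (k.+1 + 1 + 1)%N.
Local Notation A := (boldA k.+1 a).
Local Notation dl i := (delta_mx 0 i : 'rV[R]_N).

Definition skewA : 'M[R]_N := A - a *: delta_mx idxd idxd.
Local Notation W := skewA.

Lemma skewA_tr : W^T = - W.
Proof.
rewrite /skewA linearB /= linearZ /= trmx_delta opprB.
have -> : A^T = (2 * a) *: delta_mx idxd idxd - A by rewrite -boldA_sym [A + _]addrC addrK.
by rewrite mulr_natl mulr2n scalerDl addrAC addrK.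
Qed.

Lemma skewA_trA : W + A^T = a *: delta_mx idxd idxd.
Proof.
rewrite /skewA addrAC boldA_sym -scalerBl; congr (_ *: _); ring.
Qed.

Lemma mul_skewA_in (z : 'rV[R]_N) : (z *m W) 0 idxn = 0.
Proof.
rewrite mxE big1 // => i _; rewrite /skewA addmx_coef oppmx_coef scalemx_coef deltamx_coef boldA_in_r.
by rewrite [idxn == idxd]eq_sym id_neq_in andbF mulr0 subr0 mulr0.
Qed.

Lemma delta_in_skewA : dl idxn *m W = 0.
Proof.
apply/rowP => i; rewrite delta_mulmxE /skewA addmx_coef oppmx_coef scalemx_coef deltamx_coef boldA_in_l.
by rewrite [idxn == idxd]eq_sym id_neq_in mulr0 subr0 mxE.
Qed.

Lemma mul_skewA_id (z : 'rV[R]_N) : (z *m W) 0 idxd = a * z 0 idx1.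
Proof.
have -> : W = - W^T by rewrite skewA_tr opprK.
have -> : W^T = A^T - a *: delta_mx idxd idxd by rewrite /skewA linearB /= linearZ /= trmx_delta.
rewrite mulmxN oppmx_coef mulmxBr addmx_coef oppmx_coef mul_trA_id -scalemxAr scalemx_coef.
have -> : (z *m (delta_mx idxd idxd : 'M[R]_N)) 0 idxd = z 0 idxd.
  by rewrite -[z *m _]mulmx1 -trmx1 mulmx_delta_trE mxE eqxx mulr1.
ring.
Qed.

Lemma mul_skewA_ul (z : 'rV[R]_N) (j : 'I_k.+1) : z 0 idxd = 0 -> z 0 idxn = 0 ->
  (z *m W) 0 (lshift 1 (lshift 1 j)) =
  a * \sum_(i < k.+1) z 0 (lshift 1 (lshift 1 i)) * ((i < j)%N%:R - (j < i)%N%:R).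
Proof.
move=> zd zn; rewrite mxE big_split_ord /= big_ord1 -idxnE zn mul0r addr0.
rewrite big_split_ord /= big_ord1 -idxdE zd mul0r addr0 mulr_sumr; apply: eq_bigr => i _.
by rewrite /skewA addmx_coef oppmx_coef scalemx_coef deltamx_coef boldA_ul !ul_eq_id mulr0 subr0; ring.
Qed.

(* Once the coordinates 1, ..., j vanish on [Z], the coordinate j + 1 satisfies
   [(z W)_(j+1) = a z_(j+1)], and [a] is not an eigenvalue of the skew matrix [W]. *)
Lemma skewA_cyclic (Z : 'rV[R]_N -> Prop) :
  (forall z, Z z -> z 0 idxd = 0 /\ z 0 idxn = 0) ->
  (forall z, Z z -> Z (z *m W)) -> forall z, Z z -> z = 0.
Proof.
move=> Z0 ZW.
have H (m : nat) : (m < k.+1)%N -> forall z, Z z -> z 0 (lshift 1 (lshift 1 (inord m))) = 0.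
  elim: m => [|m IH] mk z Zz.
    have [zd _] := Z0 _ (ZW z Zz); move/eqP: zd; rewrite mul_skewA_id mulf_eq0 (negPf a0) /= idx1E.
    by rewrite (_ : inord 0 = 0) => [/eqP//|]; apply: val_inj; rewrite /= inordK.
  pose c : 'cV[R]_N := delta_mx (lshift 1 (lshift 1 (inord m.+1))) 0.
  have Zc (y : 'rV[R]_N) : Z y -> y *m W *m c = a *: (y *m c).
    move=> Zy; apply/matrixP => i j; rewrite !ord1 scalemx_coef !mulmx_deltaE.
    have [yd yn] := Z0 y Zy; have mk' := ltnW mk.
    have Wm := IH mk' _ (ZW y Zy).
    (* Coordinate [m] of [y W] is 0 by induction and is subtracted. Columns [m] and [m.+1] of
       [Mskew] differ only in the rows [m] and [m.+1], by 1 each, which leaves [a (y_m + y_(m+1))]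
       with [y_m = 0]. *)
    rewrite -[LHS]subr0 -[X in _ - X]Wm !mul_skewA_ul // -mulrBr -sumrB; congr (_ * _).
    rewrite -[RHS]addr0 -[X in _ = _ + X](IH mk' y Zy).
    rewrite (bigD1 (inord m.+1)) //= (bigD1 (inord m)) /=; last first.
      by rewrite -val_eqE /= !inordK // ltn_eqF.
    rewrite !inordK // big1 ?addr0 => [|l /andP[lm1 lm]].
      by rewrite !ltnn ltnSn ltnNge leqnSn /=; ring.
    move: lm1 lm; rewrite -!val_eqE /= !inordK // => lm1 lm.
    have -> : (l < m.+1)%N = (l < m)%N by rewrite ltnS leq_eqVlt (negPf lm).
    have -> : (m.+1 < l)%N = (m < l)%N by rewrite [RHS]leq_eqVlt eq_sym (negPf lm1).
    by rewrite subrr.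
  have := @skew_eigen_functional R (k + 1 + 1) W a c Z a0 skewA_tr ZW Zc z Zz.
  by move=> /matrixP/(_ 0 0); rewrite mulmx_deltaE mxE.
move=> z Zz; have [zd zn] := Z0 z Zz; apply/rowP => i; rewrite mxE.
by elim/ord_N_ind: i => [i||] //; rewrite -[i]inord_val H.
Qed.

End SkewPart.

Section Holonomy.
Context {R : realType} (k : nat) (a : R).
Hypothesis Ha : a ^+ 2 * (3 + k.+1%:R * k%:R) = 1.

Let N := (k.+1 + 1 + 1)%N.
Local Notation A := (boldA k.+1 a).
Local Notation W := (skewA k a).
Local Notation dl i := (delta_mx 0 i : 'rV[R]_N).
Local Notation g := (gG k.+1 a).
Local Notation Phi := (Phi k a).
Local Notation conn := (@connection R k a).
Local Notation fc := (fcoord k a).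
Local Notation fr := (frame k a).
Local Notation e := (dl idxn).
Local Notation E t := (expmx (t *: W)).
Implicit Types p q u v w x : 'rV[R]_N.

Lemma is_derive_line_point p v (t : R) : is_derive t 1 (fun t : R => p + t *: v) v.
Proof.
apply: is_derive_eq (is_deriveD (is_derive_cst p t 1)
  (is_derive_scalemx (is_derive_id t 1) (is_derive_cst v t 1))) _.
by rewrite add0r scale1r scaler0 addr0.
Qed.

Lemma smooth_line p v : smooth (fun t : R => p + t *: v).
Proof.
apply: (@smooth_closed _ _ _ (fun f : R -> 'rV[R]_N => exists c d, f = fun t : R => c + t *: d)).
- by move=> _ [c [d ->]]; apply: is_derive_continuous (is_derive_line_point c d).
- move=> _ r [c [d ->]]; exists (fun=> r *: d).
    by exists (r *: d), 0; apply/funext => t; rewrite scaler0 addr0.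
  move=> t; have := is_derive_scale_dir r (is_derive_line_point c d t).
  by rewrite [r *: (1 : R)]mulr1.
- by exists p, v.
Qed.

Lemma transport_step (c Y : R -> 'rV[R]_N) p u q w :
  smooth c -> c 0 = p -> Y 0 = u ->
  (forall t : R, is_derive t 1 Y (- conn (last_coord (c t)) ('D_1 c t) (Y t))) ->
  parallel_transport g (c 1) (Y 1) q w -> parallel_transport g p u q w.
Proof.
move=> sc <- <- dY; apply: parallel_transport_cat => // t.
by rewrite (derive1E c t) (connection_formE Ha (c t)).
Qed.

(* Transport along the geodesic [t |-> (x, s + t)] is the rotation [e^(tW)] in the
   left invariant frame. *)
Definition vertical_transport s t u : 'rV[R]_N := u *m Phi s *m E t *m Phi (- (s + t)).

Lemma mul_delta_diag (y : 'rV[R]_N) i : y *m delta_mx i i = y 0 i *: dl i.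
Proof.
rewrite -(mul_delta_mx (0 : 'I_1)) mulmxA.
have -> : y *m delta_mx i 0 = (y 0 i)%:M.
  by apply/matrixP => l j; rewrite !ord1 mulmx_deltaE mxE eqxx mulr1n.
by rewrite mul_scalar_mx.
Qed.

(** Rotating the frame coordinates contributes [W] and differentiating the frame contributes [A^T];
    their sum [a E_dd] is exactly the connection term along e_n. *)
Lemma parallel_transport_vertical p s t u q w : last_coord p = s ->
  parallel_transport g (p + t *: e) (vertical_transport s t u) q w ->
  parallel_transport g p u q w.
Proof.
move=> ps H.
pose Y (y : R) := u *m Phi s *m expmx ((t * y + 0) *: W) *m Phi (- (t * y + s)).
apply: (@transport_step (fun y : R => p + y *: (t *: e)) Y p u q w).
- exact: smooth_line.
- by rewrite scale0r addr0.
- by rewrite /Y mulr0 !add0r scale0r expmx0 mulmx1 -mulmxA PhiVr mulmx1.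
- move=> y; have [_ ->] := is_derive_line_point p (t *: e) y.
  have -> : last_coord (p + y *: (t *: e)) = t * y + s.
    by rewrite linearD !linearZ /= ps /last_coord coefmxE !eqxx /GRing.scale /=; ring.
  have D1 := is_derive_mulmxl (u *m Phi s) (is_derive_comp_affine (is_derive_expmx W (t * y + 0))).
  have D2 := @is_derive_comp_affine _ _ (fun s => Phi (- s)) t s y _ (is_derive_PhiN k a (t * y + s)).
  apply: is_derive_eq (is_derive_mulmx D1 D2) _.
  set z := u *m Phi s; set s' := t * y + s; set E' := expmx _.
  have -> : z *m (t *: (W *m E')) *m Phi (- s') + z *m E' *m (t *: (A^T *m Phi (- s'))) =
     (t * a * (z *m E') 0 idxd) *: fr s' idxd.
    rewrite expmx_commZ -!scalemxAr -scalemxAl -scalerDr !mulmxA -mulmxDl -mulmxDr skewA_trA.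
    by rewrite -scalemxAr mul_delta_diag -!scalemxAl !scalerA -frameE.
  have -> : (z *m E') 0 idxd = fc s' (Y y) idxd by rewrite fcoordE /Y -mulmxA PhiVl mulmx1.
  apply: (@fcoord_eq _ k a s') => i.
  rewrite fcoordN fcoord_conn !fcoord_lin fcoord_frame fcoord_dl_in !coefmxE !eqxx id_neq_in /=.
  by ring.
- rewrite scale1r /Y mulr1 addr0 [t + s]addrC.
  exact: H.
Qed.

(* Transport along a straight line in a leaf [s = cst] is a rotation in the plane
   of the frame vectors of index d and n. *)
Definition horizontal_transport s (r : R) u : 'rV[R]_N :=
  u + (((cos r - 1) * fc s u idxd + sin r * u 0 idxn) *: fr s idxd
       + ((cos r - 1) * u 0 idxn - sin r * fc s u idxd) *: e).

(** For horizontal [x] the frame stays fixed and the transport equation is [y_d' = a x_d y_n],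
    [y_n' = - a x_d y_d]: a rotation of total angle [a x_d]. *)
Lemma parallel_transport_horizontal p s x u q w : last_coord p = s -> x 0 idxn = 0 ->
  parallel_transport g (p + x) (horizontal_transport s (a * fc s x idxd) u) q w ->
  parallel_transport g p u q w.
Proof.
move=> ps xn H; set r := a * fc s x idxd in H.
pose Y (y : R) := horizontal_transport s (r * y + 0) u.
apply: (@transport_step (fun y : R => p + y *: x) Y p u q w).
- exact: smooth_line.
- by rewrite scale0r addr0.
- by rewrite /Y /horizontal_transport mulr0 addr0 cos0 sin0 subrr !mul0r subrr addr0 !scale0r !addr0.
- move=> y; have [_ ->] := is_derive_line_point p x y.
  have -> : last_coord (p + y *: x) = s.
    by rewrite linearD linearZ /= ps (_ : last_coord x = 0) // scaler0 addr0.
  have Dc := is_derive_comp_affine (is_derive_cos (r * y + 0)).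
  have Ds := is_derive_comp_affine (is_derive_sin (r * y + 0)).
  have Dk (c : R) : is_derive y 1 (fun=> c) 0 by exact: is_derive_cst.
  have D1 := is_deriveD (is_derive_mulr (is_deriveB Dc (Dk 1)) (Dk (fc s u idxd))) (is_derive_mulr Ds (Dk (u 0 idxn))).
  have D2 := is_deriveB (is_derive_mulr (is_deriveB Dc (Dk 1)) (Dk (u 0 idxn))) (is_derive_mulr Ds (Dk (fc s u idxd))).
  apply: is_derive_eq (is_deriveD (is_derive_cst u y 1) (is_deriveD
    (is_derive_scalemx D1 (is_derive_cst (fr s idxd) y 1)) (is_derive_scalemx D2 (is_derive_cst e y 1)))) _.
  have Yd : fc s (Y y) idxd = cos (r * y + 0) * fc s u idxd + sin (r * y + 0) * u 0 idxn.
    by rewrite /Y /horizontal_transport !fcoord_lin fcoord_frame fcoord_dl_in eqxx id_neq_in /=; ring.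
  have Yn : Y y 0 idxn = cos (r * y + 0) * u 0 idxn - sin (r * y + 0) * fc s u idxd.
    by rewrite /Y /horizontal_transport !coefmxE frame_coef_in [idxn == idxd]eq_sym id_neq_in !eqxx /=; ring.
  apply: (@fcoord_eq _ k a s) => i.
  rewrite fcoordN fcoord_conn Yd Yn xn !fcoord_lin !fcoord_frame !fcoord_dl_in /GRing.scale /= /r.
  by ring.
- by rewrite scale1r /Y mulr1 addr0.
Qed.

End Holonomy.

(** * Loops and irreducibility *)

Section Irreducible.
Context {R : realType} (k : nat) (a : R).
Hypothesis Ha : a ^+ 2 * (3 + k.+1%:R * k%:R) = 1.

Let N := (k.+1 + 1 + 1)%N.
Local Notation A := (boldA k.+1 a).
Local Notation W := (skewA k a).
Local Notation dl i := (delta_mx 0 i : 'rV[R]_N).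
Local Notation g := (gG k.+1 a).
Local Notation Phi := (Phi k a).
Local Notation fc := (fcoord k a).
Local Notation fr := (frame k a).
Local Notation e := (dl idxn).
Local Notation E t := (expmx (t *: W)).
Implicit Types p q u v w x : 'rV[R]_N.

Lemma delta_in_expW t : e *m E t = e.
Proof.
transitivity (e *m E 0); last by rewrite scale0r expmx0 mulmx1.
apply: (@is_derive0_cst_mx _ _ _ (fun t => e *m E t)) => y.
apply: is_derive_eq (is_derive_mulmxl _ (is_derive_expmx W y)) _.
by rewrite mulmxA delta_in_skewA mul0mx.
Qed.

Lemma mul_expW_in (z : 'rV[R]_N) t : (z *m E t) 0 idxn = z 0 idxn.
Proof.
transitivity ((z *m E 0) 0 idxn); last by rewrite scale0r expmx0 mulmx1.
apply: (@is_derive_0_is_cst _ (fun t => (z *m E t) 0 idxn)) => y.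
apply: is_derive_eq (is_derive_coef 0 idxn (is_derive_mulmxl z (is_derive_expmx W y))) _.
by rewrite expmx_commZ mulmxA mul_skewA_in.
Qed.

(** The entry vanishes at 0 with derivative [a] there, so it is not identically zero. It serves as
    the denominator when a leaf direction without d-coordinate at another height is sought. *)
Lemma Phi_i1_id_neq0 : exists r, Phi r idx1 idxd != 0.
Proof.
apply: contrapT => H.
have Z : (fun s : R => Phi s idx1 idxd) = cst 0.
  apply/funext => s; apply/eqP; apply: contraT => Hs; exfalso; apply: H; by exists s.
have D := is_derive_coef idx1 idxd (is_derive_Phi k a 0).
rewrite Z in D; have := is_derive_unique D (is_derive_cst (0 : R) (0 : R) 1).
rewrite Phi0 mul1mx oppmx_coef -(delta_mulmxE A^T) mul_trA_id !coefmxE !idxE /=.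
move=> /eqP; rewrite sub0r mulrN1 opprK => /eqP a0.
by move: (a_neq0 Ha); rewrite a0 eqxx.
Qed.

(* A loop going up by [t], along a leaf, up by [r], back along the leaf and
   down; the direction in the leaf is chosen so that the transport back along
   the leaf is trivial. *)
Lemma parallel_transport_loop p (t th : R) u : let s := last_coord p in
  let c := (u *m Phi s *m E t) 0 idxd in
  parallel_transport g p u p
    (u + ((cos th - 1) * c + sin th * u 0 idxn) *: (dl idxd *m E (- t) *m Phi (- s))
       + ((cos th - 1) * u 0 idxn - sin th * c) *: e).
Proof.
move=> s c; have [r Pr] := Phi_i1_id_neq0; have a0 := a_neq0 Ha.
(* The coefficient [th / a] gives the outward leg the rotation angle [th]; [mu] solves the linear
   equation for a vanishing d-coordinate at height [s + t + r]. *)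
pose mu := - (th / a) * Phi r idxd idxd / Phi r idx1 idxd.
pose x := ((th / a) *: dl idxd + mu *: dl idx1) *m Phi (- (s + t)).
have xn : x 0 idxn = 0 by rewrite /x mul_Phi_in !coefmxE !idxE /= !mulr0 addr0.
have x1 : a * fc (s + t) x idxd = th.
  rewrite fcoordE /x -mulmxA PhiVl mulmx1 !coefmxE !idxE /= mulr0 addr0 mulr1.
  by rewrite mulrC divfK.
have x2 : fc (s + t + r) x idxd = 0.
  rewrite fcoordE /x PhiD -mulmxA [Phi (- _) *m _]mulmxA PhiVl mul1mx mulmxDl -!scalemxAl.
  by rewrite addmx_coef !scalemx_coef !delta_mulmxE /mu divfK // mulNr addrN.
set u' := (X in parallel_transport _ _ _ _ X).
pose p1 := p + t *: e; pose p2 := p1 + x; pose p3 := p2 + r *: e; pose p4 := p3 + - x.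
have le : last_coord e = 1 by rewrite /last_coord coefmxE !eqxx.
have lx : last_coord x = 0 by [].
have l1 : last_coord p1 = s + t by rewrite linearD linearZ /= le [_ *: _]mulr1.
have l2 : last_coord p2 = s + t by rewrite linearD /= l1 lx addr0.
have l3 : last_coord p3 = s + t + r by rewrite linearD linearZ /= l2 le [_ *: _]mulr1.
have l4 : last_coord p4 = s + t + r by rewrite linearB /= l3 lx subr0.
have p5 : p4 + (- (t + r)) *: e = p.
  by apply/rowP => i; rewrite /p4 /p3 /p2 /p1 !(addmx_coef, oppmx_coef, scalemx_coef); ring.
apply: (parallel_transport_vertical Ha (t := t) (erefl s)); rewrite -/p1.
apply: (parallel_transport_horizontal Ha l1 xn); rewrite x1 -/p2.
apply: (parallel_transport_vertical Ha (t := r) l2); rewrite -/p3.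
have xn' : (- x) 0 idxn = 0 by rewrite oppmx_coef xn oppr0.
apply: (parallel_transport_horizontal Ha l3 xn'); rewrite -/p4.
apply: (parallel_transport_vertical Ha (t := - (t + r)) l4); rewrite p5.
set u1 := vertical_transport a s t u.
set u2 := horizontal_transport a (s + t) th u1.
set u3 := vertical_transport a (s + t) r u2.
have -> : horizontal_transport a (s + t + r) (a * fc (s + t + r) (- x) idxd) u3 = u3.
  rewrite /horizontal_transport fcoordN x2 oppr0 mulr0 cos0 sin0 subrr !mul0r subrr addr0.
  by rewrite !scale0r !addr0.
suff -> : vertical_transport a (s + t + r) (- (t + r)) u3 = u' by exact: parallel_transport_cst.
have E1 : vertical_transport a (s + t + r) (- (t + r)) u3 = u2 *m Phi (s + t) *m E (- t) *m Phi (- s).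
  rewrite /vertical_transport /u3 /vertical_transport.
  have -> : s + t + r + - (t + r) = s by ring.
  rewrite -[_ *m Phi (- (s + t + r)) *m _]mulmxA PhiVl mulmx1 -[_ *m E r *m _]mulmxA -expmxD.
  by have -> : r - (t + r) = - t by ring.
have E2 : u1 *m Phi (s + t) = u *m Phi s *m E t.
  by rewrite /u1 /vertical_transport -mulmxA PhiVl mulmx1.
have c1 : fc (s + t) u1 idxd = c by rewrite fcoordE E2.
have n1 : u1 0 idxn = u 0 idxn.
  by rewrite /u1 /vertical_transport mul_Phi_in mul_expW_in mul_Phi_in.
rewrite E1 /u2 /horizontal_transport c1 n1 !mulmxDl E2 -!scalemxAl frameE -[_ *m Phi (- (s + t)) *m _]mulmxA.
rewrite PhiVl mulmx1 !delta_in_Phi delta_in_expW delta_in_Phi.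
rewrite -[_ *m E t *m E (- t)]mulmxA expmxN mulmx1 -[u *m _ *m _]mulmxA PhiVr mulmx1.
by rewrite addrA.
Qed.

Lemma irreducible_gG : irreducible_metric g.
Proof.
move=> p V inv; set s := last_coord p; have a0 := a_neq0 Ha.
pose inV (z : 'rV[R]_N) := (z *m Phi (- s) <= V)%MS.
have inVP c z y : inV z -> inV y -> inV (c *: z + y).
  by move=> Vz Vy; rewrite /inV mulmxDl -scalemxAl addmx_sub // scalemx_sub.
pose rho t := dl idxd *m E (- t); pose al t (z : 'rV[R]_N) := (z *m E t) 0 idxd.
have loop t th z : inV z -> inV (z + ((cos th - 1) * al t z + sin th * z 0 idxn) *: rho t
       + ((cos th - 1) * z 0 idxn - sin th * al t z) *: e).
  move=> Vz; apply: inv Vz; have := parallel_transport_loop p t th (z *m Phi (- s)).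
  cbv zeta; rewrite -/s -[z *m Phi (- s) *m Phi s]mulmxA PhiVl mulmx1 mul_Phi_in.
  by rewrite !mulmxDl -!scalemxAl delta_in_Phi.
(* A half turn changes [z] by minus twice its projection onto the plane of [rho t] and [e]; combined
   with a quarter turn it also yields the rotated projection. *)
have rot t z : inV z -> inV (al t z *: rho t + z 0 idxn *: e) /\ inV (z 0 idxn *: rho t - al t z *: e).
  move=> Vz; have H1 : inV (al t z *: rho t + z 0 idxn *: e).
    have := inVP (-1 / 2) _ _ (inVP (-1) _ _ Vz (loop t pi z Vz)) (inVP (-1) _ _ Vz Vz).
    rewrite cospi sinpi; congr inV.
    by apply/rowP => i; rewrite !coefmxE; field.
  split=> //; have := inVP 1 _ _ H1 (inVP (-1) _ _ Vz (loop t (pi / 2) z Vz)).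
  rewrite cos_pihalf sin_pihalf; congr inV.
  by apply/rowP => i; rewrite !coefmxE; ring.
have [[z [t [Vz nz]]]|none] := pselect (exists z t, inV z /\ ~ (al t z = 0 /\ z 0 idxn = 0)).
  right; have Ve : inV e.
    have [H1 H2] := rot t z Vz.
    have S0 : al t z ^+ 2 + z 0 idxn ^+ 2 != 0.
      apply/negP; rewrite paddr_eq0 ?sqr_ge0 // !sqrf_eq0 => /andP[/eqP z1 /eqP z2].
      exact: nz.
    (* The two vectors given by [rot] form a nonzero multiple of a rotated orthonormal basis of the
       plane; inverting that rotation gives [e]. *)
    have := inVP ((al t z ^+ 2 + z 0 idxn ^+ 2)^-1 * z 0 idxn) _ _ H1
      (inVP (- (al t z ^+ 2 + z 0 idxn ^+ 2)^-1 * al t z) _ _ H2 (inVP (-1) _ _ Vz Vz)).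
    congr inV; apply/rowP => i; rewrite !coefmxE; field.
    exact: S0.
  have Vr t' : inV (rho t').
    have [_] := rot t' e Ve; rewrite /al delta_in_expW !coefmxE !eqxx id_neq_in /=.
    by rewrite scale1r scale0r subr0.
  have orth (c : 'cV[R]_N) : V *m c = 0 -> c = 0.
    move=> Vc; pose y := (Phi (- s) *m c)^T.
    have inV0 z0 : inV z0 -> z0 *m y^T = 0.
      rewrite /inV => /submxP[D E0]; rewrite /y trmxK mulmxA E0.
      by rewrite -mulmxA Vc mulmx0.
    suff y0 : y = 0.
      have <- : Phi s *m y^T = c by rewrite /y trmxK mulmxA PhiVr mul1mx.
      by rewrite y0 trmx0 mulmx0.
    (* Orthogonality to all [rho t] is stable under [W]: differentiating the vanishing function in
       [t] moves [W] onto the other factor, up to sign by skewness. *)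
    apply: (@skewA_cyclic _ _ _ a0 (fun y => y 0 idxn = 0 /\ forall t, (rho t *m y^T) 0 0 = 0)); last first.
    - split=> [|t']; last by rewrite inV0 // zeromx_coef.
      by have := inV0 _ Ve => /matrixP/(_ 0 0); rewrite delta_mulmxE trmx_coef zeromx_coef.
    - move=> x [xn xr]; split; first exact: mul_skewA_in.
      move=> t'; have D := is_derive_coef 0 0 (is_derive_mulmxr x^T (is_derive_mulmxl (dl idxd) (is_derive_expmxN W t'))).
      have E0 : (fun y : R => (dl idxd *m expmx (- y *: W) *m x^T) 0 0) = cst 0.
        by apply/funext => y'; rewrite xr.
      rewrite E0 in D; have := is_derive_unique D (is_derive_cst (0 : R) t' 1).
      rewrite expmx_commZ mulmxN mulNmx oppmx_coef => /eqP; rewrite oppr_eq0 => /eqP D0.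
      rewrite trmx_mul skewA_tr mulNmx mulmxN oppmx_coef /rho.
      by rewrite !mulmxA in D0 *; rewrite D0 oppr0.
    - move=> x [xn xr]; split=> //; have := xr 0.
      by rewrite /rho oppr0 scale0r expmx0 mulmx1 delta_mulmxE trmx_coef.
  apply/eqP; rewrite eqn_leq rank_leq_col /= -subn_eq0 -mxrank_coker mxrank_eq0.
  apply/eqP/matrixP => i j; have := orth (cokermx V *m delta_mx j 0).
  rewrite mulmxA mulmx_coker mul0mx => /(_ erefl)/colP/(_ i).
  by rewrite mulmx_deltaE !zeromx_coef.
left; apply/eqP; rewrite mxrank_eq0; apply/eqP/row_matrixP => i; rewrite row0.
(* Every row of [V], in frame coordinates, lies in this set, and differentiation in [t] shows that
   it is stable under [W]. *)
pose Z (z : 'rV[R]_N) := z 0 idxn = 0 /\ forall t, al t z = 0.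
have Zr : Z (row i V *m Phi s).
  have Vr : inV (row i V *m Phi s) by rewrite /inV -mulmxA PhiVr mulmx1 row_sub.
  split=> [|t]; apply: contrapT => H; apply: none.
    by exists (row i V *m Phi s), 0; split=> // -[].
  by exists (row i V *m Phi s), t; split=> // -[].
have Z0 : row i V *m Phi s = 0.
  apply: (@skewA_cyclic _ _ _ a0 Z) Zr => z [zn zt].
    by split=> //; have := zt 0; rewrite /al scale0r expmx0 mulmx1.
  split; first exact: mul_skewA_in.
  move=> t; have D := is_derive_coef 0 idxd (is_derive_mulmxl z (is_derive_expmx W t)).
  have E0 : (fun t : R => (z *m E t) 0 idxd) = cst 0 by apply/funext => t'; exact: zt.
  rewrite E0 in D; have := is_derive_unique D (is_derive_cst (0 : R) t 1).
  by rewrite mulmxA.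
by rewrite -[row i V]mulmx1 -(PhiVr k a s) mulmxA Z0 mul0mx.
Qed.

End Irreducible.

Theorem theorem9p6 (R : realType) (n : nat) (hn : (4 <= n)%N) (a : R)
    (ha : a ^+ 2 = 1 / (3 + (n%:R - 2) * (n%:R - 3))) :
  let k := (n - 2)%N in
  let g := gG k a in
  let M := 'rV[R]_(k + 1 + 1) in
  (injective (embG k a) /\
   range (embG k a) = connected_lie_subgroup (lie_algebra k a)) /\
  (riemannian_metric g /\ homogeneous g /\ simply_connected (R := R) M) /\
  irreducible_metric g /\
  (forall p : M, has_codim (nullity g p) 3) /\
  (forall p : M, has_codim (symmetric_subspace g p) 2) /\
  (let l0 : R := 0 in
   let l1 : R := - a ^+ 2 in
   let l2 : R := a ^+ 2 * ((-1 + Num.sqrt 5) / 2) in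
   let l3 : R := a ^+ 2 * ((-1 - Num.sqrt 5) / 2) in
   uniq [:: l0; l1; l2; l3] /\
   forall p : M,
     (forall l : R, eigenvalue (ricci_op g p) l <-> l \in [:: l0; l1; l2; l3]) /\
     \rank (eigenspace (ricci_op g p) l0) = (n - 3)%N /\
     \rank (eigenspace (ricci_op g p) l1) = 1%N /\
     \rank (eigenspace (ricci_op g p) l2) = 1%N /\
     \rank (eigenspace (ricci_op g p) l3) = 1%N) /\
  (exists p u v : M, row_free (col_mx u v) /\ 0 < sectional g p u v) /\
  (exists p u v : M, row_free (col_mx u v) /\ sectional g p u v < 0) /\
  (forall p : M,
     scalar_curvature g p = - 2 * a ^+ 2 /\
     scalar_curvature g p = - 2 / (3 + (n%:R - 2) * (n%:R - 3))).
Proof.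
(* With [n = m + 4] the parameter [k] of the preceding sections, where R^d is indexed by [k.+1 + 1],
   becomes [m.+1], that is n - 3. *)
case: n hn ha => [|[|[|[|m]]]] // _ ha; rewrite -[(m.+4 - 2)%N]/(m.+2) -[(m.+4 - 3)%N]/(m.+1).
move=> k g M.
have nE : 3 + (m.+4%:R - 2) * (m.+4%:R - 3) = 3 + m.+2%:R * m.+1%:R :> R.
  by rewrite -!natr1; ring.
have n0 : 3 + m.+2%:R * m.+1%:R != 0 :> R by rewrite gt_eqF // ltr_wpDr.
have Ha : a ^+ 2 * (3 + m.+2%:R * m.+1%:R) = 1.
  by rewrite ha nE mul1r mulVf.
split; first by split; [exact: embG_inj (a_neq0 Ha)|exact: range_embG].
split; first by split; [exact: riemannian_metric_gG|split; [exact: homogeneous_gG|exact: simply_connected_normed]].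
split; first exact: irreducible_gG.
split; first by move=> p; exact: codim_nullity.
split; first by move=> p; exact: codim_symmetric_subspace.
split.
  split; first exact: uniq_ricci_spectrum Ha.
  move=> p; have [H1 [r0 r1 r2 r3]] := ricci_spectrumP (ltn0Sn m) Ha p.
  by split; first exact: H1.
split; first exact: positive_sectional.
split; first exact: negative_sectional.
move=> p; rewrite scalar_curvatureE //; split=> //.
by rewrite ha mulrA mulr1.
Qed.
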